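(* Let $q\in L_{1,loc}(\mathbb{R}_+)$ be a complex-valued function, $\mathbb{R}_+=[0,+\infty)$, and suppose $q$ is sectorial: there exist $x_0\ge 0$, $q_0\in\mathbb{C}$ and $-\pi<\alpha\le\beta<\pi$ with $\beta-\alpha<\pi$ such that for all $x>x_0$ the values $q(x)-q_0$ lie in the sector $\alpha\le\arg(q(x)-q_0)\le\beta$. Let $l(y)=-y''+qy$, $$\mathscr{D}=\{y\in L_2(\mathbb{R}_+):\ y,y'\in AC_{loc}(\mathbb{R}_+),\ l(y)\in L_2(\mathbb{R}_+)\},$$ and for fixed $A,B\in\mathbb{C}$ with $|A|+|B|>0$ let $L_U$ be the operator in $L_2(\mathbb{R}_+)$ with domain $\mathscr{D}_U=\{y\in\mathscr{D}:\ Ay(0)+By'(0)=0\}$ acting by $L_Uy=l(y)$. Then $L_U$ has compact resolvent if and only if $q$ satisfies the Molchanov condition: for every infinite system of pairwise disjoint intervals $D_n\subset\mathbb{R}_+$ of equal length, $\int_{D_n}|q(x)|\,dx\to+\infty$ as $n\to\infty$.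
   Context: $AC_{loc}(\mathbb{R}_+)$ denotes functions absolutely continuous on every compact subinterval of $[0,+\infty)$. An operator has compact resolvent if its resolvent set is nonempty and its resolvent is a compact operator. *)

(* Defs.v *)
From HB Require Import structures.
From mathcomp Require Import all_boot all_order all_algebra.
From mathcomp Require Import all_classical all_reals all_analysis.
From mathcomp Require Import complex.
Set Implicit Arguments. Unset Strict Implicit. Unset Printing Implicit Defensive.
Import Order.TTheory GRing.Theory Num.Theory.
Import numFieldNormedType.Exports.
Local Open Scope classical_set_scope.
Local Open Scope ring_scope.
Local Open Scope complex_scope.

Section Defs.
Variable R : realType.
Local Notation C := R[i].
Local Notation mu := (@lebesgue_measure R).

Definition Rp : set R := `[(0:R), +oo[%classic.

Definition re (z : C) : R := let: Complex a _ := z in a.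
Definition im (z : C) : R := let: Complex _ b := z in b.

Definition cabs (z : C) : R := Num.sqrt (re z ^+ 2 + im z ^+ 2).

Definition L1loc (q : R -> C) : Prop :=
  forall b : R, 0 <= b ->
    mu.-integrable `[0, b] (fun x => (re (q x))%:E) /\
    mu.-integrable `[0, b] (fun x => (im (q x))%:E).

Definition arg_in (z : C) (alpha beta : R) : Prop :=
  exists r theta : R, 0 <= r /\ alpha <= theta <= beta /\
    re z = r * cos theta /\ im z = r * sin theta.

Definition sectorial (q : R -> C) : Prop :=
  exists (x0 : R) (q0 : C) (alpha beta : R),
    0 <= x0 /\ - pi < alpha /\ alpha <= beta /\ beta < pi /\ beta - alpha < pi /\
    forall x, x0 < x -> arg_in (q x - q0) alpha beta.

Definition abs_cont_on (a b : R) (f : R -> C) : Prop :=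
  forall e : R, 0 < e -> exists2 d : R, 0 < d &
    forall (n : nat) (s t : 'I_n -> R),
      (forall i, a <= s i /\ s i <= t i /\ t i <= b) ->
      (forall i j, i != j -> t i <= s j \/ t j <= s i) ->
      \sum_(i < n) (t i - s i) < d ->
      \sum_(i < n) cabs (f (t i) - f (s i)) < e.

Definition ACloc (f : R -> C) : Prop := forall b : R, 0 <= b -> abs_cont_on 0 b f.

Definition cderivable (f : R -> C) (x : R) : Prop :=
  derivable (fun t => re (f t)) x 1 /\ derivable (fun t => im (f t)) x 1.
Definition cderiv (f : R -> C) (x : R) : C :=
  Complex (derive1 (fun t => re (f t)) x) (derive1 (fun t => im (f t)) x).

(* f in L_2(R_+) (as a function; elements of L_2 are identified a.e.) *)
Definition L2 (f : R -> C) : Prop :=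
  measurable_fun Rp (fun x : R => re (f x)) /\
  measurable_fun Rp (fun x : R => im (f x)) /\
  (\int[mu]_(x in Rp) ((cabs (f x)) ^+ 2)%:E < +oo)%E.

Definition L2norm (f : R -> C) : R :=
  Num.sqrt (fine (\int[mu]_(x in Rp) ((cabs (f x)) ^+ 2)%:E)).

Definition ae_eq (f g : R -> C) : Prop :=
  {ae mu, forall x, 0 <= x -> f x = g x}.

Definition LU_graph (q : R -> C) (A B : C) (y g : R -> C) : Prop :=
  exists y1 : R -> C,
    ACloc y /\ ACloc y1 /\
    {ae mu, forall x, 0 < x -> cderivable y x /\ cderiv y x = y1 x} /\
    L2 y /\ L2 g /\
    {ae mu, forall x, 0 < x -> cderivable y1 x /\ g x = - cderiv y1 x + q x * y x} /\
    A * y 0 + B * y1 0 = 0.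

Definition resolvent_point (q : R -> C) (A B lam : C) : Prop :=
  (forall f, L2 f -> exists y g, LU_graph q A B y g /\
       ae_eq (fun x => g x - lam * y x) f) /\
  (forall y1 g1 y2 g2, LU_graph q A B y1 g1 -> LU_graph q A B y2 g2 ->
       ae_eq (fun x => g1 x - lam * y1 x) (fun x => g2 x - lam * y2 x) ->
       ae_eq y1 y2) /\
  (exists K : R, forall y g, LU_graph q A B y g ->
       L2norm y <= K * L2norm (fun x => g x - lam * y x)).

Definition compact_resolvent_at (q : R -> C) (A B lam : C) : Prop :=
  forall (f y : nat -> R -> C) (M : R),
    (forall n, L2 (f n)) -> (forall n, L2norm (f n) <= M) ->
    (forall n, exists g, LU_graph q A B (y n) g /\
        ae_eq (fun x => g x - lam * y n x) (f n)) ->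
    exists (phi : nat -> nat) (z : R -> C),
      (forall n, (phi n < phi n.+1)%N) /\ L2 z /\
      (fun n => L2norm (fun x => y (phi n) x - z x)) @ \oo --> (0 : R).

Definition has_compact_resolvent (q : R -> C) (A B : C) : Prop :=
  exists lam : C, resolvent_point q A B lam /\ compact_resolvent_at q A B lam.

Definition molchanov (q : R -> C) : Prop :=
  forall (h : R) (a : nat -> R), 0 < h -> (forall n, 0 <= a n) ->
    (forall n m, n != m -> [set` `[a n, a n + h[] `&` [set` `[a m, a m + h[] = set0) ->
    (fun n => (\int[mu]_(x in [set` `[a n, a n + h[%R]) (cabs (q x))%:E)%E) @ \oo --> +oo%E.

End Defs.

(* Main.v *)
Require Import Defs.
From HB Require Import structures.
From mathcomp Require Import all_boot all_order all_algebra.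
From mathcomp Require Import all_classical all_reals all_analysis.
From mathcomp Require Import measurable_realfun complex ring lra.
Set Implicit Arguments. Unset Strict Implicit. Unset Printing Implicit Defensive.
Import Order.TTheory GRing.Theory Num.Theory.
Import numFieldNormedType.Exports.
Local Open Scope classical_set_scope.
Local Open Scope ring_scope.

(** Write [f = l(y) - lam y].  After rotation by a unimodular [w] the sector condition reads
  [Re (w (q - q0)) >= k |q - q0|] far out, with [k > 0].  For [lam = q0 - t conj(w)], [t] large, integrating
  the derivative of [chi^2 Re (w y' conj(y))] with [chi x = 1 - eta x] bounds the energy
  [int |y'|^2 + |q| |y|^2 + |y|^2] by [int |f|^2].  Taking [eta = 0] and [y N = 0], the solutions of the
  truncated problems on [[0, N]] are bounded and their cluster point solves the equation; taking
  [eta = 1/N] and [N] to infinity, the estimate extends to the whole domain without any condition at infinity.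

  Sufficiency: on an interval of length [h] on which [int |q| >= 1/h], the mass of [|y|^2] is at most
  [2 h^2] times the energy; the Molchanov condition makes this available far out for arbitrarily small [h],
  so the tails are uniformly small and Arzela-Ascoli applies.

  Necessity: on disjoint intervals of equal length with bounded [int |q|], the solution of
  [l(u) = lam u], [u a = 1], [u' a = 0] stays close to [1] on a subinterval [[a, b]] of fixed length, and the functions
  [((x - a) (b - x))^2 u x] extended by [0] have disjoint supports, norms bounded below, and bounded [f]. *)

(** * Locally integrable functions on the half-line *)

Section LocalIntegral.
Variable R : realType.
Local Notation mu := (@lebesgue_measure R).
Local Notation I h a b := (\int[mu]_(x in `[a, b]) h x).
Implicit Types (f g h : R -> R).

(** The rotation must serve two terms at once: [re w > 0] keeps the coefficient of [|y'|^2]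
    positive, while [re (w (q - q0))] dominates [|q - q0|]. Both are possible because the sector,
    enlarged to contain the positive half-axis, still has opening below pi. With
    [lam = q0 - t conj(w)] one gets [w (q - lam) = w (q - q0) + t], so [t] adds a pure multiple of
    [|y|^2]. It pays for what has no sign: the boundary term at 0, at most a constant times
    [|y 0|^2], and the bounded region where the sector condition may fail. Both are controlled by
    the supremum of [chi^2 |y|^2], hence by a small multiple of the Dirichlet integral plus a large
    multiple of the mass. Square integrability of [y'] is not known beforehand, so the far boundary
    term is cut off by [chi]; the price is a constant times [eta] times the mass of [y], which
    vanishes in the limit. As [q] is only locally integrable, [l] of a smooth bump need not lie in
    [L2]. A polynomial times a solution [u] is used instead: the potential cancels, and only [u] and
    [u'] remain to be bounded. *)

Definition lint h := forall b : R, 0 <= b -> mu.-integrable `[0, b] (EFin \o h).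

Lemma itv_sub (a b c : R) : 0 <= a -> b <= c -> `[a, b] `<=` `[0, c].
Proof. by move=> a0 bc x /=; rewrite !in_itv/= => /andP[/(le_trans a0)-> /le_trans->]. Qed.

Lemma lint_itv h (a b : R) : lint h -> 0 <= a -> mu.-integrable `[a, b] (EFin \o h).
Proof.
move=> lh a0; apply: (integrableS _ _ _ (lh `|b| _)) => //.
by apply: itv_sub => //; exact: ler_norm.
Qed.

Lemma Rp_bigcup : @Rp R = \bigcup_n `[0, n%:R]%classic.
Proof.
apply/seteqP; split=> x /=; rewrite /Rp/= in_itv/= ?andbT.
  move=> x0; exists (Num.bound x) => //=.
  by rewrite in_itv/= x0/= ltW// archi_boundP.
by case=> n _ /=; rewrite in_itv/= => /andP[].
Qed.

Lemma lint_meas h : lint h -> measurable_fun (@Rp R) h.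
Proof.
move=> lh; rewrite Rp_bigcup; apply/measurable_fun_bigcup => // n.
by apply/measurable_EFinP; exact: (measurable_int mu (lh n%:R _)).
Qed.

Lemma lint_le f g : measurable_fun (@Rp R) f -> lint g ->
  (forall x, 0 <= x -> `|f x| <= `|g x|) -> lint f.
Proof.
move=> mf lg fg b b0; apply: (le_integrable _ _ _ (lg b b0)) => //.
  apply/measurable_EFinP; apply: (measurable_funS _ _ mf) => //.
    exact: measurable_itv.
  by move=> x /=; rewrite /Rp/= !in_itv/= => /andP[->].
by move=> x /=; rewrite in_itv/= => /andP[x0 _]; rewrite lee_fin fg.
Qed.

Lemma lint_eq f g : (forall x, 0 <= x -> f x = g x) -> lint f -> lint g.
Proof.
move=> fg lf b b0; apply: (eq_integrable _ _ _ _ (lf b b0)) => // x.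
by rewrite inE/= in_itv/= => /andP[x0 _]; rewrite /= fg.
Qed.

Lemma lintD f g : lint f -> lint g -> lint (fun x => f x + g x).
Proof. by move=> lf lg b b0; apply: (integrableD _ (lf b b0) (lg b b0)). Qed.

Lemma lintZ (k : R) f : lint f -> lint (fun x => k * f x).
Proof. by move=> lf b b0; apply: (integrableZl _ k (lf b b0)). Qed.

Lemma lintN f : lint f -> lint (fun x => - f x).
Proof. by move=> /(lintZ (-1)); apply: lint_eq => x _; rewrite mulN1r. Qed.

Lemma lintB f g : lint f -> lint g -> lint (fun x => f x - g x).
Proof. by move=> lf /lintN; exact: lintD. Qed.

Lemma lint_abs f : lint f -> lint (fun x => `|f x|).
Proof. by move=> lf b b0; apply: integrable_norm (lf b b0). Qed.

Lemma lint_cst (k : R) : lint (fun=> k).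
Proof.
move=> b b0; apply: measurable_bounded_integrable => //.
  by rewrite /= lebesgue_measure_itv/= lte_fin; case: ifP => // _; rewrite -EFinB ltry.
exact: bounded_cst.
Qed.

Lemma Ige0 h (a b : R) : (forall x, a <= x <= b -> 0 <= h x) -> 0 <= I h a b.
Proof. by move=> h0; apply: Rintegral_ge0 => x /=; rewrite in_itv/=; exact: h0. Qed.

Lemma Ieq f g (a b : R) : (forall x, a <= x <= b -> f x = g x) -> I f a b = I g a b.
Proof. by move=> fg; apply: eq_Rintegral => x; rewrite inE/= in_itv/=; exact: fg. Qed.

Lemma ID f g (a b : R) : lint f -> lint g -> 0 <= a ->
  I (fun x => f x + g x) a b = I f a b + I g a b.
Proof. by move=> lf lg a0; rewrite RintegralD//; exact: lint_itv. Qed.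

Lemma IB f g (a b : R) : lint f -> lint g -> 0 <= a ->
  I (fun x => f x - g x) a b = I f a b - I g a b.
Proof. by move=> lf lg a0; rewrite RintegralB//; exact: lint_itv. Qed.

Lemma IZ (k : R) f (a b : R) : lint f -> 0 <= a ->
  I (fun x => k * f x) a b = k * I f a b.
Proof. by move=> lf a0; rewrite RintegralZl//; exact: lint_itv. Qed.

Lemma Ile f g (a b : R) : lint f -> lint g -> 0 <= a ->
  (forall x, a <= x <= b -> f x <= g x) -> I f a b <= I g a b.
Proof.
move=> lf lg a0 fg; by apply: le_Rintegral => //; exact: lint_itv.
Qed.

Lemma Iabs f (a b : R) : lint f -> 0 <= a -> `|I f a b| <= I (fun x => `|f x|) a b.
Proof. by move=> lf a0; apply: le_normr_Rintegral => //; exact: lint_itv. Qed.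

Lemma Icst (k : R) (a b : R) : a <= b -> I (fun=> k) a b = k * (b - a).
Proof.
move=> ab; rewrite Rintegral_cst//= lebesgue_measure_itv/= lte_fin.
by case: ltgtP ab => // -> _; rewrite subrr.
Qed.

Lemma Ixx f (a : R) : I f a a = 0.
Proof. by rewrite set_itv1 Rintegral_set1. Qed.

Lemma Ichasles f (a b c : R) : lint f -> 0 <= a -> a <= b -> b <= c ->
  I f a c = I f a b + I f b c.
Proof.
move=> lf a0 ab bc; apply/eqP; rewrite addrC -subr_eq; apply/eqP.
rewrite Rintegral_itvB ?bnd_simp//; last exact: lint_itv.
by rewrite Rintegral_itv_obnd_cbnd//; apply: (integrableS _ _ _ (lint_itv c lf a0)) => //;
  apply: subset_itvr; rewrite bnd_simp.
Qed.

End LocalIntegral.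

(** * Absolutely continuous functions with zero derivative are constant *)

Section AbsoluteContinuity.
Variable R : realType.
Local Notation mu := (@lebesgue_measure R).
Local Notation I h a b := (\int[mu]_(x in `[a, b]) h x).
Implicit Types (f g h F : R -> R).

(** Cousin's lemma as an induction principle on intervals. Instead of producing a gauge-fine tagged
    partition, a predicate that is additive and holds on all short intervals around each point is
    carried from [a] to the supremum of the points reached, which cannot stay below [b]. *)
Lemma cousin (P : R -> R -> Prop) (a b : R) : a <= b ->
  (forall u v w : R, a <= u -> u <= v -> v <= w -> w <= b -> P u v -> P v w -> P u w) ->
  (forall x : R, a <= x <= b -> exists2 d : R, 0 < d &
     forall u v : R, a <= u -> u <= x -> x <= v -> v <= b -> v - u < d -> P u v) ->
  P a b.
Proof.
move=> ab Padd Ploc; pose S := [set x | a <= x <= b /\ P a x].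
have Sa : S a.
  split; first by rewrite lexx ab.
  have [|d d0 Pd] := Ploc a; first by rewrite lexx.
  by apply: Pd; rewrite ?lexx ?subrr.
have Sub : has_sup S.
  by split; [exists a|exists b => x [/andP[]]].
have as_ : a <= sup S by apply: ub_le_sup => //; case: Sub.
have sb : sup S <= b by apply: ge_sup; [exists a|move=> x [/andP[]]].
have [|d d0 Pd] := Ploc (sup S); first by rewrite as_.
have d20 : 0 < d / 2 by rewrite divr_gt0.
have [x [/andP[ax xb] Pax] sx] := sup_adherent d20 Sub.
have xs : x <= sup S by apply: ub_le_sup; [case: Sub|split=> //; rewrite ax].
pose v := Num.min b (sup S + d / 2).
have sv : sup S <= v by rewrite /v le_min sb lerDl ltW.
have vb : v <= b by rewrite /v ge_min lexx.
have Pv : P a v.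
  have [->//|xv] := eqVneq v x.
  apply: (Padd a x v) => //; first exact: le_trans sv.
  apply: Pd => //.
  have : v <= sup S + d / 2 by rewrite /v ge_min lexx orbT.
  lra.
have : v <= sup S by apply: ub_le_sup; [case: Sub|split=> //; rewrite vb (le_trans as_)].
rewrite {1}/v ge_min => /orP[bs|]; last by lra.
by rewrite (_ : b = v)//; apply/eqP; rewrite eq_le vb (le_trans bs).
Qed.

Definition rac (a b : R) (f : R -> R) : Prop :=
  forall e : R, 0 < e -> exists2 d : R, 0 < d &
    forall (n : nat) (s t : 'I_n -> R),
      (forall i, a <= s i /\ s i <= t i /\ t i <= b) ->
      (forall i j, i != j -> t i <= s j \/ t j <= s i) ->
      \sum_(i < n) (t i - s i) < d ->
      \sum_(i < n) `|f (t i) - f (s i)| < e.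

(** Families indexed by ['I_n] are awkward to concatenate; lists ordered from left to right are what
    the interval induction builds up. *)
Lemma rac_seq (a b : R) f : rac a b f -> forall e : R, 0 < e -> exists2 d : R, 0 < d &
  forall l : seq (R * R), all (fun p => [&& a <= p.1, p.1 <= p.2 & p.2 <= b]) l ->
    pairwise (fun p q => p.2 <= q.1) l ->
    \sum_(p <- l) (p.2 - p.1) < d -> \sum_(p <- l) `|f p.2 - f p.1| < e.
Proof.
move=> acf e e0; have [d d0 fd] := acf e e0; exists d => // l lab ldis.
rewrite !(big_nth (0, 0)) !big_mkord; apply: fd => [i|i j ij].
  by have /and3P[] := all_nthP (0, 0) lab i (ltn_ord i).
have /(pairwiseP (0, 0)) ld := ldis.
have [ij'|ji|/val_inj eij] := ltngtP i j; last by rewrite eij eqxx in ij.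
- by left; apply: ld => //; rewrite inE.
- by right; apply: ld => //; rewrite inE.
Qed.

Lemma derive0_local F (x : R) : derivable F x 1 -> derive1 F x = 0 ->
  forall e : R, 0 < e -> exists2 d : R, 0 < d &
    forall y : R, `|y - x| < d -> `|F y - F x| <= e * `|y - x|.
Proof.
move=> dF F0 e e0.
have : (fun k : R => k^-1 *: (F (k *: 1 + x) - F x)) @ 0^' --> 'D_1 F x := dF.
rewrite -derive1E F0 => /cvgrPdist_le /(_ e e0) [d /= d0 H].
exists d => // y yx; have [->|yx0] := eqVneq y x; first by rewrite !subrr normr0 mulr0.
have := H (y - x); rewrite /ball_ /= !sub0r !normrN => /(_ yx).
rewrite subr_eq0 => /(_ yx0); rewrite -/(_ *: _) [(y - x)%:A]mulr1 subrK.
by rewrite /GRing.scale/= normrM normfV mulrC ler_pdivrMr// normr_gt0 subr_eq0.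
Qed.

(* Gordon's gauge argument replaces the Vitali covering lemma: the exceptional null set is covered by an open set of small measure, where absolute continuity is used. *)
Lemma ac_derive0_cst F (a b : R) : a <= b -> rac a b F ->
  {ae mu, forall x : R, a < x < b -> derivable F x 1 /\ derive1 F x = 0} -> F b = F a.
Proof.
move=> ab acF [N [mN N0 subN]].
apply/eqP; rewrite -subr_eq0 -normr_eq0 eq_le normr_ge0 andbT.
apply/ler_addgt0Pr => e e0; rewrite add0r.
have ba1 : 0 < b - a + 1 by lra.
have [k k0 ke] : exists2 k : R, 0 < k & k * (b - a + 1) = e / 2.
  by exists (e / 2 / (b - a + 1)); rewrite ?divr_gt0// divfK// gt_eqF.
have e2 : 0 < e / 2 by rewrite divr_gt0.
have [d d0 acd] := rac_seq acF e2.
(* The endpoints join the exceptional set, since the derivative is controlled only inside []a,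
   b[]. *)
pose N' := N `|` [set a] `|` [set b].
have mN' : measurable N' by do 2 (apply: measurableU => //).
have N'0 : mu N' = 0%E.
  rewrite /N' measureU0//; last exact: lebesgue_measure_set1.
    by rewrite measureU0//; exact: lebesgue_measure_set1.
  exact: measurableU.
have N'lt : (mu N' < +oo)%E by rewrite N'0.
have [W [oO NO Od]] := lebesgue_regularity_outer mN' N'lt d0.
have mO : measurable W by apply: open_measurable.
have muO : (mu W < d%:E)%E.
  rewrite (_ : W = (W `\` N') `|` N'); last by rewrite setUC setDUK.
  by rewrite measureU0//; exact: measurableD.
(* The list [l] collects the pieces tagged by exceptional points. Their total length is charged to
   the part of [W] in []u, v]], half-open so that adjacent intervals do not share mass; all other
   pieces are paid for by the slope [k]. *)
pose P (u v : R) := exists l : seq (R * R),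
  [/\ all (fun p => [&& u <= p.1, p.1 <= p.2 & p.2 <= v]) l,
      pairwise (fun p q => p.2 <= q.1) l,
      ((\sum_(p <- l) (p.2 - p.1))%:E <= mu (W `&` `]u, v]))%E &
      `|F v - F u| <= k * (v - u) + \sum_(p <- l) `|F p.2 - F p.1|].
suff [l [l1 l2 l3 l4]] : P a b.
  have ls : \sum_(p <- l) (p.2 - p.1) < d.
    rewrite -lte_fin (le_lt_trans l3)// (le_lt_trans _ muO)//.
    by apply: le_measure; rewrite ?inE//; apply: measurableI.
  have {}ls := acd l l1 l2 ls.
  apply: (le_trans l4).
  lra.
apply: cousin => // [u v w au uv vw wb [l [l1 l2 l3 l4]] [j [k1 k2 k3 k4]]|x axb].
  exists (l ++ j); split.
  - rewrite all_cat; apply/andP; split.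
      by apply: sub_all l1 => p /and3P[-> -> /= /le_trans]; apply.
    by apply: sub_all k1 => p /and3P[/(le_trans uv) -> -> ->].
  - rewrite pairwise_cat l2 k2 !andbT; apply/allrelP => p q pl qk.
    have /and3P[_ _ pv] := allP l1 p pl; have /and3P[vq _ _] := allP k1 q qk.
    exact: le_trans vq.
  - rewrite big_cat/= EFinD (@itv_bndbnd_setU _ _ _ (BRight v))// setIUr.
    rewrite measureU//; [exact: leeD|exact: measurableI|exact: measurableI|].
    rewrite -subset0 => y [[_ /=]]; rewrite in_itv/= => /andP[_ yv] [_ /=].
    by rewrite in_itv/= ltNge yv.
  - by rewrite big_cat/=; have := ler_distD (F v) (F w) (F u); lra.
(* At an exceptional tag the whole short interval lies in [W] and becomes the list; at any other tag
   the vanishing derivative gives slope [k] and the list is empty. *)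
have [xN|xN] := pselect (N' x).
  have [r r0 rO] : exists2 r : R, 0 < r & ball x r `<=` W.
    by have /nbhs_ballP[r /= r0 rO] := open_nbhs_nbhs (conj oO (NO _ xN)); exists r.
  exists r => // u v au ux xv vb uvr; exists [:: (u, v)]; split => //=.
  - by rewrite !lexx (le_trans ux).
  - rewrite big_seq1/= setIidr; first by rewrite lebesgue_measure_itv/= lte_fin;
      case: ltgtP (le_trans ux xv) => // -> _; rewrite subrr.
    move=> y /=; rewrite in_itv/= => /andP[uy yv]; apply: rO.
    by rewrite /ball/= ltr_distl; apply/andP; split; lra.
  - by rewrite big_seq1/= lerDr mulr_ge0 ?(ltW k0)// subr_ge0 (le_trans ux).
have xab : a < x < b.
  case/andP: axb => ax xb; rewrite !lt_neqAle ax xb !andbT.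
  by apply/andP; split; apply/eqP => E; apply: xN; [left; right|right].
have [dx Fx] : derivable F x 1 /\ derive1 F x = 0.
  by apply: contrapT => nd; apply: xN; left; left; apply: subN => /= /(_ xab).
have [r r0 rF] := derive0_local dx Fx k0.
exists r => // u v au ux xv vb uvr; exists [::]; split => //.
  by rewrite big_nil.
rewrite big_nil addr0.
have Hv := rF v; have Hu := rF u.
rewrite ger0_norm ?subr_ge0// in Hv; rewrite ler0_norm ?subr_le0// in Hu.
have {}Hv : `|F v - F x| <= k * (v - x) by apply: Hv; lra.
have {}Hu : `|F u - F x| <= k * - (u - x) by apply: Hu; lra.
by have := ler_distD (F x) (F v) (F u); rewrite (distrC (F x) (F u)); lra.
Qed.

End AbsoluteContinuity.

(** * Indefinite integrals *)

Section Primitives.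
Variable R : realType.
Local Notation mu := (@lebesgue_measure R).
Local Notation I h a b := (\int[mu]_(x in `[a, b]) h x).
Implicit Types (f g h k F : R -> R).

(** An absolutely continuous function is carried together with an integrable density, so that sums,
    products and integration by parts become identities between explicit pairs. *)
Definition prim f h : Prop :=
  lint h /\ forall x : R, 0 <= x -> f x = f 0 + I h 0 x.

Lemma prim_lint f h : prim f h -> lint h.
Proof. by case. Qed.

Lemma primB_itv f h (a b : R) : prim f h -> 0 <= a -> a <= b -> f b - f a = I h a b.
Proof.
move=> [lh fh] a0 ab; rewrite (fh b) ?(le_trans a0)// (fh a)//.
by rewrite (Ichasles lh _ a0 ab)//; lra.
Qed.

Lemma lint_restrict h (b : R) : lint h -> 0 <= b -> mu.-integrable setT (EFin \o (h \_ `[0, b])).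
Proof.
by move=> lh b0; rewrite -restrict_EFin; apply/integrable_restrict => //=; rewrite setTI; exact: lh.
Qed.

(** Absolute continuity of the integral, applied to the union [D] of the disjoint intervals []s i, t
    i]], whose measure is the sum of their lengths. *)
Lemma prim_rac f h (b : R) : prim f h -> 0 <= b -> rac 0 b f.
Proof.
move=> pf b0 e e0; have lh := prim_lint pf.
have ib := lint_restrict lh b0.
have [d [d0 dP]] := integral_normr_continuous ib e0.
exists d => // n s t st dis sd.
pose F (i : 'I_n) : set R := `]s i, t i]%classic.
pose D := \big[setU/set0]_(i < n) F i.
have mF i : measurable (F i) by exact: measurable_itv.
have mD : measurable D by apply: bigsetU_measurable.
have tF : trivIset [set: 'I_n] F.
  apply/trivIsetP => i j _ _ ij; rewrite -subset0 => x []; rewrite /F /= !in_itv/=.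
  by have [|] := dis i j ij; move=> H /andP[? ?] /andP[? ?]; lra.
have muF i : mu (F i) = (t i - s i)%:E.
  rewrite /F lebesgue_measure_itv/= lte_fin; have [_ [+ _]] := st i.
  by case: ltgtP => // ->; rewrite subrr.
have muD : (mu D < d%:E)%E.
  rewrite /D (@measure_semi_additive_ord _ _ _ mu n F)//.
  rewrite (eq_bigr (fun i => (t i - s i)%:E)) => [|i _]; last exact: muF.
  by rewrite sumEFin lte_fin.
apply: le_lt_trans (dP D mD muD).
set g := h \_ `[0, b] in dP ib *.
have mg : measurable_fun setT (fun x => `|g x|%:E).
  by apply/measurable_EFinP; apply: measurableT_comp => //; apply/measurable_EFinP; exact: (measurable_int mu ib).
have intF i : mu.-integrable (F i) (EFin \o (fun x => `|g x|)).
  by apply: (integrableS _ _ _ (integrable_norm ib)) => //; exact: mF.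
rewrite /Rintegral /D (@ge0_integral_bigsetU _ _ _ mu _ F)//; first last.
- by apply: measurable_funS mg.
- by apply: sub_trivIset tF.
- exact: index_enum_uniq.
rewrite (eq_bigr (fun i => (I (fun x => `|h x|) (s i) (t i))%:E)); last first.
  move=> i _; have [si [sti tib]] := st i.
  rewrite -[LHS]fineK; last by apply: integrable_fin_num; [exact: mF|exact: (intF i)].
  congr EFin; rewrite -/(Rintegral mu (F i) (fun x => `|g x|)) /F Rintegral_itv_obnd_cbnd; last exact: (intF i).
  apply: Ieq => x /andP[sx xt]; rewrite /g patchE mem_set//= in_itv/=.
  by rewrite (le_trans si sx) (le_trans xt tib).
rewrite sumEFin/=; apply: ler_sum => i _; have [si [sti tib]] := st i.
by rewrite (primB_itv pf)//; apply: Iabs.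
Qed.

(** Lebesgue's form of the fundamental theorem for [h] extended by 0 to the negative half-line. Only
    to the right of 0 does [f] agree near [x] with a constant plus that primitive, hence the
    restriction to [0 < x]. *)
Lemma prim_ae f h : prim f h ->
  {ae mu, forall x : R, 0 < x -> derivable f x 1 /\ derive1 f x = h x}.
Proof.
move=> [lh fh].
have mh : measurable_fun setT (h \_ (@Rp R)).
  by apply/(measurable_restrictT _ _).1; [exact: measurable_itv|exact: lint_meas].
have E (c : R) : {in `]-oo, c], h \_ (@Rp R) =1 h \_ `[0, c]}.
  move=> x; rewrite in_itv/= => xc; rewrite !patchE.
  have -> // : (x \in @Rp R) = (x \in `[0, c]%classic).
  by rewrite /Rp; apply/idP/idP; rewrite !inE/= !in_itv/= ?xc ?andbT.
have := @FTC1 R (h \_ (@Rp R)) (BLeft 0).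
case.
- move=> y; have [y0|y0] := leP 0 y; last first.
    by rewrite set_itv_ge ?bnd_simp -?ltNge//; exact: integrable_set0.
  apply: eq_integrable (lh y y0) => // x.
  by rewrite inE/= in_itv/= => /andP[x0 _] /=; rewrite patchE mem_set//= /Rp/= in_itv/= x0.
- split; [exact: mh|exact: openT|] => K _ cK.
  have [M [Mr MP]] := compact_bounded cK.
  have KM : K `<=` `[- (`|M| + 1), `|M| + 1].
    move=> x Kx /=; rewrite in_itv/= -ler_norml.
    by apply: (MP (`|M| + 1)) => //; rewrite (le_lt_trans (ler_norm M))// ltrDl.
  have M0 : 0 <= `|M| + 1 by rewrite addr_ge0.
  have /integrableP[_] := integrable_norm (lint_restrict lh M0).
  apply: le_lt_trans.
  rewrite [leRHS](_ : _ = \int[mu]_x `|(h \_ `[0, (`|M| + 1)%R]) x|%:E)%E; last first.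
    by apply: eq_integral => x _; rewrite /= normr_id.
  have mM : measurable_fun setT (fun x => `|(h \_ `[0, `|M| + 1]) x|%:E).
    by apply/measurable_EFinP; apply: measurableT_comp => //; apply/measurable_EFinP;
      exact: (measurable_int mu (lint_restrict lh M0)).
  apply: (@le_trans _ _ (\int[mu]_(x in K) `|(h \_ `[0, `|M| + 1]) x|%:E)%E).
    apply: ge0_le_integral => //.
    + exact: compact_measurable.
    + by apply/measurable_EFinP; apply: measurableT_comp => //; exact: measurable_funS mh.
    + exact: measurable_funS mM.
    + move=> x /KM /=; rewrite in_itv/= => /andP[_ xM].
      by rewrite (E (`|M| + 1)) ?in_itv.
  by apply: ge0_subset_integral => //; exact: compact_measurable.
move=> N [mN N0 sN]; exists N; split => // x /= nx; apply: sN => /= H; apply: nx => x0.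
have [] := H; first by rewrite lte_fin.
rewrite patchE mem_set/=; last by rewrite /Rp/= in_itv/= ltW.
set G := (X in derivable X _ _) => dG GE.
have nfG : {near x, (cst (f 0) + G) =1 f}.
  near=> y.
  have y0 : 0 <= y.
    suff : y \in `]0, +oo[ by rewrite in_itv/= andbT => /ltW.
    by near: y; apply: near_in_itvoy; rewrite in_itv/= x0.
  rewrite (fh y y0); change (f 0 + G y = f 0 + I h 0 y); congr (_ + _); rewrite /G; apply: Ieq => z /andP[z0 _].
  by rewrite patchE mem_set//= /Rp/= in_itv/= z0.
have dc : derivable (cst (f 0) : R -> R) x 1 by exact: derivable_cst.
have dcG : derivable (cst (f 0) + G) x 1 by exact: derivableD.
split; first exact: near_eq_derivable nfG dcG.
have -> : derive1 f x = derive1 (cst (f 0) + G) x.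
  by rewrite !derive1E; apply/esym/near_eq_derive.
by rewrite derive1E (deriveD dc dG) derive_cst add0r -[LHS]derive1E.
Unshelve. all: by end_near. Qed.

Lemma racB (a b : R) f g : rac a b f -> rac a b g -> rac a b (fun x => f x - g x).
Proof.
move=> af ag e e0; have e2 : 0 < e / 2 by rewrite divr_gt0.
have [d d0 dP] := af _ e2; have [c c0 cP] := ag _ e2.
exists (Num.min d c); first by rewrite lt_min d0 c0.
move=> n s t st dis; rewrite lt_min => /andP[sd sc].
have := dP n s t st dis sd; have := cP n s t st dis sc.
set X := \sum_(i < n) _ => X2; set Y := \sum_(i < n) _ => Y2.
suff : \sum_(i < n) `|f (t i) - g (t i) - (f (s i) - g (s i))| <= Y + X by lra.
rewrite -big_split/=; apply: ler_sum => i _.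
rewrite (_ : _ - _ - _ = (f (t i) - f (s i)) - (g (t i) - g (s i))); last by lra.
exact: ler_normB.
Qed.

Lemma racM (a b M : R) f g : rac a b f -> rac a b g ->
  (forall x : R, a <= x <= b -> `|f x| <= M /\ `|g x| <= M) ->
  rac a b (fun x => f x * g x).
Proof.
move=> af ag fgM e e0.
have M1 : 0 < `|M| + 1 by rewrite ltr_wpDl.
have e2 : 0 < e / 2 / (`|M| + 1) by rewrite !divr_gt0.
have [d d0 dP] := af _ e2; have [c c0 cP] := ag _ e2.
exists (Num.min d c); first by rewrite lt_min d0 c0.
move=> n s t st dis; rewrite lt_min => /andP[sd sc].
have := dP n s t st dis sd; have := cP n s t st dis sc.
set X := \sum_(i < n) _ => X2; set Y := \sum_(i < n) _ => Y2.
apply: (@le_lt_trans _ _ ((`|M| + 1) * (Y + X))); last first.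
  by move: X2 Y2; rewrite !ltr_pdivlMr// => X2 Y2; lra.
rewrite -big_split/= mulr_sumr; apply: ler_sum => i _.
have [si [sti tib]] := st i.
have MM : M <= `|M| by exact: ler_norm.
have [fs gs] : `|f (s i)| <= M /\ `|g (s i)| <= M by apply: fgM; rewrite si (le_trans sti).
have [ft gt_] : `|f (t i)| <= M /\ `|g (t i)| <= M by apply: fgM; rewrite tib (le_trans si).
rewrite (_ : _ - _ = f (t i) * (g (t i) - g (s i)) + g (s i) * (f (t i) - f (s i))); last by ring.
apply: le_trans (ler_normD _ _) _; rewrite !normrM mulrDr addrC.
by apply: lerD; apply: ler_wpM2r => //; lra.
Qed.

(** [F] minus the primitive of [h] is absolutely continuous with derivative 0 almost everywhere,
    hence constant by [ac_derive0_cst]. This turns the almost-everywhere conditions defining the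
    operator into integral identities. *)
Lemma ftc_ac F h : (forall b, 0 <= b -> rac 0 b F) -> lint h ->
  {ae mu, forall x : R, 0 < x -> derivable F x 1 /\ derive1 F x = h x} -> prim F h.
Proof.
move=> aF lh dF; split => // b b0.
pose G x := I h 0 x.
have pG : prim G h by split => // x x0; rewrite /G Ixx add0r.
have : F b - G b = F 0 - G 0.
  apply: (ac_derive0_cst b0 (F := fun x => F x - G x)).
    by apply: racB; [exact: aF|exact: prim_rac pG b0].
  have dG := prim_ae pG.
  move: dF dG => [N [mN N0 sN]] [N' [mN' N'0 sN']]; exists (N `|` N'); split.
  - exact: measurableU.
  - by rewrite measureU0.
  - move=> x /= nx; have [?|xN] := pselect (N x); first by left.
    have [?|xN'] := pselect (N' x); first by right.
    exfalso; apply: nx => /andP[x0 _].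
    have [dFx FE] : derivable F x 1 /\ derive1 F x = h x.
      by apply: contrapT => H; apply: xN; apply: sN => /= /(_ x0).
    have [dGx GE] : derivable G x 1 /\ derive1 G x = h x.
      by apply: contrapT => H; apply: xN'; apply: sN' => /= /(_ x0).
    split; first exact: derivableB.
    by rewrite derive1E (deriveB dFx dGx) -![in LHS]derive1E FE GE subrr.
by rewrite {2}/G Ixx subr0 /G; lra.
Qed.

Lemma prim_bounded f h (b : R) : prim f h -> exists M : R, 0 <= M /\
  forall x : R, 0 <= x <= b -> `|f x| <= M.
Proof.
move=> [lh fh]; exists (`|f 0| + I (fun x => `|h x|) 0 b).
split; first by apply: addr_ge0 => //; apply: Ige0.
move=> x /andP[x0 xb]; rewrite fh//; apply: le_trans (ler_normD _ _) _.
rewrite lerD2l (le_trans (Iabs _ _ _))// (@Ichasles _ _ 0 x b)//; last exact: lint_abs.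
by rewrite lerDl Ige0.
Qed.

Lemma prim_meas f h : prim f h -> measurable_fun (@Rp R) f.
Proof.
move=> [lh fh]; rewrite Rp_bigcup; apply/measurable_fun_bigcup => // n.
have n0 : 0 <= n%:R :> R by [].
have := parameterized_integral_continuous n0 (lh _ n0).
move/(@subspace_continuous_measurable_fun R _ _ (measurable_itv _)) => mI.
apply: (eq_measurable_fun (fun x : R => f 0 + I h 0 x)).
  by move=> x; rewrite inE/= in_itv/= => /andP[x0 _]; rewrite -fh.
exact: measurable_funD.
Qed.

Lemma lintM h f k : lint h -> prim f k -> lint (fun x => h x * f x).
Proof.
move=> lh pf b b0; have [M [M0 fM]] := prim_bounded b pf.
apply: (le_integrable _ _ _ (lintZ M lh b0)) => //.
- apply/measurable_EFinP; apply: measurable_funM.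
    by apply/measurable_EFinP; exact: (measurable_int mu (lh b b0)).
  apply: measurable_funS (prim_meas pf) => //; first exact: measurable_itv.
  by move=> x /=; rewrite /Rp/= !in_itv/= => /andP[->].
- move=> x /=; rewrite in_itv/= => xb; rewrite lee_fin !normrM mulrC (ger0_norm M0).
  by apply: ler_wpM2r => //; exact: fM.
Qed.

Lemma prim_lint_self f h : prim f h -> lint f.
Proof.
by move=> pf; apply: lint_eq (lintM (lint_cst 1) pf) => x _; rewrite mul1r.
Qed.

(** Both factors are bounded on [[0, b]], so the product is absolutely continuous, and the product
    rule holds wherever both are differentiable; [ftc_ac] concludes. The energy identities and the
    Wronskian rest on this rule. *)
Lemma primM f h g k : prim f h -> prim g k ->
  prim (fun x => f x * g x) (fun x => h x * g x + k x * f x).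
Proof.
move=> pf pg; apply: ftc_ac.
- move=> b b0; have [M [M0 fM]] := prim_bounded b pf; have [N [N0 gN]] := prim_bounded b pg.
  apply: (@racM _ _ (M + N)); [exact: prim_rac pf b0|exact: prim_rac pg b0|].
  by move=> x xb; have := fM x xb; have := gN x xb; split; lra.
- exact: lintD (lintM (prim_lint pf) pg) (lintM (prim_lint pg) pf).
have [N [mN N0 sN]] := prim_ae pf; have [N' [mN' N'0 sN']] := prim_ae pg.
exists (N `|` N'); split; [exact: measurableU|by rewrite measureU0|].
move=> x /= nx; have [?|xN] := pselect (N x); first by left.
have [?|xN'] := pselect (N' x); first by right.
exfalso; apply: nx => x0.
have [dFx FE] : derivable f x 1 /\ derive1 f x = h x.
  by apply: contrapT => H; apply: xN; apply: sN => /= /(_ x0).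
have [dGx GE] : derivable g x 1 /\ derive1 g x = k x.
  by apply: contrapT => H; apply: xN'; apply: sN' => /= /(_ x0).
split; first exact: derivableM.
rewrite derive1E (deriveM dFx dGx) -![in LHS]derive1E FE GE /GRing.scale/=; ring.
Qed.

Lemma primD f h g k : prim f h -> prim g k -> prim (fun x => f x + g x) (fun x => h x + k x).
Proof.
move=> [lh fh] [lk gk]; split; first exact: lintD.
by move=> x x0; rewrite fh// gk// ID//; lra.
Qed.

Lemma primZ (c : R) f h : prim f h -> prim (fun x => c * f x) (fun x => c * h x).
Proof.
move=> [lh fh]; split; first exact: lintZ.
by move=> x x0; rewrite fh// IZ//; lra.
Qed.

Lemma prim_cst (c : R) : prim (fun=> c) (fun=> 0).
Proof. by split; [exact: lint_cst|move=> x x0; rewrite Icst// mul0r addr0]. Qed.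

Lemma prim_id : prim (fun x => x) (fun=> 1).
Proof.
by split; [exact: lint_cst|move=> x x0; rewrite Icst// mul1r; lra].
Qed.

Lemma prim_eq f g h k : (forall x : R, 0 <= x -> f x = g x) ->
  (forall x : R, 0 <= x -> h x = k x) -> prim f h -> prim g k.
Proof.
move=> fg hk [lh fh]; split; first exact: lint_eq lh.
move=> x x0; rewrite -!fg// fh//; congr (_ + _); apply: Ieq => y /andP[y0 _]; exact: hk.
Qed.

End Primitives.

(** * Linear systems with locally integrable coefficients *)

Section LinearODE.
Variable R : realType.
Local Notation mu := (@lebesgue_measure R).
Local Notation I h a b := (\int[mu]_(x in `[a, b]) h x).
Implicit Types (f g h : R -> R).

Lemma lint_sum (T : Type) (s : seq T) (f : T -> R -> R) :
  (forall i, lint (f i)) -> lint (fun t => \sum_(i <- s) f i t).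
Proof.
move=> lf; elim: s => [|i s IH].
  by apply: lint_eq (lint_cst 0) => x _; rewrite big_nil.
by apply: lint_eq (lintD (lf i) IH) => x _; rewrite big_cons.
Qed.

Lemma prim_exp f h (n : nat) : prim f h ->
  prim (fun x => f x ^+ n.+1) (fun x => n.+1%:R * (h x * f x ^+ n)).
Proof.
move=> pf; elim: n => [|n IH]; first by apply: prim_eq pf => x _; rewrite ?expr1 ?expr0 ?mulr1 ?mul1r.
apply: prim_eq (primM pf IH) => x _; first by rewrite -exprS.
by rewrite -[n.+2]addn1 natrD !exprS; ring.
Qed.

Section System.
Variables (n : nat) (M : 'I_n -> 'I_n -> R -> R) (F : 'I_n -> R -> R) (x0 : 'I_n -> R).
Hypothesis lM : forall i j, lint (M i j).
Hypothesis lF : forall i, lint (F i).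

(** The terms of the Picard (Neumann) series rather than its iterates: term 0 is the initial value
    plus the integrated forcing, and each further term applies the Volterra operator of [M]. The
    solution is the sum of the series. *)
Fixpoint picard (k : nat) (i : 'I_n) (x : R) : R :=
  if k is k'.+1 then I (fun t => \sum_j M i j t * picard k' j t) 0 x
  else x0 i + I (F i) 0 x.

Lemma prim_picard k i :
  prim (picard k i) (if k is k'.+1 then fun t => \sum_j M i j t * picard k' j t else F i).
Proof.
elim: k i => [|k IH] i.
  by split => // x x0_; rewrite /= Ixx addr0.
split; last by move=> x x0_; rewrite /= Ixx add0r.
by apply: lint_sum => j; exact: lintM (lM i j) (IH j).
Qed.

Let m (t : R) := \sum_i \sum_j `|M i j t|.
Let P x := I m 0 x.

Let lm : lint m.
Proof. by apply: lint_sum => i; apply: lint_sum => j; exact: lint_abs. Qed.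

Let m0 t : 0 <= m t.
Proof. by apply: sumr_ge0 => i _; apply: sumr_ge0. Qed.

Let pP : prim P m.
Proof. by split => // x x0_; rewrite /P Ixx add0r. Qed.

Let P0 x : 0 <= P x.
Proof. by apply: Ige0 => *; exact: m0. Qed.

Let P_le x b : 0 <= x -> x <= b -> P x <= P b.
Proof. by move=> x0_ xb; rewrite /P (Ichasles lm _ x0_ xb)// lerDl; apply: Ige0 => *; exact: m0. Qed.

Let row_le_m i t : \sum_j `|M i j t| <= m t.
Proof.
by rewrite [leRHS](bigD1 i)//= lerDl; apply: sumr_ge0 => j _; apply: sumr_ge0.
Qed.

(** Induction on [k] with [P] the primitive of [m], the sum of all [|M i j|]: the density of
    [P ^ k.+1] is [k.+1 * m * P ^ k], so each integration produces the next coefficient of the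
    exponential series. *)
Lemma picard_bound b : 0 <= b -> exists2 D : R, 0 <= D &
  forall k i (x : R), 0 <= x <= b -> `|picard k i x| <= D * exp_coeff (P x) k.
Proof.
move=> b0.
have /choice[B HB] : forall i, exists B : R, 0 <= B /\ forall x : R, 0 <= x <= b -> `|picard 0 i x| <= B.
  by move=> i; exact: prim_bounded (prim_picard 0 i).
exists (\sum_i B i); first by apply: sumr_ge0 => i _; have [] := HB i.
elim=> [|k IH] i x /andP[x0_ xb].
  rewrite /exp_coeff/= expr0 fact0 divr1 mulr1.
  apply: (@le_trans _ _ (B i)); first by have [_] := HB i; apply; rewrite x0_.
  by rewrite [leRHS](bigD1 i)//= lerDl; apply: sumr_ge0 => j _; have [] := HB j.
set D := \sum_i B i in IH *.
have [lk _] := prim_picard k.+1 i.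
rewrite [picard _ _ _]/=; apply: le_trans (Iabs _ lk _) _ => //.
have lmP : lint (fun t => D / k`!%:R * (m t * P t ^+ k)).
  apply: lintZ; case: k {IH lk} => [|k]; first by apply: lint_eq lm => t _; rewrite expr0 mulr1.
  exact: lintM lm (prim_exp k pP).
apply: (@le_trans _ _ (I (fun t => D / k`!%:R * (m t * P t ^+ k)) 0 x)).
  apply: Ile => //; first exact: lint_abs.
  move=> t /andP[t0 tx]; apply: le_trans (ler_norm_sum _ _ _) _.
  apply: (@le_trans _ _ (\sum_j `|M i j t| * (D * exp_coeff (P t) k))).
    apply: ler_sum => j _; rewrite normrM; apply: ler_wpM2l => //.
    by apply: IH; rewrite t0 (le_trans tx).
  have E0 : 0 <= D * exp_coeff (P t) k.
    by apply: le_trans (IH i t _); rewrite ?t0 ?(le_trans tx).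
  rewrite -mulr_suml; apply: (@le_trans _ _ (m t * (D * exp_coeff (P t) k))).
    exact: ler_wpM2r (row_le_m i t).
  by rewrite /exp_coeff/= le_eqVlt; apply/orP; left; apply/eqP; ring.
have [lPk PkE] := prim_exp k pP.
have H : k.+1%:R * I (fun t => m t * P t ^+ k) 0 x = P x ^+ k.+1.
  rewrite -IZ//.
    by rewrite PkE// [P 0]Ixx expr0n/= add0r.
  have : lint (fun t => k.+1%:R^-1 * (k.+1%:R * (m t * P t ^+ k))) by exact: lintZ.
  by apply: lint_eq => t _; rewrite mulKf// pnatr_eq0.
have lmk : lint (fun t => m t * P t ^+ k).
  have : lint (fun t => k.+1%:R^-1 * (k.+1%:R * (m t * P t ^+ k))) by exact: lintZ.
  by apply: lint_eq => t _; rewrite mulKf// pnatr_eq0.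
rewrite IZ// /exp_coeff/= -H factS natrM.
rewrite [leRHS](_ : _ = D / k`!%:R * I (fun t => m t * P t ^+ k) 0 x)//.
have kn0 : (k.+1%:R : R) != 0 by rewrite pnatr_eq0.
have fn0 : (k`!%:R : R) != 0 by rewrite pnatr_eq0 -lt0n fact_gt0.
by move: (k.+1%:R : R) (k`!%:R : R) kn0 fn0 => u v u0 v0; field; rewrite u0 v0.
Qed.

Let S N i x := \sum_(k < N) picard k i x.

Let S_lint N i : lint (S N i).
Proof. by apply: lint_sum => k; exact: prim_lint_self (prim_picard k i). Qed.

Let lMS N i : lint (fun t => \sum_j M i j t * S N j t).
Proof.
apply: (@lint_eq _ (fun t => \sum_j \sum_(k < N) M i j t * picard k j t)).
  by move=> t _; apply: eq_bigr => j _; rewrite mulr_sumr.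
by apply: lint_sum => j; apply: lint_sum => k; exact: lintM (lM i j) (prim_picard k j).
Qed.

Let S_rec N i (x : R) : 0 <= x ->
  S N.+1 i x = x0 i + I (fun t => \sum_j M i j t * S N j t + F i t) 0 x.
Proof.
move=> x0_; rewrite ID//; elim: N => [|N IH].
  rewrite /S big_ord_recl big_ord0 addr0/= [X in _ = _ + (X + _)](_ : _ = 0) ?add0r//.
  rewrite -[RHS](mul0r (x - 0)) -(Icst 0 x0_); apply: Ieq => t _.
  by rewrite big1// => j _; rewrite big_ord0 mulr0.
have -> : I (fun t => \sum_j M i j t * S N.+1 j t) 0 x =
    I (fun t => \sum_j M i j t * S N j t) 0 x + picard N.+1 i x.
  rewrite -ID//; last by have [] := prim_picard N.+1 i.
  apply: Ieq => t _; rewrite -big_split/=; apply: eq_bigr => j _.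
  by rewrite /S big_ord_recr/= mulrDr.
have -> : S N.+2 i x = S N.+1 i x + picard N.+1 i x by rewrite /S big_ord_recr.
by rewrite IH; move: (picard _ _ _) => p; ring.
Qed.

(** The exponential series of [P b] majorizes the Picard series on [[0, b]] with a remainder [e N]
    independent of the point. The pointwise limit [X] is therefore measurable and locally bounded,
    and the integral equation passes to the limit. *)
Lemma linear_ode_exists : exists X : 'I_n -> R -> R, forall i,
  X i 0 = x0 i /\ prim (X i) (fun t => \sum_j M i j t * X j t + F i t).
Proof.
pose X (i : 'I_n) (x : R) : R := limn (fun N => S N i x).
have tail b : 0 <= b -> exists2 e : nat -> R, e @ \oo --> 0 &
    forall N i (x : R), 0 <= x <= b -> (fun K => S K i x) @ \oo --> X i x /\ `|X i x - S N i x| <= e N.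
  move=> b0; have [D D0 HD] := picard_bound b0.
  have bnd k i (x : R) : 0 <= x <= b -> `|picard k i x| <= D * exp_coeff (P b) k.
    move=> /andP[x0_ xb]; apply: le_trans (HD k i x _) _; first by rewrite x0_.
    apply: ler_wpM2l => //; rewrite /exp_coeff/= ler_wpM2r// ?invr_ge0//.
    by apply: lerXn2r; rewrite ?nnegrE ?P0// P_le.
  exists (fun N => D * (expR (P b) - series (exp_coeff (P b)) N)).
    rewrite -[X in _ --> X](mulr0 D) -(subrr (expR (P b))).
    apply: cvgMl_tmp; apply: cvgB; first exact: cvg_cst.
    exact: is_cvg_series_exp_coeff.
  move=> N i x xb.
  have cS : cvgn (series (fun k => D * exp_coeff (P b) k)).
    by apply: is_cvg_seriesZ; exact: is_cvg_series_exp_coeff.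
  have ES : (fun K => S K i x) = series (fun k => picard k i x).
    by apply/funext => K; rewrite /S /series/= big_mkord.
  have cX : cvgn ((fun K => S K i x)).
    rewrite ES; apply: normed_cvg; apply: series_le_cvg cS => k /=.
    - by [].
    - by rewrite mulr_ge0// exp_coeff_ge0.
    - exact: bnd.
  split; first exact: cX.
  have cD : (fun K => `|S K i x - S N i x|) @ \oo --> `|X i x - S N i x|.
    by apply: cvg_norm; apply: cvgB; [exact: cX|exact: cvg_cst].
  rewrite -(cvg_lim _ cD)//; apply: limr_le; first by apply/cvg_ex; eexists; exact: cD.
  near=> K.
  have NK : (N <= K)%N by near: K; exists N.
  apply: (@le_trans _ _ (D * (series (exp_coeff (P b)) K - series (exp_coeff (P b)) N))).
    rewrite -(subnKC NK) /series/= /S !big_mkord big_split_ord/= addrAC subrr add0r.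
    rewrite [in X in _ <= _ * X]big_split_ord/= addrAC subrr add0r mulr_sumr.
    by apply: le_trans (ler_norm_sum _ _ _) _; apply: ler_sum => k _; exact: bnd.
  apply: ler_wpM2l => //; rewrite lerD2r.
  apply: (nondecreasing_cvgn_le _ (@is_cvg_series_exp_coeff R (P b))).
  by apply: nondecreasing_series => k _ _; exact: exp_coeff_ge0.
have mX i : measurable_fun (@Rp R) (X i).
  apply: (@measurable_fun_cvg _ _ _ _ (fun N => S N i)).
    by move=> N; apply: lint_meas; exact: S_lint.
  move=> x; rewrite /Rp/= in_itv/= andbT => x0_.
  have [e _ H] := tail x x0_; have [] // := H 0%N i x.
  by rewrite x0_ lexx.
have bX b i : 0 <= b -> exists2 B : R, 0 <= B & forall x : R, 0 <= x <= b -> `|X i x| <= B.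
  move=> b0; have [e _ He] := tail b b0.
  exists `|e 0%N| => // x xb; have [_] := He 0%N i x xb.
  by rewrite /S big_ord0 subr0 => /le_trans; apply; exact: ler_norm.
have lMX i j : lint (fun t => M i j t * X j t).
  move=> b b0; have [B B0 HB] := bX b j b0.
  apply: (le_integrable _ _ _ (lintZ B (lM i j) b0)) => //.
    apply/measurable_EFinP; apply: measurable_funM.
      by apply/measurable_EFinP; exact: (measurable_int mu (lM i j b0)).
    apply: measurable_funS (mX j) => //; first exact: measurable_itv.
    by move=> x /=; rewrite /Rp/= !in_itv/= => /andP[->].
  move=> x /=; rewrite in_itv/= => xb; rewrite lee_fin !normrM mulrC (ger0_norm B0).
  by apply: ler_wpM2r => //; exact: HB.
have lMXs i : lint (fun t => \sum_j M i j t * X j t) by apply: lint_sum.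
have XE i (x : R) : 0 <= x -> X i x = x0 i + I (fun t => \sum_j M i j t * X j t + F i t) 0 x.
  move=> x0_; have [e e0 He] := tail x x0_.
  apply/eqP; rewrite -subr_eq0 -normr_eq0 eq_le normr_ge0 andbT.
  (* The defect of [X] in the integral equation is compared with the exact relation [S_rec] between
     consecutive partial sums. *)
  have key N : `|X i x - (x0 i + I (fun t => \sum_j M i j t * X j t + F i t) 0 x)| <= e N.+1 + P x * e N.
    apply: le_trans (ler_distD (S N.+1 i x) _ _) _; apply: lerD.
      by have [] := He N.+1 i x; rewrite ?x0_ ?lexx.
    rewrite S_rec// opprD addrACA subrr add0r -IB//; [|exact: lintD|exact: lintD].
    apply: le_trans (Iabs _ _ _) _ => //.
      by apply: lintB; apply: lintD.
    rewrite mulrC /P -IZ//; apply: Ile => //.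
    - by apply: lint_abs; apply: lintB; apply: lintD.
    - exact: lintZ.
    move=> t tx; rewrite opprD addrACA subrr addr0 -sumrB.
    apply: le_trans (ler_norm_sum _ _ _) _.
    apply: (@le_trans _ _ (\sum_j `|M i j t| * e N)).
      apply: ler_sum => j _; rewrite -mulrBr normrM; apply: ler_wpM2l => //.
      by rewrite distrC; have [] := He N j t tx.
    rewrite -mulr_suml mulrC; apply: ler_wpM2l; last exact: row_le_m.
    by apply: le_trans (normr_ge0 (X i t - S N i t)) _; have [] := He N i t tx.
  have c0 : (fun N => e N.+1 + P x * e N) @ \oo --> 0 + P x * 0.
    apply: cvgD; first by rewrite (cvg_shiftS e).
    exact: cvgMl_tmp.
  rewrite mulr0 addr0 in c0.
  apply: (ler_cvg_to (cvg_cst _) c0); first exact: nearW.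
exists X => i; split; first by rewrite XE// Ixx addr0.
split; first exact: lintD.
by move=> x x0_; rewrite XE// [X i 0]XE// Ixx addr0.
Unshelve. all: by end_near. Qed.

End System.
End LinearODE.

(** * Complex-valued functions and [L2] *)

Section ComplexParts.
Variable R : realType.
Local Notation mu := (@lebesgue_measure R).
Local Notation I h a b := (\int[mu]_(x in `[a, b]) h x).
Local Notation C := R[i].
Implicit Types (z w : C).

Lemma reD z w : re (z + w) = re z + re w. Proof. by case: z w => [a b] [c d]. Qed.
Lemma imD z w : im (z + w) = im z + im w. Proof. by case: z w => [a b] [c d]. Qed.
Lemma reN z : re (- z) = - re z. Proof. by case: z. Qed.
Lemma imN z : im (- z) = - im z. Proof. by case: z. Qed.
Lemma reB z w : re (z - w) = re z - re w. Proof. by rewrite reD reN. Qed.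
Lemma imB z w : im (z - w) = im z - im w. Proof. by rewrite imD imN. Qed.
Lemma reM z w : re (z * w) = re z * re w - im z * im w. Proof. by case: z w => [a b] [c d]. Qed.
Lemma imM z w : im (z * w) = re z * im w + im z * re w. Proof. by case: z w => [a b] [c d]. Qed.

Lemma complex_ext z w : re z = re w -> im z = im w -> z = w.
Proof. by case: z w => [a b] [c d] /= -> ->. Qed.

(** Squared modulus. Being polynomial in the two parts, it has a density as soon as they have one,
    and arithmetic on it avoids square roots. *)
Definition nsq z : R := re z ^+ 2 + im z ^+ 2.

Lemma nsq_ge0 z : 0 <= nsq z. Proof. by rewrite addr_ge0 ?sqr_ge0. Qed.

Lemma cabs_sqr z : cabs z ^+ 2 = nsq z.
Proof. by rewrite sqr_sqrtr// nsq_ge0. Qed.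

Lemma cabs_ge0 z : 0 <= cabs z. Proof. exact: sqrtr_ge0. Qed.

Lemma nsqM z w : nsq (z * w) = nsq z * nsq w.
Proof. by rewrite /nsq reM imM; ring. Qed.

Lemma nsqD_le z w : nsq (z + w) <= 2 * nsq z + 2 * nsq w.
Proof.
rewrite /nsq reD imD.
have := sqr_ge0 (re z - re w); have := sqr_ge0 (im z - im w); lra.
Qed.

Lemma nsqB_le z w : nsq (z - w) <= 2 * nsq z + 2 * nsq w.
Proof. by apply: le_trans (nsqD_le _ _) _; rewrite /nsq reN imN !sqrrN. Qed.

Lemma abs_le_of_nsq (b : R) z : nsq z <= b -> `|re z| <= b + 1 /\ `|im z| <= b + 1.
Proof.
rewrite /nsq => zb; split.
  have := sqr_ge0 (`|re z| - 1); rewrite sqrrB real_normK ?num_real//.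
  have := sqr_ge0 (im z); have := normr_ge0 (re z); lra.
have := sqr_ge0 (`|im z| - 1); rewrite sqrrB real_normK ?num_real//.
have := sqr_ge0 (re z); have := normr_ge0 (im z); lra.
Qed.

Lemma nsq_le_diff z w : nsq w <= 2 * nsq z + 2 * nsq (z - w).
Proof. by have := nsqB_le z (z - w); rewrite opprB addrC subrK. Qed.

Lemma nsq_eq0 z : nsq z = 0 -> z = 0.
Proof.
move=> /eqP; rewrite paddr_eq0 ?sqr_ge0// !sqrf_eq0 => /andP[/eqP a /eqP b].
exact: complex_ext.
Qed.

Lemma cabsM z w : cabs (z * w) = cabs z * cabs w.
Proof. by rewrite /cabs -!/(nsq _) nsqM sqrtrM ?nsq_ge0. Qed.

Lemma re_le_cabs z : `|re z| <= cabs z.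
Proof.
rewrite -(@ler_pXn2r _ 2)// ?nnegrE ?cabs_ge0// cabs_sqr real_normK ?num_real//.
by rewrite lerDl sqr_ge0.
Qed.

Lemma im_le_cabs z : `|im z| <= cabs z.
Proof.
rewrite -(@ler_pXn2r _ 2)// ?nnegrE ?cabs_ge0// cabs_sqr real_normK ?num_real//.
by rewrite lerDr sqr_ge0.
Qed.

Lemma cabs_le_re_im z : cabs z <= `|re z| + `|im z|.
Proof.
rewrite -(@ler_pXn2r _ 2)// ?nnegrE ?cabs_ge0// ?addr_ge0// cabs_sqr /nsq.
rewrite -(real_normK (num_real (re z))) -(real_normK (num_real (im z))).
by have := mulr_ge0 (normr_ge0 (re z)) (normr_ge0 (im z)); rewrite sqrrD; lra.
Qed.

Lemma cabs_le_sum (a b : R) z : `|re z| <= a -> `|im z| <= b -> cabs z <= a + b.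
Proof. by move=> ha hb; apply: le_trans (cabs_le_re_im z) _; exact: lerD. Qed.

Lemma cabsD z w : cabs (z + w) <= cabs z + cabs w.
Proof.
rewrite -(@ler_pXn2r _ 2)// ?nnegrE ?addr_ge0 ?cabs_ge0// cabs_sqr sqrrD !cabs_sqr.
suff : re z * re w + im z * im w <= cabs z * cabs w.
  by rewrite /nsq reD imD; lra.
rewrite -cabsM; apply: le_trans (ler_norm _) _.
have := re_le_cabs (z * Complex (re w) (- im w)).
by rewrite !cabsM reM/= mulrN opprK {2}/cabs /= sqrrN.
Qed.

Lemma cabsN z : cabs (- z) = cabs z.
Proof. by rewrite /cabs reN imN !sqrrN. Qed.

Lemma cabsB z w : cabs (z - w) <= cabs z + cabs w.
Proof. by apply: le_trans (cabsD _ _) _; rewrite cabsN. Qed.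

Lemma ACloc_parts (f : R -> C) :
  ACloc f <-> forall b : R, 0 <= b -> rac 0 b (fun x => re (f x)) /\ rac 0 b (fun x => im (f x)).
Proof.
split=> H b b0.
  have {}H := H b b0; split => e e0; have [d d0 dP] := H e e0; exists d => // n s t st dis sd.
    apply: le_lt_trans (dP n s t st dis sd); apply: ler_sum => i _.
    by rewrite -reB re_le_cabs.
  apply: le_lt_trans (dP n s t st dis sd); apply: ler_sum => i _.
  by rewrite -imB im_le_cabs.
move=> e e0; have e2 : 0 < e / 2 by rewrite divr_gt0.
have [r1 r2] := H b b0; have [d d0 dP] := r1 _ e2; have [c c0 cP] := r2 _ e2.
exists (Num.min d c); first by rewrite lt_min d0 c0.
move=> n s t st dis; rewrite lt_min => /andP[sd sc].
have := dP n s t st dis sd; have := cP n s t st dis sc.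
set X := \sum_(i < n) _ => X2; set Y := \sum_(i < n) _ => Y2.
apply: (@le_lt_trans _ _ (Y + X)); last by lra.
rewrite -big_split/=; apply: ler_sum => i _.
by rewrite -reB -imB cabs_le_re_im.
Qed.

Definition cprim (f h : R -> C) : Prop :=
  prim (fun x => re (f x)) (fun x => re (h x)) /\ prim (fun x => im (f x)) (fun x => im (h x)).

Lemma cprim_ACloc f h : cprim f h -> ACloc f.
Proof.
by move=> [p1 p2]; apply/ACloc_parts => b b0; split; [exact: prim_rac p1 b0|exact: prim_rac p2 b0].
Qed.

Lemma cprim_ae f h : cprim f h ->
  {ae mu, forall x : R, 0 < x -> cderivable f x /\ cderiv f x = h x}.
Proof.
move=> [/prim_ae[N [mN N0 sN]] /prim_ae[N' [mN' N'0 sN']]].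
exists (N `|` N'); split; [exact: measurableU|by rewrite measureU0|].
move=> x /= nx; have [?|xN] := pselect (N x); first by left.
have [?|xN'] := pselect (N' x); first by right.
exfalso; apply: nx => x0.
have [d1 E1] : derivable (fun t => re (f t)) x 1 /\ derive1 (fun t => re (f t)) x = re (h x).
  by apply: contrapT => H; apply: xN; apply: sN => /= /(_ x0).
have [d2 E2] : derivable (fun t => im (f t)) x 1 /\ derive1 (fun t => im (f t)) x = im (h x).
  by apply: contrapT => H; apply: xN'; apply: sN' => /= /(_ x0).
by split => //; apply: complex_ext.
Qed.

Lemma ACloc_cprim f h : ACloc f -> lint (fun x => re (h x)) -> lint (fun x => im (h x)) ->
  {ae mu, forall x : R, 0 < x -> cderivable f x /\ cderiv f x = h x} -> cprim f h.
Proof.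
move=> /ACloc_parts af l1 l2 [N [mN N0 sN]].
split; apply: ftc_ac => //; try by move=> b /af[].
- exists N; split => // x nx; apply: sN => /= H; apply: nx => /= x0.
  by have [[d1 d2] <-] := H x0.
- exists N; split => // x nx; apply: sN => /= H; apply: nx => /= x0.
  by have [[d1 d2] <-] := H x0.
Qed.

(** Monotone convergence along [[0, n]]. Together with [int_Rp_ge] it reduces membership in [L2] and
    norm estimates to real integrals over [[0, b]], bounded uniformly in [b]. *)
Lemma int_Rp_le (g : R -> R) (K : R) : lint g -> (forall x : R, 0 <= x -> 0 <= g x) ->
  (forall b : R, 0 <= b -> I g 0 b <= K) -> (\int[mu]_(x in @Rp R) (g x)%:E <= K%:E)%E.
Proof.
move=> lg g0 gK; rewrite Rp_bigcup.
have ne : nondecreasing_seq (fun n => `[0, n%:R]%classic : set R).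
  move=> n m nm; rewrite subsetEset => x /=; rewrite !in_itv/= => /andP[-> xn].
  by rewrite (le_trans xn)// ler_nat.
have mg n : measurable_fun (`[0, n%:R]%classic : set R) (EFin \o g).
  exact: (measurable_int mu (lg n%:R _)).
have gn0 (n : nat) (x : R) : `[0, n%:R]%classic x -> (0 <= (EFin \o g) x)%E.
  by rewrite /= in_itv/= => /andP[x0 _]; rewrite lee_fin g0.
have cg := @ge0_nondecreasing_set_cvg_integral _ (measurableTypeR R) R
  (fun n => `[0, n%:R]%classic : set R) (EFin \o g) mu ne (fun n => measurable_itv _) mg gn0.
rewrite -(cvg_lim _ cg)//; apply: lime_le.
  by apply/cvg_ex; eexists; exact: cg.
apply: nearW => n; rewrite -[leLHS]fineK; first by rewrite lee_fin; exact: gK.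
apply: integrable_fin_num; [exact: measurable_itv|exact: lg].
Qed.

Lemma int_Rp_ge (g : R -> R) (b : R) : measurable_fun (@Rp R) g -> (forall x : R, 0 <= x -> 0 <= g x) ->
  (\int[mu]_(x in @Rp R) (g x)%:E < +oo)%E ->
  lint g /\ I g 0 b <= fine (\int[mu]_(x in @Rp R) (g x)%:E).
Proof.
move=> mg g0 goo.
have ig : mu.-integrable (@Rp R) (EFin \o g).
  apply/integrableP; split; first exact/measurable_EFinP.
  apply: le_lt_trans goo; rewrite le_eqVlt; apply/orP; left; apply/eqP.
  by apply: eq_integral => x; rewrite inE/= /Rp/= in_itv/= andbT => /g0 x0 /=; rewrite ger0_norm.
have sub c : `[0, c] `<=` @Rp R by move=> x; rewrite /Rp/= !in_itv/= => /andP[->].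
have lg : lint g by move=> c c0; apply: (integrableS _ _ _ ig) => //; exact: measurable_itv.
split => //; apply: fine_le.
- apply: integrable_fin_num; first exact: measurable_itv.
  by apply: (integrableS _ _ _ ig) => //; exact: measurable_itv.
- by apply: integrable_fin_num ig; exact: measurable_itv.
- apply: ge0_subset_integral => //; first exact: measurable_itv.
    exact/measurable_EFinP.
  by move=> x; rewrite /Rp/= in_itv/= andbT => /g0; rewrite lee_fin.
Qed.

Lemma L2_lint f : L2 f -> [/\ lint (fun x => nsq (f x)), lint (fun x => re (f x)) & lint (fun x => im (f x))].
Proof.
move=> [m1 [m2 foo]].
have mn : measurable_fun (@Rp R) (fun x => nsq (f x)).
  by apply: measurable_funD; exact: measurable_funX.
have [ln _] : lint (fun x => nsq (f x)) /\ I (fun x => nsq (f x)) 0 0 <= fine (\int[mu]_(x in @Rp R) (nsq (f x))%:E).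
  apply: int_Rp_ge => //; first by move=> *; exact: nsq_ge0.
  by apply: le_lt_trans foo; rewrite le_eqVlt; apply/orP; left; apply/eqP; apply: eq_integral => x _; rewrite cabs_sqr.
have l1 := lintD (lint_cst 1) ln.
split => //; apply: (lint_le _ l1) => // x _.
- rewrite [leRHS]ger0_norm; last by rewrite addr_ge0// nsq_ge0.
  rewrite /nsq.
  have := sqr_ge0 (`|re (f x)| - 1); rewrite sqrrB real_normK ?num_real//.
  by have := sqr_ge0 (im (f x)); have := normr_ge0 (re (f x)); lra.
- rewrite [leRHS]ger0_norm; last by rewrite addr_ge0// nsq_ge0.
  rewrite /nsq.
  have := sqr_ge0 (`|im (f x)| - 1); rewrite sqrrB real_normK ?num_real//.
  by have := sqr_ge0 (re (f x)); have := normr_ge0 (im (f x)); lra.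
Qed.

Lemma L2norm_ge0 (f : R -> C) : 0 <= L2norm f. Proof. exact: sqrtr_ge0. Qed.

Lemma L2norm_sqr f : L2norm f ^+ 2 = fine (\int[mu]_(x in @Rp R) (nsq (f x))%:E).
Proof.
rewrite sqr_sqrtr; last by apply: fine_ge0; apply: integral_ge0 => x _; rewrite lee_fin sqr_ge0.
by congr fine; apply: eq_integral => x _; rewrite cabs_sqr.
Qed.

Lemma L2_int_le f (b : R) : L2 f -> I (fun x => nsq (f x)) 0 b <= L2norm f ^+ 2.
Proof.
move=> [m1 [m2 foo]]; rewrite L2norm_sqr.
have mn : measurable_fun (@Rp R) (fun x => nsq (f x)).
  by apply: measurable_funD; exact: measurable_funX.
have [] // : lint (fun x => nsq (f x)) /\ I (fun x => nsq (f x)) 0 b <= fine (\int[mu]_(x in @Rp R) (nsq (f x))%:E).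
apply: int_Rp_ge => //; first by move=> *; exact: nsq_ge0.
by apply: le_lt_trans foo; rewrite le_eqVlt; apply/orP; left; apply/eqP; apply: eq_integral => x _; rewrite cabs_sqr.
Qed.

Lemma L2_of_bound f (K : R) : measurable_fun (@Rp R) (fun x => re (f x)) ->
  measurable_fun (@Rp R) (fun x => im (f x)) -> lint (fun x => nsq (f x)) ->
  (forall b : R, 0 <= b -> I (fun x => nsq (f x)) 0 b <= K) -> L2 f /\ L2norm f ^+ 2 <= K.
Proof.
move=> m1 m2 ln H.
have le : (\int[mu]_(x in @Rp R) (nsq (f x))%:E <= K%:E)%E.
  by apply: int_Rp_le => // *; exact: nsq_ge0.
have E : (\int[mu]_(x in @Rp R) (cabs (f x) ^+ 2)%:E = \int[mu]_(x in @Rp R) (nsq (f x))%:E)%E.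
  by apply: eq_integral => x _; rewrite cabs_sqr.
split.
  by split => //; split => //; rewrite E (le_lt_trans le)// ltry.
rewrite L2norm_sqr -lee_fin fineK// ge0_fin_numE ?(le_lt_trans le) ?ltry//.
by apply: integral_ge0 => x _; rewrite lee_fin nsq_ge0.
Qed.

Lemma lint_nsq_prim f h : cprim f h -> lint (fun x => nsq (f x)).
Proof.
move=> [p1 p2].
apply: lint_eq (lintD (lintM (prim_lint_self p1) p1) (lintM (prim_lint_self p2) p2)) => x _.
by rewrite /nsq !expr2.
Qed.

End ComplexParts.

(** * Solutions of the differential equation *)

Section Solutions.
Variable R : realType.
Local Notation mu := (@lebesgue_measure R).
Local Notation I h a b := (\int[mu]_(x in `[a, b]) h x).
Local Notation C := R[i].
Implicit Types (p f q y g : R -> C).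

Definition clint f : Prop := lint (fun x => re (f x)) /\ lint (fun x => im (f x)).

Lemma clintD f g : clint f -> clint g -> clint (fun x => f x + g x).
Proof.
move=> [f1 f2] [g1 g2]; split.
  by apply: lint_eq (lintD f1 g1) => x _; rewrite reD.
by apply: lint_eq (lintD f2 g2) => x _; rewrite imD.
Qed.

Lemma clintZ (z : C) f : clint f -> clint (fun x => z * f x).
Proof.
move=> [f1 f2]; split.
  by apply: lint_eq (lintB (lintZ (re z) f1) (lintZ (im z) f2)) => x _; rewrite reM.
by apply: lint_eq (lintD (lintZ (re z) f2) (lintZ (im z) f1)) => x _; rewrite imM.
Qed.

Lemma clintB f g : clint f -> clint g -> clint (fun x => f x - g x).
Proof.
move=> cf /(clintZ (-1)) /(clintD cf); case=> [h1 h2].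
by split; [apply: lint_eq h1|apply: lint_eq h2] => x _; rewrite mulN1r.
Qed.

Lemma clint_cst (z : C) : clint (fun=> z).
Proof. by split; exact: lint_cst. Qed.

Lemma clintM p y y1 : clint p -> cprim y y1 -> clint (fun x => p x * y x).
Proof.
move=> [p1 p2] [a1 a2]; split.
  by apply: lint_eq (lintB (lintM p1 a1) (lintM p2 a2)) => x _; rewrite reM.
by apply: lint_eq (lintD (lintM p1 a2) (lintM p2 a1)) => x _; rewrite imM.
Qed.

Lemma lint_cabs f : clint f -> lint (fun x => cabs (f x)).
Proof.
move=> [f1 f2]; apply: (lint_le _ (lintD (lint_abs f1) (lint_abs f2))).
  apply: measurableT_comp; first by apply: continuous_measurable_fun; exact: sqrt_continuous.
  by apply: measurable_funD; apply: measurable_funX; exact: lint_meas.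
move=> x _; rewrite ger0_norm ?cabs_ge0// ger0_norm ?addr_ge0//.
exact: cabs_le_re_im.
Qed.

Lemma cprimD y y1 g g1 : cprim y y1 -> cprim g g1 -> cprim (fun x => y x + g x) (fun x => y1 x + g1 x).
Proof.
move=> [a1 a2] [b1 b2]; split.
  by apply: prim_eq (primD a1 b1) => x _; rewrite reD.
by apply: prim_eq (primD a2 b2) => x _; rewrite imD.
Qed.

Lemma cprimZ (z : C) y y1 : cprim y y1 -> cprim (fun x => z * y x) (fun x => z * y1 x).
Proof.
move=> [a1 a2]; split.
  by apply: prim_eq (primD (primZ (re z) a1) (primZ (- im z) a2)) => x _; rewrite reM mulNr.
by apply: prim_eq (primD (primZ (re z) a2) (primZ (im z) a1)) => x _; rewrite imM.
Qed.

Lemma cprimM y y1 g g1 : cprim y y1 -> cprim g g1 ->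
  cprim (fun x => y x * g x) (fun x => y1 x * g x + g1 x * y x).
Proof.
move=> [a1 a2] [b1 b2]; split.
  by apply: prim_eq (primD (primM a1 b1) (primZ (-1) (primM a2 b2))) => x _;
    rewrite ?reD !reM; ring.
by apply: prim_eq (primD (primM a1 b2) (primM a2 b1)) => x _; rewrite ?imD !imM; ring.
Qed.

Lemma cprim_eq y y1 g g1 : (forall x : R, 0 <= x -> y x = g x) ->
  (forall x : R, 0 <= x -> y1 x = g1 x) -> cprim y y1 -> cprim g g1.
Proof.
by move=> e1 e2 [a1 a2]; split; [apply: prim_eq a1|apply: prim_eq a2] => x x0; rewrite ?e1 ?e2.
Qed.

Lemma cprim_clint y y1 : cprim y y1 -> clint y.
Proof. by move=> [a1 a2]; split; [exact: prim_lint_self a1|exact: prim_lint_self a2]. Qed.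

(* The quasi-differential system of [- y'' + p y = f] on [0, +oo[, with [y1] standing for [y']. *)
Definition csol p f y y1 : Prop :=
  cprim y y1 /\ cprim y1 (fun x => p x * y x - f x).

Lemma csol_exists p f (z z1 : C) : clint p -> clint f ->
  exists y y1 : R -> C, [/\ y 0 = z, y1 0 = z1 & csol p f y y1].
Proof.
move=> [lp1 lp2] [lf1 lf2].
(* The unknowns are the real and imaginary parts of [y], then those of [y1]; the lower left block is
   multiplication by [p] as a real matrix. *)
pose M (i j : 'I_4) (t : R) : R := nth 0 (nth [::]
  [:: [:: 0; 0; 1; 0]; [:: 0; 0; 0; 1];
      [:: re (p t); - im (p t); 0; 0]; [:: im (p t); re (p t); 0; 0]] i) j.
pose F (i : 'I_4) (t : R) : R := nth 0 [:: 0; 0; - re (f t); - im (f t)] i.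
pose X0 (i : 'I_4) : R := nth 0 [:: re z; im z; re z1; im z1] i.
have lM i j : lint (M i j).
  case: i => [[|[|[|[|]]]] ?]//=; case: j => [[|[|[|[|]]]] ?]//=;
    rewrite /M/=; try exact: lint_cst; try exact: lp1; try exact: lp2; exact: lintN.
have lF i : lint (F i).
  by case: i => [[|[|[|[|]]]] ?]//=; rewrite /F/=; try exact: lint_cst; exact: lintN.
have [X HX] := linear_ode_exists X0 lM lF.
pose i0 : 'I_4 := Ordinal (isT : (0 < 4)%N); pose i1 : 'I_4 := Ordinal (isT : (1 < 4)%N).
pose i2 : 'I_4 := Ordinal (isT : (2 < 4)%N); pose i3 : 'I_4 := Ordinal (isT : (3 < 4)%N).
have E i t : \sum_j M i j t * X j t = M i i0 t * X i0 t + M i i1 t * X i1 t + M i i2 t * X i2 t + M i i3 t * X i3 t.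
  rewrite !big_ord_recl big_ord0 addr0 -!addrA.
  by congr (_ + (_ + (_ + _))); congr (M i _ t * X _ t); apply: val_inj.
have [X00 p0] := HX i0; have [X10 p1] := HX i1; have [X20 p2] := HX i2; have [X30 p3] := HX i3.
exists (fun t => Complex (X i0 t) (X i1 t)), (fun t => Complex (X i2 t) (X i3 t)).
split; [by rewrite X00 X10; apply: complex_ext|by rewrite X20 X30; apply: complex_ext|].
split; split.
- by apply: prim_eq p0 => x _ //=; rewrite E /M /F /=; ring.
- by apply: prim_eq p1 => x _ //=; rewrite E /M /F /=; ring.
- by apply: prim_eq p2 => x _ //; rewrite E /M /F reB reM /=; ring.
- by apply: prim_eq p3 => x _ //; rewrite E /M /F imB imM /=; ring.
Qed.

Lemma csolD p f g y y1 u u1 : csol p f y y1 -> csol p g u u1 ->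
  csol p (fun x => f x + g x) (fun x => y x + u x) (fun x => y1 x + u1 x).
Proof.
move=> [a1 a2] [b1 b2]; split; first exact: cprimD.
by apply: cprim_eq (cprimD a2 b2) => x _ //; ring.
Qed.

Lemma csolZ (z : C) p f y y1 : csol p f y y1 ->
  csol p (fun x => z * f x) (fun x => z * y x) (fun x => z * y1 x).
Proof.
move=> [a1 a2]; split; first exact: cprimZ.
by apply: cprim_eq (cprimZ z a2) => x _ //; ring.
Qed.

Lemma csol_eq p f g y y1 : (forall x : R, 0 <= x -> f x = g x) -> csol p f y y1 -> csol p g y y1.
Proof.
by move=> fg [a1 a2]; split => //; apply: cprim_eq a2 => x x0 //; rewrite fg.
Qed.

Lemma csolB p f g y y1 u u1 : csol p f y y1 -> csol p g u u1 ->
  csol p (fun x => f x - g x) (fun x => y x - u x) (fun x => y1 x - u1 x).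
Proof.
move=> [a1 a2] [b1 b2]; split.
  by apply: cprim_eq (cprimD a1 (cprimZ (-1) b1)) => x _ //; ring.
by apply: cprim_eq (cprimD a2 (cprimZ (-1) b2)) => x _ //; ring.
Qed.

(** Absolute continuity tested on a single interval is continuity, hence integrability on [[0, b]].
    It supplies the local integrability of [y'] that [ACloc_cprim] asks for. *)
Lemma rac_lint (f : R -> R) : (forall b : R, 0 <= b -> rac 0 b f) -> lint f.
Proof.
move=> af b b0; apply: continuous_compact_integrable; first exact: segment_compact.
apply/subspace_continuousP => x; rewrite /= in_itv/= => /andP[x0 xb].
apply/cvgrPdist_lt => e e0; have [d d0 dP] := af b b0 e e0.
rewrite near_withinE; near=> t; rewrite /= in_itv/= => /andP[t0 tb].
have tx : `|x - t| < d by near: t; exact: (@cvgr_dist_lt _ _ _ _ _ _ _ (cvg_id)).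
have := dP 1%N (fun=> Num.min x t) (fun=> Num.max x t).
rewrite !big_ord1; have [xt|tx'] := leP x t.
  move=> H; rewrite distrC; apply: H => //.
  - by move=> i j; rewrite !ord1 eqxx.
  - by move: tx; rewrite distrC; apply: le_lt_trans; exact: ler_norm.
move=> H; apply: H => //.
- by move=> _; rewrite t0 ltW.
- by move=> i j; rewrite !ord1 eqxx.
- by apply: le_lt_trans tx; exact: ler_norm.
Unshelve. all: by end_near. Qed.

End Solutions.

(** * The graph of the operator in integral form *)

Section Graph.
Variable R : realType.
Local Notation mu := (@lebesgue_measure R).
Local Notation I h a b := (\int[mu]_(x in `[a, b]) h x).
Local Notation C := R[i].
Implicit Types (p f q y g : R -> C).

Lemma L2_clint f : L2 f -> clint f.
Proof. by move=> /L2_lint[]. Qed.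

Lemma L2_nsq f : L2 f -> lint (fun x => nsq (f x)).
Proof. by move=> /L2_lint[]. Qed.

Lemma lint_nsqD f g : clint f -> clint g -> lint (fun x => nsq (f x)) -> lint (fun x => nsq (g x)) ->
  lint (fun x => nsq (f x + g x)).
Proof.
move=> [f1 f2] [g1 g2] nf ng; apply: (lint_le _ (lintD (lintZ 2 nf) (lintZ 2 ng))).
  by apply: measurable_funD; apply: measurable_funX;
    [under eq_fun do rewrite reD|under eq_fun do rewrite imD];
    apply: measurable_funD; apply: lint_meas.
move=> x _; rewrite ger0_norm ?nsq_ge0// ger0_norm; first exact: nsqD_le.
by rewrite addr_ge0// mulr_ge0// nsq_ge0.
Qed.

Lemma L2D f g : L2 f -> L2 g -> L2 (fun x => f x + g x).
Proof.
move=> Lf Lg; have [f1 f2] := L2_clint Lf; have [g1 g2] := L2_clint Lg.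
have [h1 h2] := clintD (L2_clint Lf) (L2_clint Lg).
have [] // := @L2_of_bound _ (fun x => f x + g x) (2 * L2norm f ^+ 2 + 2 * L2norm g ^+ 2).
- exact: lint_meas.
- exact: lint_meas.
- by apply: lint_nsqD => //; exact: L2_nsq.
move=> b b0; have nf := L2_nsq Lf; have ng := L2_nsq Lg.
apply: (@le_trans _ _ (I (fun x => 2 * nsq (f x) + 2 * nsq (g x)) 0 b)).
  apply: Ile => //; [exact: lint_nsqD|exact: lintD (lintZ 2 nf) (lintZ 2 ng)|].
  by move=> x _; exact: nsqD_le.
rewrite ID//; [|exact: lintZ|exact: lintZ].
by rewrite !IZ//; apply: lerD; apply: ler_wpM2l => //; exact: L2_int_le.
Qed.

Lemma L2Z (z : C) f : L2 f -> L2 (fun x => z * f x).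
Proof.
move=> Lf; have [h1 h2] := clintZ z (L2_clint Lf); have nf := L2_nsq Lf.
have [] // := @L2_of_bound _ (fun x => z * f x) (nsq z * L2norm f ^+ 2).
- exact: lint_meas.
- exact: lint_meas.
- by apply: lint_eq (lintZ (nsq z) nf) => x _; rewrite nsqM.
move=> b b0; have -> : I (fun x => nsq (z * f x)) 0 b = I (fun x => nsq z * nsq (f x)) 0 b.
  by apply: Ieq => x _; rewrite nsqM.
by rewrite IZ//; apply: ler_wpM2l; [exact: nsq_ge0|exact: L2_int_le].
Qed.

Lemma L2B f g : L2 f -> L2 g -> L2 (fun x => f x - g x).
Proof.
move=> Lf /(L2Z (-1))/(L2D Lf).
by under eq_fun do rewrite mulN1r.
Qed.

Lemma ae_eq_int (f g : R -> R) (b : R) : lint f -> lint g ->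
  {ae mu, forall x : R, 0 <= x -> f x = g x} -> I f 0 b = I g 0 b.
Proof.
move=> lf lg [N [mN N0 sN]].
have mf h : lint h -> measurable_fun (`[0, b]%classic : set R) (EFin \o h).
  by move=> lh; exact: (measurable_int mu (lint_itv b lh (lexx 0))).
congr fine; apply: ae_eq_integral; [exact: measurable_itv|exact: mf|exact: mf|].
exists N; split => // x nx; apply: sN => /= H; apply: nx => /=.
by rewrite in_itv/= => /andP[x0 _]; rewrite H.
Qed.

Lemma ae_eq_L2norm_le f g (M : R) : L2 f -> L2 g -> Defs.ae_eq f g -> 0 <= M -> L2norm g <= M -> L2norm f <= M.
Proof.
move=> Lf Lg fg M0 gM.
have [] := @L2_of_bound _ f (L2norm g ^+ 2).
- by have [] := Lf.
- by have [_ []] := Lf.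
- exact: L2_nsq.
- move=> b b0; rewrite (ae_eq_int b (L2_nsq Lf) (L2_nsq Lg)); first exact: L2_int_le.
  by case: fg => N [mN N0 sN]; exists N; split => // x nx; apply: sN => /= H; apply: nx => /= /H ->.
by move=> _ H; apply: le_trans gM; rewrite -(@ler_pXn2r _ 2)// nnegrE L2norm_ge0.
Qed.

(** [y'' = q y - g] is locally integrable, because [q] and [g] are and [y] is bounded on compact
    intervals; so both first-order equations hold as integral identities, and [lam] may be moved to
    the other side. *)
Lemma graph_csol q (A B lam : C) y g : L1loc q -> LU_graph q A B y g ->
  exists y1 : R -> C, [/\ csol (fun x => q x - lam) (fun x => g x - lam * y x) y y1,
    A * y 0 + B * y1 0 = 0, L2 y & L2 g].
Proof.
move=> lq [y1 [ay [ay1 [dy [Ly [Lg [dy1 bc]]]]]]]; exists y1.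
have cq : clint q by split => b b0; have [] := lq b b0.
have /ACloc_parts py1 := ay1.
have py : cprim y y1.
  by apply: ACloc_cprim => //; apply: rac_lint => b b0; have [] := py1 b b0.
have [l1 l2] := clintB (clintM cq py) (L2_clint Lg).
have py1' : cprim y1 (fun x => q x * y x - g x).
  apply: ACloc_cprim => //.
  case: dy1 => N [mN N0 sN]; exists N; split => // x nx; apply: sN => /= H; apply: nx => /= x0.
  by have [? ->] := H x0; split => //; ring.
split => //; split => //.
by apply: cprim_eq py1' => x _ //; ring.
Qed.

Lemma csol_graph q (A B lam : C) f y y1 : csol (fun x => q x - lam) f y y1 -> L2 y -> L2 f ->
  A * y 0 + B * y1 0 = 0 -> LU_graph q A B y (fun x => f x + lam * y x).
Proof.
move=> [py py1] Ly Lf bc; exists y1.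
split; first exact: cprim_ACloc py.
split; first exact: cprim_ACloc py1.
split; first exact: cprim_ae.
split=> //; split; first by apply: L2D => //; exact: L2Z.
split => //; have [N [mN N0 sN]] := cprim_ae py1.
exists N; split => // x nx; apply: sN => /= H; apply: nx => /= x0.
by have [? ->] := H x0; split => //; ring.
Qed.

End Graph.

(** * Rotation of the sector *)

Section Sector.
Variable R : realType.
Local Notation mu := (@lebesgue_measure R).
Local Notation I h a b := (\int[mu]_(x in `[a, b]) h x).
Local Notation C := R[i].
Implicit Types (p f q y g : R -> C).

Lemma cos_ge_of_norm_le (x d : R) : `|x| <= d -> d <= pi -> cos d <= cos x.
Proof.
move=> xd dpi; rewrite -[cos x]cos_norm.
have [->|ne] := eqVneq `|x| d; first by [].
apply/ltW; rewrite ltr_cos ?in_itv/= ?normr_ge0 ?(le_trans xd)//.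
  by rewrite lt_neqAle ne.
by rewrite (le_trans _ xd) ?normr_ge0.
Qed.

(* The sector spanned by [0, +oo) and the values of [q - q0] has opening smaller than pi; [w] rotates its bisector to the positive real axis. *)
Lemma sectorial_rotation q : sectorial q -> exists (x0 : R) (q0 w : C) (k : R),
  [/\ 0 <= x0, 0 < re w, nsq w = 1, 0 < k <= 1 &
   forall x : R, x0 < x -> k * cabs (q x - q0) <= re (w * (q x - q0))].
Proof.
move=> [x0 [q0 [al [be [x00 [al1 [albe [be1 [ba H]]]]]]]]].
have pi0 := pi_gt0 R.
have [al' [H1 H2 H3]] : exists al' : R, [/\ al' <= al, al' <= 0 & - pi < al' /\ be - al' < pi].
  by have [h|h] := leP al 0; [exists al|exists 0]; split => //; lra.
have [be' [H4 H5 H6]] : exists be' : R, [/\ be <= be', 0 <= be' & be' < pi /\ be' - al' < pi].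
  by have [h|h] := leP 0 be; [exists be|exists 0]; split => //; lra.
(* [ga] is the bisector and [d] the half-opening of the enlarged sector. Rotated arguments lie in
   [[- d, d]], whence the constant [cos d], positive as [d < pi / 2]; direction 0 lies in the
   enlarged sector, so [re w = cos ga >= cos d]. *)
pose ga := (al' + be') / 2; pose d := (be' - al') / 2.
have d0 : 0 <= d by rewrite /d; lra.
have dpi : d < pi / 2 by rewrite /d; lra.
have cd : 0 < cos d by apply: cos_gt0_pihalf; rewrite dpi andbT; lra.
exists x0, q0, (Complex (cos ga) (- sin ga)), (cos d); split => //=.
- apply: lt_le_trans cd _; apply: cos_ge_of_norm_le; last by lra.
  by rewrite ler_norml /ga /d; apply/andP; split; lra.
- by rewrite /nsq/= sqrrN cos2Dsin2.
- by rewrite cd cos_le1.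
move=> x xx; have [r [th [r0 [/andP[t1 t2] [zr zi]]]]] := H x xx.
have -> : cabs (q x - q0) = r.
  by rewrite /cabs zr zi !exprMn -mulrDr cos2Dsin2 mulr1 sqrtr_sqr ger0_norm.
rewrite reM/= zr zi (_ : _ - _ = r * (cos th * cos ga + sin th * sin ga)); last by ring.
rewrite -cosB mulrC; apply: ler_wpM2l => //.
apply: cos_ge_of_norm_le; last by lra.
by rewrite ler_norml /ga /d; apply/andP; split; lra.
Qed.

End Sector.

(** * The energy estimate *)

Section EnergyEstimate.
Variable R : realType.
Local Notation mu := (@lebesgue_measure R).
Local Notation I h a b := (\int[mu]_(x in `[a, b]) h x).
Local Notation C := R[i].
Implicit Types (p f q y g : R -> C).

Lemma young (e X Y : R) : 0 < e -> 2 * (X * Y) <= e * X ^+ 2 + e^-1 * Y ^+ 2.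
Proof.
move=> e0; rewrite -subr_ge0.
rewrite (_ : _ - _ = e^-1 * (e * X - Y) ^+ 2).
  by rewrite mulr_ge0 ?invr_ge0 ?sqr_ge0// ltW.
by field; rewrite gt_eqF.
Qed.

(* [r] stands for [|q - q0|] and [rho] for its restriction to the bounded region where the sector condition may fail.
  The weight [(1 - eta x)^2] kills the boundary term at [N] when [eta = 1/N]. *)
Section Weighted.
Variables (p f y y1 : R -> C) (r rho : R -> R) (w : C) (k KU R0 e t N eta : R).
Hypothesis sol : csol p f y y1.
Hypothesis lf : lint (fun x => nsq (f x)).
Hypothesis lr : lint r.
Hypothesis lrho : lint rho.
Hypothesis rho0 : forall x, 0 <= rho x.
Hypothesis w1 : nsq w = 1.
Hypothesis c0 : 0 < re w.
Hypothesis Hp : forall x : R, 0 <= x -> k * r x - 2 * rho x + t <= re (w * p x).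
Hypothesis bc0 : cabs (y1 0) * cabs (y 0) <= KU * nsq (y 0).
Hypothesis KU0 : 0 <= KU.
Hypothesis R0P : I rho 0 N <= R0.
Hypothesis N0 : 0 < N.
Hypothesis eta0 : 0 <= eta.
Hypothesis eta1 : eta <= 1.
Hypothesis etaN : eta * N <= 1.
Hypothesis bcN : eta * N = 1 \/ y N = 0.
Hypothesis e0 : 0 < e.
Hypothesis eK : (KU + 2 * R0) * e <= re w / 4.
Hypothesis tK : 3 / 2 + (KU + 2 * R0) * e^-1 <= t.

Let chi (x : R) : R := 1 - eta * x.
Let chi2 (x : R) : R := chi x ^+ 2.

Let chi2_ge0 x : 0 <= chi2 x.
Proof. exact: sqr_ge0. Qed.

Let pchi : prim chi (fun=> - eta).
Proof.
apply: prim_eq (primD (prim_cst 1) (primZ (- eta) (prim_id R))) => x _; rewrite /chi; ring.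
Qed.

Let pchi2 : prim chi2 (fun x => - 2 * eta * chi x).
Proof. by apply: prim_eq (primM pchi pchi) => x _; rewrite /chi2 ?expr2; ring. Qed.

Let py := sol.1.
Let py1 := sol.2.

Let ly : lint (fun x => nsq (y x)) := lint_nsq_prim py.
Let ly1 : lint (fun x => nsq (y1 x)) := lint_nsq_prim py1.

Let G x := nsq (y x) * chi2 x.
Let G' x := 2 * (re (y x) * re (y1 x) + im (y x) * im (y1 x)) * chi2 x - 2 * eta * chi x * nsq (y x).

Let pnsq : prim (fun x => nsq (y x)) (fun x => 2 * (re (y x) * re (y1 x) + im (y x) * im (y1 x))).
Proof.
have [a b] := py.
by apply: prim_eq (primD (primM a a) (primM b b)) => x _; rewrite /nsq ?expr2; ring.
Qed.

Let pG : prim G G'.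
Proof. by apply: prim_eq (primM pnsq pchi2) => x _; rewrite /G /G' //; ring. Qed.

Let GN : G N = 0.
Proof.
rewrite /G; case: bcN => [h|->]; first by rewrite /chi2 /chi h subrr expr0n mulr0.
by rewrite /nsq/= expr0n addr0 mul0r.
Qed.

Let chi_itv x : 0 <= x <= N -> 0 <= chi x <= 1.
Proof.
move=> /andP[x0 xN]; rewrite /chi; apply/andP; split; last by rewrite gerBl mulr_ge0.
by rewrite subr_ge0; apply: le_trans etaN; apply: ler_wpM2l.
Qed.

(** Integrable majorant of [- G'] on [[0, N]], by Young's inequality with parameter [e] and
    [chi <= 1]. Since [G N = 0], its integral [S] bounds [G] on the whole interval. *)
Let D x := 2 * eta * nsq (y x) + (e * (nsq (y1 x) * chi2 x) + e^-1 * (nsq (y x) * chi2 x)).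

Let lE1 : lint (fun x => nsq (y1 x) * chi2 x) := lintM ly1 pchi2.
Let lE0 : lint (fun x => nsq (y x) * chi2 x) := lintM ly pchi2.

Let lD : lint D.
Proof. exact: lintD (lintZ _ ly) (lintD (lintZ _ lE1) (lintZ _ lE0)). Qed.

Let D0 x : 0 <= D x.
Proof.
have e0' := ltW e0.
have ei : 0 <= e^-1 by rewrite invr_ge0.
have a1 : 0 <= 2 * eta * nsq (y x) by rewrite mulr_ge0 ?nsq_ge0// mulr_ge0.
have a2 := mulr_ge0 e0' (mulr_ge0 (nsq_ge0 (y1 x)) (chi2_ge0 x)).
have a3 := mulr_ge0 ei (mulr_ge0 (nsq_ge0 (y x)) (chi2_ge0 x)).
exact: addr_ge0 a1 (addr_ge0 a2 a3).
Qed.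

Let S := I D 0 N.

Let G_le x : 0 <= x <= N -> G x <= S.
Proof.
move=> /andP[x0 xN].
have -> : G x = I (fun z => - G' z) x N.
  rewrite (_ : G x = - (G N - G x)); last by rewrite GN; ring.
  rewrite (primB_itv pG x0 xN) -mulN1r -IZ//; last exact: prim_lint pG.
  by apply: Ieq => z _; rewrite mulN1r.
apply: (@le_trans _ _ (I D x N)); last first.
  by rewrite /S (Ichasles lD _ x0 xN)// lerDr; apply: Ige0 => *; exact: D0.
apply: Ile => //; first exact: lintN (prim_lint pG).
move=> z /andP[xz zN]; have /andP[ch0 ch1] : 0 <= chi z <= 1 by apply: chi_itv; rewrite (le_trans x0).
rewrite /G' /D /nsq.
have Ya := young (- re (y1 z)) (re (y z)) e0; have Yb := young (- im (y1 z)) (im (y z)) e0.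
have c2 : 0 <= chi2 z by exact: sqr_ge0.
have := ler_wpM2l c2 (lerD Ya Yb); rewrite !sqrrN.
have : 0 <= eta * (1 - chi z) * (re (y z) ^+ 2 + im (y z) ^+ 2).
  by rewrite !mulr_ge0// ?subr_ge0 ?addr_ge0 ?sqr_ge0.
by move: (e^-1) => ei; lra.
Qed.

(** [P] is the real part of [w * y1 * conj y], and [P'] that of [w * (|y1|^2 + (p y - f) conj y)],
    its density because [y1' = p y - f]. *)
Let P x := re w * (re (y1 x) * re (y x) + im (y1 x) * im (y x)) - im w * (im (y1 x) * re (y x) - re (y1 x) * im (y x)).
Let P' x := re w * (nsq (y1 x) + re (p x * y x - f x) * re (y x) + im (p x * y x - f x) * im (y x))
  - im w * (im (p x * y x - f x) * re (y x) - re (p x * y x - f x) * im (y x)).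

Let pP : prim P P'.
Proof.
have [a b] := py; have [a1 b1] := py1.
have A := primD (primM a1 a) (primM b1 b).
have B := primD (primM b1 a) (primZ (-1) (primM a1 b)).
apply: prim_eq (primD (primZ (re w) A) (primZ (- im w) B)) => x _; rewrite /P /P' /nsq; ring.
Qed.

Let F x := P x * chi2 x.
Let F' x := P' x * chi2 x + (- 2 * eta * chi x) * P x.
Let pF : prim F F' := primM pP pchi2.

Let FN : F N = 0.
Proof.
rewrite /F; case: bcN => [h|h]; first by rewrite /chi2 /chi h subrr expr0n mulr0.
by rewrite /P h/= !mulr0 !(addr0, subr0) !mulr0 subr0 mul0r.
Qed.

(** Lower bound for [F'] by Young's inequality: a quarter of [re w] is spent on the derivative of
    the weight, which also leaves the term in [eta ^+ 2], and half a unit of [t] on the term with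
    [f]. *)
Let low x := 3 / 4 * re w * (nsq (y1 x) * chi2 x) + k * (r x * nsq (y x) * chi2 x)
  + (t - 2^-1) * (nsq (y x) * chi2 x) - 2 * (rho x * G x)
  - (2^-1 * nsq (f x) + 4 / re w * eta ^+ 2 * nsq (y x)).

Let F'_ge x : 0 <= x <= N -> low x <= F' x.
Proof.
move=> xN; have x0 : 0 <= x by case/andP: xN.
have /andP[ch0 ch1] := chi_itv xN.
rewrite /low /F' /P /P' /G /nsq.
have := Hp x0; rewrite !reB !imB !reM !imM.
have := w1; rewrite /nsq.
have ceta : 2 * (eta * chi x) * P x <= re w / 4 * (nsq (y1 x) * chi2 x) + 4 / re w * eta ^+ 2 * nsq (y x).
  have c4 : 0 < re w / 4 by rewrite divr_gt0.
  have Y1 := young (chi x * re (y1 x)) (eta * (re w * re (y x) + im w * im (y x))) c4.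
  have Y2 := young (chi x * im (y1 x)) (eta * (re w * im (y x) - im w * re (y x))) c4.
  have E : (re w * re (y x) + im w * im (y x)) ^+ 2 + (re w * im (y x) - im w * re (y x)) ^+ 2 = nsq (y x).
    rewrite -[RHS]mul1r -w1 /nsq; ring.
  rewrite invf_div in Y1 Y2; rewrite -E.
  apply: le_trans (le_trans (lerD Y1 Y2) _); rewrite le_eqVlt; apply/orP; left; apply/eqP.
    by rewrite /P; ring.
  by rewrite /chi2 /nsq; ring.
move: ceta; rewrite /P /nsq /chi2.
move: (re w) (im w) c0 (re (p x)) (im (p x)) (re (y x)) (im (y x)) (re (y1 x)) (im (y1 x)) (re (f x)) (im (f x)) (chi x) ch0 ch1 (r x) (rho x).
move=> c s c0' pr pi a b a1 b1 f1 f2 ch h0 h1 rx rhox ceta cs Hpx.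
have H1 : 0 <= ch ^+ 2 * (c * pr - s * pi - (k * rx - 2 * rhox + t)) * (a ^+ 2 + b ^+ 2).
  apply: mulr_ge0 (addr_ge0 (sqr_ge0 _) (sqr_ge0 _)).
  by apply: mulr_ge0 (sqr_ge0 _) _; rewrite subr_ge0.
have H2 : 0 <= ch ^+ 2 * ((c * f1 - s * f2 - a) ^+ 2 + (c * f2 + s * f1 - b) ^+ 2).
  by rewrite mulr_ge0 ?addr_ge0 ?sqr_ge0.
have H2' : ch ^+ 2 * ((c * f1 - s * f2 - a) ^+ 2 + (c * f2 + s * f1 - b) ^+ 2) =
  ch ^+ 2 * ((c ^+ 2 + s ^+ 2) * (f1 ^+ 2 + f2 ^+ 2) + a ^+ 2 + b ^+ 2
   - 2 * ((c * f1 - s * f2) * a + (c * f2 + s * f1) * b)) by ring.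
rewrite H2' cs mul1r in H2.
have H3 : ch ^+ 2 * (f1 ^+ 2 + f2 ^+ 2) <= f1 ^+ 2 + f2 ^+ 2.
  by apply: ler_piMl; rewrite ?addr_ge0 ?sqr_ge0 ?exprn_ile1.
move: (4 / c * eta ^+ 2) ceta => q4 ceta.
lra.
Qed.

(** Integrating [low <= F'] over [[0, N]] leaves [- F 0], as [F N = 0]. The boundary term is at most
    [KU * S] and the term with [rho] at most [2 * R0 * S]. By [eK] and [tK], absorbing
    [(KU + 2 * R0) * S] costs a quarter of [re w] and at most [t - 3 / 2] of the mass coefficient,
    apart from a multiple of [eta]; [re w / 2] and 1 survive. *)
Lemma energy_weighted :
  re w / 2 * I (fun x => nsq (y1 x) * (1 - eta * x) ^+ 2) 0 N
  + k * I (fun x => r x * nsq (y x) * (1 - eta * x) ^+ 2) 0 N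
  + I (fun x => nsq (y x) * (1 - eta * x) ^+ 2) 0 N
  <= 2^-1 * I (fun x => nsq (f x)) 0 N
   + (4 / re w + 2 * (KU + 2 * R0)) * eta * I (fun x => nsq (y x)) 0 N.
Proof.
have N0' := ltW N0.
have lE2 : lint (fun x => r x * nsq (y x) * chi2 x) := lintM (lintM lr pnsq) pchi2.
have lrG : lint (fun x => rho x * G x) := lintM lrho pG.
have S0 : 0 <= S by apply: Ige0 => *; exact: D0.
have IrG : I (fun x => rho x * G x) 0 N <= S * R0.
  apply: (@le_trans _ _ (I (fun x => S * rho x) 0 N)).
    apply: Ile => //; first exact: lintZ.
    by move=> x xN; rewrite mulrC; apply: ler_wpM2r => //; exact: G_le.
  by rewrite IZ//; apply: ler_wpM2l.
have l3 := lintD (lintZ 2^-1 lf) (lintZ (4 / re w * eta ^+ 2) ly).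
have l2 := lintZ 2 lrG.
have l1a := lintZ (3 / 4 * re w) lE1.
have l1b := lintZ k lE2.
have l1c := lintZ (t - 2^-1) lE0.
have llow : lint low := lintB (lintB (lintD (lintD l1a l1b) l1c) l2) l3.
have l12 := lintD l1a l1b; have l13 := lintD l12 l1c; have l4 := lintB l13 l2.
have lf2 := lintZ 2^-1 lf; have ly2 := lintZ (4 / re w * eta ^+ 2) ly.
have lowE : I low 0 N = 3 / 4 * re w * I (fun x => nsq (y1 x) * chi2 x) 0 N
    + k * I (fun x => r x * nsq (y x) * chi2 x) 0 N
    + (t - 2^-1) * I (fun x => nsq (y x) * chi2 x) 0 N - 2 * I (fun x => rho x * G x) 0 N
    - (2^-1 * I (fun x => nsq (f x)) 0 N + 4 / re w * eta ^+ 2 * I (fun x => nsq (y x)) 0 N).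
  by rewrite /low IB// IB// ID// ID// ID// !IZ.
have SE : S = 2 * eta * I (fun x => nsq (y x)) 0 N
    + (e * I (fun x => nsq (y1 x) * chi2 x) 0 N + e^-1 * I (fun x => nsq (y x) * chi2 x) 0 N).
  have d1 := lintZ (2 * eta) ly; have d2 := lintZ e lE1; have d3 := lintZ e^-1 lE0.
  have d4 := lintD d2 d3.
  by rewrite /S /D ID// ID// !IZ.
have := Ile llow (prim_lint pF) (lexx 0) F'_ge.
rewrite -(primB_itv pF (lexx 0) N0') FN sub0r lowE.
have F0 : - F 0 <= KU * S.
  apply: (@le_trans _ _ (KU * G 0)); last by apply: ler_wpM2l => //; apply: G_le; rewrite lexx N0'.
  have chi0 : chi2 0 = 1 by rewrite /chi2 /chi mulr0 subr0 expr1n.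
  rewrite /F /G !chi0 !mulr1; apply: le_trans bc0.
  have -> : - P 0 = re (- (w * (y1 0 * Complex (re (y 0)) (- im (y 0))))).
    by rewrite /P !(reN, reM, imM)/=; ring.
  apply: le_trans (ler_norm _) _; apply: le_trans (re_le_cabs _) _.
  have cw : cabs w = 1 by rewrite /cabs -/(nsq w) w1 sqrtr1.
  by rewrite cabsN !cabsM cw mul1r {2}/cabs/= sqrrN.
have E10 : 0 <= I (fun x => nsq (y1 x) * chi2 x) 0 N.
  by apply: Ige0 => *; rewrite mulr_ge0 ?nsq_ge0 ?chi2_ge0.
have E00 : 0 <= I (fun x => nsq (y x) * chi2 x) 0 N.
  by apply: Ige0 => *; rewrite mulr_ge0 ?nsq_ge0 ?chi2_ge0.
have Z0 : 0 <= I (fun x => nsq (y x)) 0 N by apply: Ige0 => *; exact: nsq_ge0.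
rewrite -/(chi2 _).
move: E10 E00 Z0 F0 IrG SE; rewrite -/chi2.
set E1 := I (fun x => nsq (y1 x) * chi2 x) 0 N; set E0 := I (fun x => nsq (y x) * chi2 x) 0 N.
set E2 := I (fun x => r x * nsq (y x) * chi2 x) 0 N; set Z := I (fun x => nsq (y x)) 0 N; set Ph := I (fun x => nsq (f x)) 0 N.
set rG := I (fun x => rho x * G x) 0 N => E10 E00 Z0 F0 IrG SE H.
have A1 := ler_wpM2r E10 eK; have A2 := ler_wpM2r E00 tK.
have A3 : 4 / re w * eta ^+ 2 * Z <= 4 / re w * eta * Z.
  apply: ler_wpM2r => //; apply: ler_wpM2l; first by rewrite divr_ge0// ltW.
  by rewrite expr2 ler_piMl.
have A4 : (KU + 2 * R0) * S = 2 * (KU + 2 * R0) * eta * Z + (KU + 2 * R0) * e * E1 + (KU + 2 * R0) * e^-1 * E0.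
  by rewrite SE; ring.
change (re w / 2 * E1 + k * E2 + E0 <= 2^-1 * Ph + (4 / re w + 2 * (KU + 2 * R0)) * eta * Z).
lra.
Qed.
End Weighted.
End EnergyEstimate.

(** * Coercivity at a suitable spectral parameter *)

Section Resolvent.
Variable R : realType.
Local Notation mu := (@lebesgue_measure R).
Local Notation I h a b := (\int[mu]_(x in `[a, b]) h x).
Local Notation C := R[i].
Implicit Types (p f q y g : R -> C).

(** A positive value at [x] persists at half its size on an interval to the right or to the left of
    [x], whichever fits into [[0, N]], by the continuity contained in [prim_rac]. *)
Lemma prim_int0_eq0 (g h : R -> R) (N : R) : prim g h -> (forall x, 0 <= g x) -> I g 0 N <= 0 ->
  0 < N -> forall x : R, 0 <= x <= N -> g x = 0.
Proof.
move=> pg g0 IN N0 x /andP[x0 xN]; apply/eqP; rewrite eq_le g0 andbT leNgt; apply/negP => gx.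
have lg := prim_lint_self pg.
have gx2 : 0 < g x / 2 by rewrite divr_gt0.
have [d d0 dP] := prim_rac pg (ltW N0) gx2.
have near_x (t : R) : 0 <= t <= N -> `|t - x| < d -> g x / 2 <= g t.
  move=> /andP[t0 tN] tx.
  have := dP 1%N (fun=> Num.min x t) (fun=> Num.max x t); rewrite !big_ord1.
  have [xt|tx'] := leP x t => H.
    have /ler_normlP[] : `|g t - g x| <= g x / 2.
      apply/ltW/H => //; first by move=> i j; rewrite !ord1 eqxx.
      by apply: le_lt_trans tx; exact: ler_norm.
    by clear H dP; lra.
  have /ler_normlP[] : `|g x - g t| <= g x / 2.
    apply/ltW/H => //; first by move=> _; rewrite t0 ltW.
      by move=> i j; rewrite !ord1 eqxx.
    by apply: le_lt_trans tx; rewrite distrC; exact: ler_norm.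
  by clear H dP; lra.
have [u [v [u0 uv vN uvP]]] : exists u v : R, [/\ 0 <= u, u < v, v <= N &
    forall t : R, u <= t <= v -> `|t - x| < d].
  pose e := Num.min (d / 2) (N / 2).
  have e0 : 0 < e by rewrite lt_min !divr_gt0.
  have ed : e < d by rewrite gt_min; apply/orP; left; lra.
  have eN : e <= N / 2 by rewrite ge_min lexx orbT.
  have [xeN|xeN] := leP (x + e) N.
    exists x, (x + e); split => //; first by rewrite ltrDl.
    by move=> t /andP[xt te]; rewrite ger0_norm; lra.
  exists (x - e), x; split => //; [lra|lra|].
  by move=> t /andP[xt te]; rewrite ler0_norm; lra.
have : I (fun=> g x / 2) u v <= I g u v.
  apply: Ile => //; first exact: lint_cst.
  move=> t tuv; apply: near_x; last exact: uvP.
  by case/andP: tuv => ut tv; rewrite (le_trans u0)// (le_trans tv).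
rewrite (Icst _ (ltW uv)).
have : I g u v <= I g 0 N.
  rewrite (Ichasles lg (lexx 0) (le_trans u0 (ltW uv)) vN).
  rewrite (Ichasles lg (lexx 0) u0 (ltW uv)).
  have := @Ige0 _ g 0 u (fun x _ => g0 x); have := @Ige0 _ g v N (fun x _ => g0 x).
  lra.
have : 0 < g x / 2 * (v - u) by rewrite mulr_gt0// subr_gt0.
lra.
Qed.

Lemma cprim_nsq y y1 : cprim y y1 -> exists h, prim (fun x => nsq (y x)) h.
Proof.
move=> [a b]; eexists.
by apply: prim_eq (primD (primM a a) (primM b b)) => x _ //; rewrite /nsq ?expr2.
Qed.

(** If [B = 0] the condition forces [z = 0] and the product vanishes; otherwise [z1 = - (A / B) z].
    In this form the condition at 0 enters the energy estimate. *)
Lemma boundary_bound (A B : C) : A != 0 \/ B != 0 -> exists2 KU : R, 0 <= KU &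
  forall z z1 : C, A * z + B * z1 = 0 -> cabs z1 * cabs z <= KU * nsq z.
Proof.
move=> AB; have [B0|B0] := eqVneq B 0.
  exists 0 => // z z1; rewrite B0 mul0r addr0 => /eqP; rewrite mulf_eq0.
  have A0 : A != 0 by case: AB => //; rewrite B0 eqxx.
  rewrite (negPf A0) /= => /eqP ->.
  by rewrite mul0r [cabs 0]/cabs/= expr0n addr0 sqrtr0 mulr0.
exists (cabs (A / B)); first exact: cabs_ge0.
move=> z z1 bc; have -> : z1 = - (A / B * z).
  apply: (mulfI B0); rewrite mulrN mulrA mulrCA divff// mulr1.
  by apply/eqP; rewrite -addr_eq0 addrC bc.
by rewrite cabsN cabsM -mulrA -expr2 cabs_sqr.
Qed.

(** One [lam] and one [K] serve both estimates. The first, on [[0, N]] with [y N = 0], yields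
    existence; the second, for square integrable solutions on the half-line, yields uniqueness,
    boundedness of the inverse and compactness. *)
Lemma sectorial_coercive q (A B : C) : clint q -> sectorial q -> A != 0 \/ B != 0 ->
  exists (lam : C) (K : R), 0 <= K /\
  (forall f y y1 (N : R), csol (fun x => q x - lam) f y y1 -> lint (fun x => nsq (f x)) ->
     A * y 0 + B * y1 0 = 0 -> y N = 0 -> 0 < N ->
     I (fun x => nsq (y1 x)) 0 N + I (fun x => nsq (y x)) 0 N <= K * I (fun x => nsq (f x)) 0 N) /\
  (forall f y y1 (M : R), csol (fun x => q x - lam) f y y1 -> L2 f -> L2 y ->
     A * y 0 + B * y1 0 = 0 -> 0 <= M ->
     I (fun x => nsq (y1 x)) 0 M + I (fun x => cabs (q x) * nsq (y x)) 0 M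
       + I (fun x => nsq (y x)) 0 M <= K * L2norm f ^+ 2).
Proof.
move=> cq sq AB.
have [x0 [q0 [w [k [x00 c0 w1 /andP[k0 k1] Hq]]]]] := sectorial_rotation sq.
have [KU KU0 HKU] := boundary_bound AB.
pose r x := cabs (q x - q0).
have lr : lint r by apply: lint_cabs; apply: clintB => //; exact: clint_cst.
have r0 x : 0 <= r x by exact: cabs_ge0.
(* Any point beyond [x0] would do: the sector condition is strict in [x0], while [rho] is cut off at
   [x < x1]. *)
pose x1 := x0 + 1.
have x10 : 0 <= x1 by rewrite /x1; lra.
pose rho x : R := r x * (x < x1)%R%:R.
have rho0 x : 0 <= rho x by rewrite mulr_ge0.
have rho_r x : rho x <= r x by rewrite /rho; case: (x < x1); rewrite ?mulr1 ?mulr0.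
have lrho : lint rho.
  apply: (lint_le _ lr); last by move=> x _; rewrite !ger0_norm.
  apply: measurable_funM; first exact: lint_meas.
  rewrite (_ : (fun x : R => _) = \1_(`]-oo, x1[%classic)); first exact: measurable_indic.
  by apply/funext => x; rewrite indicE; congr ((nat_of_bool _)%:R); apply/idP/idP; rewrite inE/= in_itv/=.
pose R0 := I r 0 x1.
have R00 : 0 <= R0 by apply: Ige0.
have R0P N : 0 < N -> I rho 0 N <= R0.
  move=> N0; have [Nx|xN] := leP N x1.
    rewrite /R0 (Ichasles lr (lexx 0) (ltW N0) Nx).
    have : I rho 0 N <= I r 0 N by apply: Ile.
    have := @Ige0 _ r N x1 (fun x _ => r0 x); lra.
  rewrite (Ichasles lrho (lexx 0) x10 (ltW xN)).
  have -> : I rho x1 N = 0.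
    rewrite -(mul0r (N - x1)) -(Icst 0 (ltW xN)); apply: Ieq => x /andP[x1x _].
    by rewrite /rho ltNge x1x mulr0.
  by rewrite addr0; apply: Ile.
set KK := KU + 2 * R0.
have KK0 : 0 <= KK by rewrite /KK; lra.
have KK1 : 0 < 4 * (KK + 1) by lra.
(* [e] and [t] are dictated by [eK] and [tK]; [KK + 1] keeps the denominator positive when
   [KK = 0]. *)
pose e := re w / (4 * (KK + 1)).
have e0 : 0 < e by rewrite divr_gt0.
have eK : KK * e <= re w / 4.
  have -> : re w / 4 = (KK + 1) * e.
    by rewrite /e; field; lra.
  by apply: ler_wpM2r; [exact: ltW|lra].
pose t := 3 / 2 + KK * e^-1.
pose lam := q0 - (t%:C)%C * Complex (re w) (- im w).
have Hp (x : R) : 0 <= x -> k * r x - 2 * rho x + t <= re (w * (q x - lam)).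
  move=> xx; have -> : re (w * (q x - lam)) = re (w * (q x - q0)) + t.
    rewrite /lam -[X in _ = _ + X]mulr1 -w1 /nsq !(reM, imM, reB, imB)/=; ring.
  rewrite lerD2r /rho; have [xx1|xx1] := ltP x x1.
    rewrite mulr1; have := re_le_cabs (w * (q x - q0)).
    rewrite cabsM {1}/cabs -/(nsq w) w1 sqrtr1 mul1r -/(r x) ler_norml => /andP[h _].
    by have := ler_wpM2r (r0 x) k1; lra.
  by rewrite !mulr0 subr0; apply: Hq; rewrite /x1 in xx1; lra.
pose C2 := 4 / re w + 2 * KK.
have C20 : 0 <= C2 by rewrite /C2 addr_ge0// ?divr_ge0 ?mulr_ge0// ltW.
(* The mass is bounded with 2, the Dirichlet integral with [4 / re w], the integral of [r |y|^2]
   with [2 / k]; [cabs q0 * 2] comes from [|q| <= |q - q0| + |q0|]. *)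
pose K := (2 + cabs q0 * 2) + 4 / re w + 2 / k.
have cq00 := cabs_ge0 q0.
have w40 : 0 <= 4 / re w by rewrite divr_ge0// ltW.
have k20 : 0 <= 2 / k by rewrite divr_ge0// ltW.
exists lam, K; split; first by rewrite /K; lra.
split.
  move=> f y y1 N sol lf bc yN N0.
  have eN : 0 * N <= 1 :> R by rewrite mul0r.
  have := @energy_weighted _ _ _ _ _ r rho w k KU R0 e t N 0 sol lf lr lrho rho0 w1 c0 Hp
    (HKU _ _ bc) KU0 (R0P N N0) N0 (lexx 0) ler01 eN (or_intror yN) e0 eK (lexx _).
  have simp (h : R -> R) : I (fun x => h x * (1 - 0 * x) ^+ 2) 0 N = I h 0 N.
    by apply: Ieq => x _; rewrite mul0r subr0 expr1n mulr1.
  rewrite !simp mulr0 mul0r addr0.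
  have E1 : 0 <= I (fun x => nsq (y1 x)) 0 N by apply: Ige0 => *; exact: nsq_ge0.
  have E0 : 0 <= I (fun x => nsq (y x)) 0 N by apply: Ige0 => *; exact: nsq_ge0.
  have E2 : 0 <= I (fun x => r x * nsq (y x)) 0 N by apply: Ige0 => *; rewrite mulr_ge0 ?nsq_ge0.
  have Ef : 0 <= I (fun x => nsq (f x)) 0 N by apply: Ige0 => *; exact: nsq_ge0.
  move: E1 E0 E2 Ef; set a := I (fun x => nsq (y1 x)) 0 N; set b := I (fun x => nsq (y x)) 0 N.
  set d := I (fun x => r x * nsq (y x)) 0 N; set F := I (fun x => nsq (f x)) 0 N => E1 E0 E2 Ef H.
  have kd := mulr_ge0 (ltW k0) E2.
  have cE1 := mulr_ge0 (ltW c0) E1.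
  have H1 : b <= F by lra.
  have H2 : a <= 4 / re w * F.
    have -> : a = 2 / re w * (re w / 2 * a) by field; rewrite gt_eqF.
    have : 2 / re w * (re w / 2 * a) <= 2 / re w * F.
      by apply: ler_wpM2l; [rewrite divr_ge0// ltW|lra].
    have := mulr_ge0 w40 Ef; lra.
  have := mulr_ge0 k20 Ef; have := mulr_ge0 cq00 Ef; rewrite /K; lra.
move=> f y y1 M sol Lf Ly bc M0.
have [py py1] := sol; have ly := lint_nsq_prim py; have ly1 := lint_nsq_prim py1.
have [hy pn] := cprim_nsq py.
have lry : lint (fun x => r x * nsq (y x)) := lintM lr pn.
have lqy : lint (fun x => cabs (q x) * nsq (y x)) := lintM (lint_cabs cq) pn.
set a := I (fun x => nsq (y1 x)) 0 M; set b := I (fun x => nsq (y x)) 0 M.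
set d := I (fun x => cabs (q x) * nsq (y x)) 0 M.
pose dr := I (fun x => r x * nsq (y x)) 0 M.
set F := L2norm f ^+ 2.
have E1 : 0 <= a by apply: Ige0 => *; exact: nsq_ge0.
have E0 : 0 <= b by apply: Ige0 => *; exact: nsq_ge0.
have E2 : 0 <= dr by apply: Ige0 => *; rewrite mulr_ge0 ?nsq_ge0.
have EF : 0 <= F by exact: sqr_ge0.
have key : re w / 2 * a + k * dr + b <= 2 * F.
  apply/ler_addgt0Pr => eps eps0.
  have Y0 : 0 <= L2norm y ^+ 2 by exact: sqr_ge0.
  (* [N >= 1] gives [eta <= 1], [N >= 2 M] keeps the weight at least 1/4 on [[0, M]], and the last
     entry makes the error at most [eps / 4]. *)
  pose N := Num.max (Num.max 1 (2 * M)) (4 * C2 * L2norm y ^+ 2 / eps).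
  have N1 : 1 <= N by rewrite !le_max lexx.
  have NM : 2 * M <= N by rewrite !le_max lexx orbT.
  have Ne : 4 * C2 * L2norm y ^+ 2 / eps <= N by rewrite !le_max lexx !orbT.
  have N0 : 0 < N by lra.
  have eN : N^-1 * N = 1 by rewrite mulVf// gt_eqF.
  have eN0 : 0 <= N^-1 by rewrite invr_ge0 ltW.
  have eN1 : N^-1 <= 1 by rewrite invf_le1.
  have eN' : N^-1 * N <= 1 by rewrite eN.
  have MN : M <= N by lra.
  have lf := L2_nsq Lf.
  have := @energy_weighted _ _ _ _ _ r rho w k KU R0 e t N N^-1 sol lf lr lrho rho0 w1 c0 Hp
    (HKU _ _ bc) KU0 (R0P N N0) N0 eN0 eN1 eN' (or_introl eN) e0 eK (lexx _).
  have pchi : exists h, prim (fun x => (1 - N^-1 * x) ^+ 2) h.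
    eexists; apply: prim_eq (prim_exp 1 (primD (prim_cst 1) (primZ (- N^-1) (prim_id R)))) => x _ //.
    by rewrite mulNr.
  have [hchi {}pchi] := pchi.
  have low (h : R -> R) : lint h -> (forall x, 0 <= h x) ->
      4^-1 * I h 0 M <= I (fun x => h x * (1 - N^-1 * x) ^+ 2) 0 N.
    move=> lh h0; have lhc := lintM lh pchi.
    rewrite (Ichasles lhc (lexx 0) M0 MN).
    have : 0 <= I (fun x => h x * (1 - N^-1 * x) ^+ 2) M N by apply: Ige0 => *; rewrite mulr_ge0 ?sqr_ge0.
    suff : 4^-1 * I h 0 M <= I (fun x => h x * (1 - N^-1 * x) ^+ 2) 0 M by lra.
    rewrite -IZ//; apply: Ile => //; first exact: lintZ.
    move=> x /andP[xx xM]; rewrite mulrC; apply: ler_wpM2l => //.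
    have xN2 : N^-1 * x <= 2^-1.
      by rewrite mulrC ler_pdivrMr//; lra.
    by have -> : 4^-1 = 2^-1 ^+ 2 :> R; [by field|rewrite lerXn2r ?nnegrE//; lra].
  have L1 := low _ ly1 (fun x => nsq_ge0 _).
  have L0 := low _ ly (fun x => nsq_ge0 _).
  have L2' := low _ lry (fun x => mulr_ge0 (r0 x) (nsq_ge0 (y x))).
  have Hf := L2_int_le N Lf; have Hy := L2_int_le N Ly.
  have H1 := ler_wpM2l (ltW c0) L1; have H2 := ler_wpM2l (ltW k0) L2'.
  have H3 : (4 / re w + 2 * (KU + 2 * R0)) * N^-1 * I (fun x => nsq (y x)) 0 N <= eps / 4.
    apply: (@le_trans _ _ (C2 * N^-1 * L2norm y ^+ 2)).
      by apply: ler_wpM2l => //; rewrite mulr_ge0.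
    rewrite mulrAC ler_pdivrMr//.
    by rewrite ler_pdivrMr// in Ne; lra.
  rewrite -/a -/b -/dr -/F in L1 L0 L2' Hf H1 H2 *.
  lra.
have kd := mulr_ge0 (ltW k0) E2.
have cE1 := mulr_ge0 (ltW c0) E1.
have H1 : b <= 2 * F by lra.
have H2 : a <= 4 / re w * F.
  have -> : a = 2 / re w * (re w / 2 * a) by field; rewrite gt_eqF.
  have : 2 / re w * (re w / 2 * a) <= 2 / re w * (2 * F).
    by apply: ler_wpM2l; [rewrite divr_ge0// ltW|lra].
  lra.
have H3 : dr <= 2 / k * F.
  have -> : dr = k^-1 * (k * dr) by rewrite mulKf// gt_eqF.
  have : k^-1 * (k * dr) <= k^-1 * (2 * F).
    by apply: ler_wpM2l; [rewrite invr_ge0 ltW|lra].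
  lra.
have H4 : d <= dr + cabs q0 * b.
  rewrite /d /dr /b -IZ// -ID//; last exact: lintZ.
  apply: Ile => //; first exact: lintD lry (lintZ _ ly).
  move=> x _; rewrite -mulrDl; apply: ler_wpM2r; first exact: nsq_ge0.
  by have := cabsD (q x - q0) q0; rewrite subrK.
have H5 := ler_wpM2l cq00 H1.
rewrite /K; lra.
Qed.

End Resolvent.

(** * The resolvent *)

Section Onto.
Variable R : realType.
Local Notation mu := (@lebesgue_measure R).
Local Notation I h a b := (\int[mu]_(x in `[a, b]) h x).
Local Notation C := R[i].
Implicit Types (p f q y g : R -> C).

(** A free ultrafilter gives all bounded sequences a limit simultaneously, instead of repeated
    extraction: here for the parts of the multiples of [ph], later for the values at all points of
    the half-line. *)
Lemma free_ultrafilter : exists U : set_system nat,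
  UltraFilter U /\ forall n : nat, U [set k | (n <= k)%N].
Proof.
have [U [UU sU]] := ultraFilterLemma (@eventually_filter).
by exists U; split => // n; apply: sU; exists n.
Qed.

Lemma ultra_lim (U : set_system nat) (u : nat -> R) (M : R) : UltraFilter U ->
  (forall n, `|u n| <= M) -> exists l : R, forall e : R, 0 < e -> U [set n | `|u n - l| < e].
Proof.
move=> UU uM.
have PU := @ultra_proper _ U UU.
have FU : (u @ U) (`[- M, M]%classic).
  rewrite /= /nbhs/=; apply: (@filterS _ U _ setT); last exact: filterT.
  by move=> n _ /=; rewrite in_itv/= -ler_norml.
have [l [_ lc]] := segment_compact (fmap_proper_filter u PU) FU.
exists l => e e0; have [//|H] := in_ultra_setVsetC [set n | `|u n - l| < e] UU.
have := lc (~` ball l e) (ball l e) _ (nbhsx_ballx l e e0).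
case=> [|x [//]].
apply: (@filterS nat U _ (~` [set n | `|u n - l| < e])) H => n /= H1 hb.
by apply: H1; rewrite distrC.
Qed.

(* [ph] satisfies the boundary condition at [0]; subtracting a multiple of it enforces [y N = 0] for each [N], and the multiples are bounded. *)
Lemma onto_L2 p f (A B : C) (K : R) : clint p -> 0 <= K -> A != 0 \/ B != 0 ->
  (forall f y y1 (N : R), csol p f y y1 -> lint (fun x => nsq (f x)) ->
     A * y 0 + B * y1 0 = 0 -> y N = 0 -> 0 < N ->
     I (fun x => nsq (y1 x)) 0 N + I (fun x => nsq (y x)) 0 N <= K * I (fun x => nsq (f x)) 0 N) ->
  L2 f -> exists y y1, [/\ csol p f y y1, A * y 0 + B * y1 0 = 0 & L2 y].
Proof.
move=> cp K0 AB HD Lf.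
have [yp [yp1 [yp0 yp10 solp]]] := csol_exists 0 0 cp (L2_clint Lf).
have [ph [ph1 [ph0 ph10 solh]]] := csol_exists B (- A) cp (clint_cst 0).
have [pph pph1] := solh; have [hph nph] := cprim_nsq pph; have [hph1 nph1] := cprim_nsq pph1.
have lph := lint_nsq_prim pph; have lph1 := lint_nsq_prim pph1.
(* If [ph N = 0], the estimate with right-hand side 0 forces [ph] and [ph1] to vanish on [[0, N]],
   against the initial data [(B, - A)]. *)
have phN (N : R) : 0 < N -> ph N != 0.
  move=> N0; apply/eqP => phN0.
  have l0 : lint (fun x : R => nsq (0 : C)) by exact: lint_cst.
  have := HD _ _ _ _ solh l0 _ phN0 N0.
  rewrite ph0 ph10 mulrC mulrN subrr => /(_ erefl).
  have -> : I (fun x => nsq (0 : C)) 0 N = 0.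
    by rewrite (Icst _ (ltW N0)) /nsq/= expr0n addr0 mul0r.
  have E1 : 0 <= I (fun x => nsq (ph1 x)) 0 N by apply: Ige0 => *; exact: nsq_ge0.
  have E0 : 0 <= I (fun x => nsq (ph x)) 0 N by apply: Ige0 => *; exact: nsq_ge0.
  rewrite mulr0 => H.
  have z0 : 0 <= (0 : R) <= N by rewrite lexx ltW.
  have B0 : B = 0.
    rewrite -ph0; apply: nsq_eq0; apply: (prim_int0_eq0 nph _ _ N0 z0); last by lra.
    by move=> x; exact: nsq_ge0.
  have A0 : - A = 0.
    rewrite -ph10; apply: nsq_eq0; apply: (prim_int0_eq0 nph1 _ _ N0 z0); last by lra.
    by move=> x; exact: nsq_ge0.
  by case: AB; [rewrite -oppr_eq0 A0 eqxx|rewrite B0 eqxx].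
(* Chosen so that [Y n] vanishes at [n.+1], the successor keeping the right end positive. *)
pose c (n : nat) : C := - yp n.+1%:R / ph n.+1%:R.
pose Y n x := yp x + c n * ph x.
pose F := K * L2norm f ^+ 2.
have F0 : 0 <= F by rewrite mulr_ge0 ?sqr_ge0.
have lcy z : lint (fun x => nsq (yp x + z * ph x)).
  exact: lint_nsq_prim (cprimD solp.1 (cprimZ z pph)).
have Yb n (M : R) : 0 <= M -> M <= n.+1%:R -> I (fun x => nsq (Y n x)) 0 M <= F.
  move=> M0 Mn.
  have n0 : 0 < n.+1%:R :> R by [].
  have solY : csol p f (Y n) (fun x => yp1 x + c n * ph1 x).
    by apply: csol_eq (csolD solp (csolZ (c n) solh)) => x _; rewrite mulr0 addr0.
  have := HD _ _ _ _ solY (L2_nsq Lf) _ _ n0.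
  rewrite /Y yp0 yp10 ph0 ph10 !add0r.
  have -> : A * (c n * B) + B * (c n * - A) = 0 by ring.
  have -> : yp n.+1%:R + c n * ph n.+1%:R = 0.
    by rewrite /c divfK ?phN// subrr.
  move=> /(_ erefl erefl).
  have E1 : 0 <= I (fun x => nsq (yp1 x + c n * ph1 x)) 0 n.+1%:R by apply: Ige0 => *; exact: nsq_ge0.
  have E2 : 0 <= I (fun x => nsq (yp x + c n * ph x)) M n.+1%:R by apply: Ige0 => *; exact: nsq_ge0.
  rewrite (Ichasles (lcy (c n)) (lexx 0) M0 Mn).
  have := ler_wpM2l K0 (L2_int_le n.+1%:R Lf); rewrite -/F; lra.
(* On [[0, 1]] both [Y n] and [yp] have mass bounded independently of [n], hence so has
   [c n * ph = Y n - yp], and [ph] has positive mass there. *)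
have [b [b0 cb]] : exists b : R, 0 <= b /\ forall n, nsq (c n) <= b.
  pose a := I (fun x => nsq (ph x)) 0 1.
  have a0 : 0 < a.
    rewrite lt_neqAle; apply/andP; split; last by apply: Ige0 => *; exact: nsq_ge0.
    apply/eqP => a0; have := phN 1 ltr01; apply/negP; rewrite negbK; apply/eqP/nsq_eq0.
    apply: (prim_int0_eq0 nph _ _ ltr01); rewrite ?lexx ?ler01//; last by rewrite -/a -a0.
    by move=> x; exact: nsq_ge0.
  have lyp := lint_nsq_prim solp.1.
  have p0 : 0 <= I (fun x => nsq (yp x)) 0 1 by apply: Ige0 => *; exact: nsq_ge0.
  exists ((2 * F + 2 * I (fun x => nsq (yp x)) 0 1) / a); split.
    by apply: divr_ge0; [lra|exact: ltW].
  move=> n; rewrite ler_pdivlMr// /a -IZ//.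
  have n1 : 1 <= n.+1%:R :> R by rewrite ler1n.
  have H := Yb n 1 ler01 n1.
  apply: (@le_trans _ _ (I (fun x => 2 * nsq (Y n x) + 2 * nsq (yp x)) 0 1)).
    apply: Ile => //; first exact: lintZ.
      exact: lintD (lintZ 2 (lcy (c n))) (lintZ 2 lyp).
    move=> x _; rewrite -nsqM; have -> : c n * ph x = Y n x - yp x by rewrite /Y addrAC subrr add0r.
    exact: nsqB_le.
  have lY : lint (fun x => nsq (Y n x)) := lcy (c n).
  have l1 := lintZ 2 lY; have l2 := lintZ 2 lyp.
  by rewrite ID// !IZ//; lra.
have [U [UU Un]] := free_ultrafilter.
have PU := @ultra_proper _ U UU.
have [l1 Hl1] := @ultra_lim U (fun n => re (c n)) (b + 1) UU (fun n => (abs_le_of_nsq (cb n)).1).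
have [l2 Hl2] := @ultra_lim U (fun n => im (c n)) (b + 1) UU (fun n => (abs_le_of_nsq (cb n)).2).
pose cc : C := Complex l1 l2.
have near_cc (e : R) (m : nat) : 0 < e -> exists2 n, (m <= n)%N & nsq (cc - c n) <= 2 * e ^+ 2.
  move=> e0; have H : U ([set n | (m <= n)%N] `&` ([set n | `|re (c n) - l1| < e] `&` [set n | `|im (c n) - l2| < e])).
    by apply: filterI => //; apply: filterI; [exact: Hl1|exact: Hl2].
  have [n [/= mn [h1 h2]]] := @filter_ex _ U PU _ H; exists n => //.
  rewrite /nsq reB imB/=.
  have s1 : (l1 - re (c n)) ^+ 2 <= e ^+ 2.
    by rewrite -real_normK ?num_real// lerXn2r ?nnegrE ?(ltW e0)// distrC ltW.
  have s2 : (l2 - im (c n)) ^+ 2 <= e ^+ 2.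
    by rewrite -real_normK ?num_real// lerXn2r ?nnegrE ?(ltW e0)// distrC ltW.
  lra.
exists (fun x => yp x + cc * ph x), (fun x => yp1 x + cc * ph1 x).
have soly : csol p f (fun x => yp x + cc * ph x) (fun x => yp1 x + cc * ph1 x).
  by apply: csol_eq (csolD solp (csolZ cc solh)) => x _; rewrite mulr0 addr0.
split => //; first by rewrite yp0 yp10 ph0 ph10; ring.
have [m1 m2] := cprim_clint soly.1.
have [] // := @L2_of_bound _ (fun x => yp x + cc * ph x) (2 * F + 4).
- exact: lint_meas m1.
- exact: lint_meas m2.
move=> M M0; pose a := I (fun x => nsq (ph x)) 0 M.
have a0 : 0 <= a by apply: Ige0 => *; exact: nsq_ge0.
(* With this tolerance the correction [(cc - c n) * ph] has mass at most 2 on [[0, M]], which gives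
   the 4 in the bound [2 * F + 4], uniform in [M]. *)
have e0 : 0 < (a + 1)^-1 by rewrite invr_gt0; lra.
have [n mn Hn] := near_cc _ (Num.bound M) e0.
have Mn : M <= n.+1%:R.
  by apply: ltW; apply: lt_le_trans (archi_boundP M0) _; rewrite ler_nat (leq_trans mn).
have H := Yb n M M0 Mn.
have lY : lint (fun x => nsq (Y n x)) := lcy (c n).
apply: (@le_trans _ _ (I (fun x => 2 * nsq (Y n x) + 2 * nsq (cc - c n) * nsq (ph x)) 0 M)).
  apply: Ile => //; first exact: lintD (lintZ 2 lY) (lintZ _ lph).
  move=> x _; rewrite -mulrA -nsqM.
  have -> : yp x + cc * ph x = Y n x + (cc - c n) * ph x by rewrite /Y; ring.
  exact: nsqD_le.
have l3 := lintZ 2 lY; have l4 := lintZ (2 * nsq (cc - c n)) lph.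
rewrite ID// !IZ// -/a.
suff : nsq (cc - c n) * a <= 2 by lra.
apply: le_trans (ler_wpM2r a0 Hn) _.
have i1 : (a + 1)^-1 * a <= 1 by rewrite mulrC ler_pdivrMr; lra.
have i2 : (a + 1)^-1 <= 1 by rewrite invf_le1; lra.
have := ler_pM (ltW e0) (mulr_ge0 (ltW e0) a0) i2 i1.
rewrite expr2; lra.
Qed.

Lemma L2_zero : L2 (fun _ : R => 0 : C) /\ L2norm (fun _ : R => 0 : C) = 0.
Proof.
have [] // := @L2_of_bound R (fun=> 0) 0.
- exact: lint_cst.
- by move=> b b0; rewrite (Icst _ b0) /nsq/= expr0n addr0 mul0r.
move=> L0 n0; split => //; apply/eqP; rewrite -sqrf_eq0 eq_le n0 sqr_ge0//.
Qed.

(** Surjectivity is [onto_L2]. For injectivity, the difference of two solutions has a right-hand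
    side of norm 0, so the second estimate annihilates its mass on every [[0, M]]; the same estimate
    bounds the inverse. *)
Lemma resolvent_point_of_coercive q (A B lam : C) (K : R) :
  L1loc q -> 0 <= K -> A != 0 \/ B != 0 ->
  (forall f y y1 (N : R), csol (fun x => q x - lam) f y y1 -> lint (fun x => nsq (f x)) ->
     A * y 0 + B * y1 0 = 0 -> y N = 0 -> 0 < N ->
     I (fun x => nsq (y1 x)) 0 N + I (fun x => nsq (y x)) 0 N <= K * I (fun x => nsq (f x)) 0 N) ->
  (forall f y y1 (M : R), csol (fun x => q x - lam) f y y1 -> L2 f -> L2 y ->
     A * y 0 + B * y1 0 = 0 -> 0 <= M -> I (fun x => nsq (y x)) 0 M <= K * L2norm f ^+ 2) ->
  resolvent_point q A B lam.
Proof.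
move=> lq K0 AB HD HE.
have cq : clint q by split => b b0; have [] := lq b b0.
have cp : clint (fun x => q x - lam) := clintB cq (clint_cst lam).
split; last split.
- move=> f Lf; have [y [y1 [sol bc Ly]]] := onto_L2 cp K0 AB HD Lf.
  exists y, (fun x => f x + lam * y x); split; first exact: csol_graph sol Ly Lf bc.
  by apply: aeW => x _; rewrite addrK.
- move=> u1 g1 u2 g2 G1 G2 gE.
  have [v1 [s1 bc1 Lu1 Lg1]] := graph_csol lam lq G1.
  have [v2 [s2 bc2 Lu2 Lg2]] := graph_csol lam lq G2.
  have s := csolB s1 s2; apply: aeW => x x0.
  have Lf1 := L2B Lg1 (L2Z lam Lu1); have Lf2 := L2B Lg2 (L2Z lam Lu2).
  have bc : A * (u1 0 - u2 0) + B * (v1 0 - v2 0) = 0.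
    by rewrite !mulrBr addrACA -opprD bc1 bc2 subrr.
  have nf : L2norm (fun x => (g1 x - lam * u1 x) - (g2 x - lam * u2 x)) <= 0.
    have [L0 N0] := L2_zero.
    apply: (ae_eq_L2norm_le (L2B Lf1 Lf2) L0) => //; last by rewrite N0.
    case: gE => N [mN mN0 sN]; exists N; split => // z nz; apply: sN => /= H; apply: nz => /= /H ->.
    by rewrite subrr.
  have nf0 : L2norm (fun x => (g1 x - lam * u1 x) - (g2 x - lam * u2 x)) = 0.
    by apply/eqP; rewrite eq_le nf L2norm_ge0.
  (* The interval must contain [x] and have positive length even for [x = 0]. *)
  have x10 : 0 < x + 1 by lra.
  have := HE _ _ _ (x + 1) s (L2B Lf1 Lf2) (L2B Lu1 Lu2) bc (ltW x10).
  rewrite nf0 expr0n mulr0 => H.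
  have [h np] := cprim_nsq s.1.
  have := prim_int0_eq0 np (fun x => nsq_ge0 _) H x10.
  move=> /(_ x); rewrite x0 lerDl ler01 => /(_ isT)/nsq_eq0/eqP.
  by rewrite subr_eq0 => /eqP.
(* The estimate bounds the squared norm with [K], and [K <= (K + 1)^2]. *)
- exists (K + 1) => y g G.
  have [y1 [s bc Ly Lg]] := graph_csol lam lq G.
  have Lf := L2B Lg (L2Z lam Ly).
  have [] := @L2_of_bound R y (K * L2norm (fun x => g x - lam * y x) ^+ 2).
  + by have [] := Ly.
  + by have [_ []] := Ly.
  + exact: L2_nsq.
  + by move=> b b0; exact: HE s Lf Ly bc b0.
  move=> _ H; have f0 := L2norm_ge0 (fun x => g x - lam * y x).
  rewrite -(@ler_pXn2r _ 2)// ?nnegrE ?L2norm_ge0 ?mulr_ge0//; last by lra.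
  apply: le_trans H _; rewrite exprMn; apply: ler_wpM2r; first exact: sqr_ge0.
  by have := mulr_ge0 K0 K0; rewrite expr2; lra.
Qed.

End Onto.

(** * Sufficiency of the Molchanov condition *)

Section Compactness.
Variable R : realType.
Local Notation mu := (@lebesgue_measure R).
Local Notation I h a b := (\int[mu]_(x in `[a, b]) h x).
Local Notation C := R[i].
Implicit Types (p f q y g : R -> C).

(** Cauchy-Schwarz against the constant 1, from the nonnegative integral of the squared deviation of
    [g] from its mean [J / L]. *)
Lemma sqr_I_le (g : R -> R) (s t : R) : lint g -> lint (fun x => g x ^+ 2) -> 0 <= s -> s <= t ->
  I g s t ^+ 2 <= (t - s) * I (fun x => g x ^+ 2) s t.
Proof.
move=> lg lg2 s0; rewrite le_eqVlt => /orP[/eqP <-|st]; first by rewrite subrr mul0r Ixx expr0n.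
set J := I g s t; set L := t - s.
have L0 : 0 < L by rewrite subr_gt0.
have l1 := lintZ (2 * (J / L)) lg; have l2 := lintB lg2 l1.
have : 0 <= I (fun x => g x ^+ 2 - 2 * (J / L) * g x + (J / L) ^+ 2) s t.
  apply: Ige0 => x _; rewrite (_ : _ + _ = (g x - J / L) ^+ 2) ?sqr_ge0//; ring.
rewrite ID//; last exact: lint_cst.
rewrite IB// IZ// (Icst _ (ltW st)) -/J -/L.
set X := I (fun x => g x ^+ 2) s t => /(mulr_ge0 (ltW L0)).
have -> : L * (X - 2 * (J / L) * J + (J / L) ^+ 2 * L) = L * X - J ^+ 2 by field; rewrite gt_eqF.
by rewrite subr_ge0.
Qed.

Lemma nsq_diff_le y y1 (s t : R) : cprim y y1 -> lint (fun x => nsq (y1 x)) -> 0 <= s -> s <= t ->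
  nsq (y t - y s) <= (t - s) * I (fun x => nsq (y1 x)) s t.
Proof.
move=> [pa pb] ln s0 st.
have sq (h : R -> R) : lint h -> (forall x, h x ^+ 2 <= nsq (y1 x)) -> lint (fun x => h x ^+ 2).
  move=> lh hn; apply: (lint_le _ ln); first by apply: measurable_funX; exact: lint_meas.
  by move=> x _; rewrite !ger0_norm ?nsq_ge0 ?sqr_ge0.
have la := prim_lint pa; have lb := prim_lint pb.
have la2 := sq _ la (fun x => ltac:(by rewrite /nsq lerDl sqr_ge0)).
have lb2 := sq _ lb (fun x => ltac:(by rewrite /nsq lerDr sqr_ge0)).
rewrite /nsq reB imB (primB_itv pa s0 st) (primB_itv pb s0 st) ID// mulrDr.
by apply: lerD; exact: sqr_I_le.
Qed.

Lemma nsq_diff_sym (z w : C) : nsq (z - w) = nsq (w - z).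
Proof. by rewrite /nsq !reB !imB -[re z - _]opprB -[im z - _]opprB !sqrrN. Qed.

Lemma nsq_itv_diff_le y y1 (a b s t : R) : cprim y y1 -> lint (fun x => nsq (y1 x)) -> 0 <= a ->
  a <= s <= b -> a <= t <= b -> nsq (y t - y s) <= (b - a) * I (fun x => nsq (y1 x)) a b.
Proof.
move=> py ln a0 /andP[as_ sb] /andP[at_ tb].
have n0 u v : 0 <= I (fun x => nsq (y1 x)) u v by apply: Ige0 => *; exact: nsq_ge0.
have key u v : a <= u -> u <= v -> v <= b -> nsq (y v - y u) <= (b - a) * I (fun x => nsq (y1 x)) a b.
  move=> au uv vb; apply: le_trans (nsq_diff_le py ln (le_trans a0 au) uv) _.
  apply: ler_pM => //; [by rewrite subr_ge0|by lra|].
  rewrite (Ichasles ln a0 (le_trans au uv) vb) (Ichasles ln a0 au uv).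
  by have := n0 a u; have := n0 v b; lra.
have [st|ts] := leP s t; first exact: key.
by rewrite nsq_diff_sym; apply: key => //; exact: ltW.
Qed.

(** Integrate [|y x|^2 <= 2 |y t|^2 + 2 |y x - y t|^2] in [t] against [rho]; the increment is at
    most [h] times the Dirichlet integral. With [rho = |q|] it exploits the Molchanov condition,
    with [rho = 1] it bounds [y] pointwise. *)
Lemma weighted_pointwise y y1 (rho : R -> R) (a h x : R) : cprim y y1 -> lint (fun x => nsq (y1 x)) ->
  lint rho -> (forall x, 0 <= rho x) -> 0 <= a -> 0 <= h -> a <= x <= a + h ->
  nsq (y x) * I rho a (a + h) <=
    2 * I (fun t => rho t * nsq (y t)) a (a + h)
    + 2 * h * I (fun t => nsq (y1 t)) a (a + h) * I rho a (a + h).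
Proof.
move=> py ln lr r0 a0 h0 xD; have [hy pn] := cprim_nsq py.
have lry : lint (fun t => rho t * nsq (y t)) := lintM lr pn.
set D1 := I (fun t => nsq (y1 t)) a (a + h).
have l1 := lintZ 2 lry; have l2 := lintZ (2 * h * D1) lr.
suff : I (fun t => nsq (y x) * rho t) a (a + h) <=
    I (fun t => 2 * (rho t * nsq (y t)) + 2 * h * D1 * rho t) a (a + h).
  by rewrite ID// !IZ.
apply: Ile => //; [exact: lintZ|exact: lintD|].
move=> t tD.
have H := nsq_itv_diff_le py ln a0 tD xD.
have : nsq (y x) <= 2 * nsq (y t) + 2 * ((a + h - a) * D1).
  have -> : y x = y t + (y x - y t) by ring.
  by apply: le_trans (nsqD_le _ _) _; rewrite lerD2l; apply: ler_wpM2l.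
rewrite (_ : a + h - a = h); last by ring.
by move=> /(ler_wpM2r (r0 t)); lra.
Qed.

(** The threshold [1 / h] balances the two terms of [weighted_pointwise]: as [1 <= h * W], division
    by [W] gives [|y x|^2 <= 2 * h * (Q + D1)], and integration over the interval adds another
    factor [h]. *)
Lemma interval_L2_le y y1 q (a h : R) : cprim y y1 -> lint (fun x => nsq (y1 x)) -> clint q ->
  0 <= a -> 0 < h -> h^-1 <= I (fun x => cabs (q x)) a (a + h) ->
  I (fun x => nsq (y x)) a (a + h) <=
    2 * h ^+ 2 * (I (fun x => nsq (y1 x)) a (a + h) + I (fun x => cabs (q x) * nsq (y x)) a (a + h)).
Proof.
move=> py ln cq a0 h0; have lq := lint_cabs cq; have [hy pn] := cprim_nsq py.
set W := I (fun x => cabs (q x)) a (a + h) => hW.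
set D1 := I (fun x => nsq (y1 x)) a (a + h); set Q := I (fun x => cabs (q x) * nsq (y x)) a (a + h).
have W0 : 0 < W by apply: lt_le_trans hW; rewrite invr_gt0.
have Q0 : 0 <= Q by apply: Ige0 => *; rewrite mulr_ge0 ?cabs_ge0 ?nsq_ge0.
have ah : a <= a + h by lra.
have pt x : a <= x <= a + h -> nsq (y x) <= 2 * h * (Q + D1).
  move=> xD; have := weighted_pointwise py ln lq (fun x => cabs_ge0 _) a0 (ltW h0) xD.
  rewrite -/W -/D1 -/Q => H.
  have hW1 : 1 <= h * W by rewrite mulrC -ler_pdivrMr// mul1r.
  have := ler_wpM2r Q0 hW1; rewrite mul1r => H2.
  rewrite -(ler_pM2r W0); lra.
apply: (@le_trans _ _ (I (fun=> 2 * h * (Q + D1)) a (a + h))).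
  by apply: Ile => //; [exact: lint_nsq_prim py|exact: lint_cst].
by rewrite Icst//; lra.
Qed.

Lemma integral_itvco (g : R -> R) (a h : R) : lint g -> 0 <= a ->
  (\int[mu]_(x in [set` `[a, (a + h)%R[]) (g x)%:E = (I g a (a + h))%:E)%E.
Proof.
move=> lg a0; rewrite integral_itv_bndo_bndc.
  by rewrite /Rintegral fineK//; apply: integrable_fin_num; [exact: measurable_itv|exact: lint_itv].
apply: (measurable_int mu); apply: (integrableS _ _ _ (lint_itv (a + h) lg a0)) => //.
by apply: subset_itvl; rewrite bnd_simp.
Qed.

(** The condition is applied to the intervals [[n h, (n + 1) h[]. From some [n0] on each carries at
    least [1 / h] of [|q|], so the local estimates sum to [2 * h^2 * E]. The point [b = n0 * h]
    depends on [q], [E] and [e] but not on [y]. *)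
Lemma molchanov_tail q (E e : R) : clint q -> molchanov q -> 0 <= E -> 0 < e ->
  exists2 b : R, 0 <= b & forall (y y1 : R -> C) (c : R), cprim y y1 -> lint (fun x => nsq (y1 x)) ->
    (forall M : R, 0 <= M -> I (fun x => nsq (y1 x)) 0 M + I (fun x => cabs (q x) * nsq (y x)) 0 M <= E) ->
    b <= c -> I (fun x => nsq (y x)) b c <= e.
Proof.
move=> cq mq E0 e0; have lq := lint_cabs cq.
have E1 : 0 < E + 1 by lra.
(* [h <= 1] gives [h^2 <= h], so the second entry ensures [2 * h^2 * E <= e]. *)
pose h := Num.min 1 (e / (2 * (E + 1))).
have h0 : 0 < h by rewrite lt_min ltr01 divr_gt0// mulr_gt0.
have h1 : h <= 1 by rewrite ge_min lexx.
have hE : 2 * h ^+ 2 * E <= e.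
  have : h * (2 * (E + 1)) <= e by rewrite -ler_pdivlMr ?mulr_gt0// ge_min lexx orbT.
  have := ler_wpM2r (ltW h0) h1; have := mulr_ge0 (ltW h0) E0.
  rewrite mul1r -expr2 => u v w; have := ler_wpM2r E0 v; lra.
have an0 n : 0 <= n%:R * h by rewrite mulr_ge0// ltW.
have := mq h (fun n => n%:R * h) h0 an0.
have dis n m : n != m -> [set` `[n%:R * h, n%:R * h + h[] `&` [set` `[m%:R * h, m%:R * h + h[] = set0.
  wlog nm : n m / (n < m)%N.
    move=> W; rewrite neq_ltn => /orP[nm|mn]; first by apply: W => //; rewrite ltn_eqF.
    by rewrite setIC; apply: W => //; rewrite ltn_eqF.
  move=> _; rewrite -subset0 => x [] /=; rewrite !in_itv/= => /andP[_ x1] /andP[x2 _].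
  have : n.+1%:R * h <= m%:R * h by apply: ler_wpM2r; [exact: ltW|rewrite ler_nat].
  rewrite -natr1 mulrDl mul1r; lra.
move=> /(_ dis)/cvgeyPge/(_ h^-1)[n0 _ Hn0].
have Hn n : (n0 <= n)%N -> h^-1 <= I (fun x => cabs (q x)) (n%:R * h) (n%:R * h + h).
  by move=> nn; have := Hn0 n nn; rewrite /= integral_itvco// lee_fin.
exists (n0%:R * h) => // y y1 c py ln HE bc.
have ly := lint_nsq_prim py; have [hy pn] := cprim_nsq py.
have lqy : lint (fun x => cabs (q x) * nsq (y x)) := lintM lq pn.
have step m : I (fun x => nsq (y x)) (n0%:R * h) ((n0 + m)%:R * h) <=
    2 * h ^+ 2 * (I (fun x => nsq (y1 x)) (n0%:R * h) ((n0 + m)%:R * h) +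
                  I (fun x => cabs (q x) * nsq (y x)) (n0%:R * h) ((n0 + m)%:R * h)).
  elim: m => [|m IH]; first by rewrite addn0 !Ixx addr0 mulr0.
  have am : n0%:R * h <= (n0 + m)%:R * h.
    by apply: ler_wpM2r; [exact: ltW|rewrite ler_nat leq_addr].
  have mm : (n0 + m)%:R * h <= (n0 + m)%:R * h + h by lra.
  have -> : (n0 + m.+1)%:R * h = (n0 + m)%:R * h + h by rewrite addnS -natr1 mulrDl mul1r.
  rewrite (Ichasles ly (an0 _) am mm) (Ichasles ln (an0 _) am mm) (Ichasles lqy (an0 _) am mm).
  have := interval_L2_le py ln cq (an0 (n0 + m)%N) h0 (Hn _ (leq_addr _ _)).
  by move: IH; lra.
have c0 : 0 <= c / h by apply: divr_ge0; [exact: le_trans bc|exact: ltW].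
pose m := Num.bound (c / h).
have cm : c <= (n0 + m)%:R * h.
  rewrite -ler_pdivrMr// ltW//; apply: lt_le_trans (archi_boundP c0) _.
  by rewrite ler_nat leq_addl.
have H1 := step m; have H2 := HE _ (an0 (n0 + m)%N).
have Z (g : R -> R) (u v w : R) : lint g -> (forall x, 0 <= g x) -> 0 <= u -> u <= v -> v <= w -> I g u v <= I g u w /\ I g v w <= I g u w.
  move=> lg g0 u0 uv vw; rewrite (Ichasles lg u0 uv vw).
  have := @Ige0 _ g u v (fun x _ => g0 x); have := @Ige0 _ g v w (fun x _ => g0 x); lra.
have [Z1 _] := Z _ _ _ _ ly (fun x => nsq_ge0 _) (an0 n0) bc cm.
have [_ Z2] := Z _ _ _ _ ln (fun x => nsq_ge0 _) (lexx 0) (an0 n0) (le_trans bc cm).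
have [_ Z3] := Z _ _ _ _ lqy (fun x => mulr_ge0 (cabs_ge0 _) (nsq_ge0 _)) (lexx 0) (an0 n0) (le_trans bc cm).
apply: (le_trans Z1); apply: (le_trans H1); apply: le_trans hE.
by apply: ler_wpM2l; [rewrite mulr_ge0// sqr_ge0|exact: le_trans (lerD Z2 Z3) H2].
Qed.

End Compactness.

(** * Convergent subsequences and compactness of the resolvent *)

Section Subsequence.
Variable R : realType.
Local Notation mu := (@lebesgue_measure R).
Local Notation I h a b := (\int[mu]_(x in `[a, b]) h x).
Local Notation C := R[i].
Implicit Types (p f q g : R -> C).

Lemma increasing_choice (P : nat -> nat -> Prop) : (forall k m, exists2 n, (m < n)%N & P k n) ->
  exists phi : nat -> nat, (forall k, (phi k < phi k.+1)%N) /\ forall k, P k (phi k).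
Proof.
move=> H; have /choice[F HF] : forall km : nat * nat, exists n, (km.2 < n)%N /\ P km.1 n.
  by move=> [k m]; have [n mn Pn] := H k m; exists n.
pose phi := fix phi k := if k is k'.+1 then F (k'.+1, phi k') else F (0%N, 0%N).
exists phi; split => k; first by have [] := HF (k.+1, phi k).
by case: k => [|k]; [have [] := HF (0%N, 0%N)|have [] := HF (k.+1, phi k)].
Qed.

Section Sequence.
Variables (y y1 : nat -> R -> C) (E : R).
Hypothesis py : forall n, cprim (y n) (y1 n).
Hypothesis ln : forall n, lint (fun x => nsq (y1 n x)).
Hypothesis HE : forall n (M : R), 0 <= M ->
  I (fun x => nsq (y1 n x)) 0 M + I (fun x => nsq (y n x)) 0 M <= E.

Let I1_0 n u v : 0 <= I (fun x => nsq (y1 n x)) u v.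
Proof. by apply: Ige0 => *; exact: nsq_ge0. Qed.
Let I0_0 n u v : 0 <= I (fun x => nsq (y n x)) u v.
Proof. by apply: Ige0 => *; exact: nsq_ge0. Qed.
Let E0 : 0 <= E.
Proof. by have := HE 0 (lexx 0); rewrite !Ixx addr0. Qed.

Lemma energy_pointwise n (x : R) : 0 <= x -> nsq (y n x) <= 2 * E.
Proof.
move=> x0; have lc := @lint_cst R 1.
have xx : x <= x <= x + 1 by rewrite lexx lerDl ler01.
have := weighted_pointwise (py n) (ln n) lc (fun _ => ler01) x0 ler01 xx.
rewrite Icst; last by lra.
rewrite (_ : I (fun t => 1 * nsq (y n t)) x (x + 1) = I (fun t => nsq (y n t)) x (x + 1)); last first.
  by apply: Ieq => t _; rewrite mul1r.
have x1 : x <= x + 1 by lra.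
have := HE n (le_trans x0 x1).
rewrite (Ichasles (ln n) (lexx 0) x0 x1) (Ichasles (lint_nsq_prim (py n)) (lexx 0) x0 x1).
have := I1_0 n 0 x; have := I0_0 n 0 x; lra.
Qed.

Lemma energy_equicontinuous n (s t : R) : 0 <= s -> s <= t -> nsq (y n t - y n s) <= (t - s) * E.
Proof.
move=> s0 st; apply: le_trans (nsq_diff_le (py n) (ln n) s0 st) _.
apply: ler_wpM2l; first by rewrite subr_ge0.
have := HE n (le_trans s0 st); rewrite (Ichasles (ln n) (lexx 0) s0 st).
have := I1_0 n 0 s; have := I0_0 n 0 t; lra.
Qed.

(** Arzela-Ascoli along an ultrafilter: a limit exists at every point, the Hoelder bound passes to
    it, and closeness on a finite grid becomes uniform on [[0, b]]. Indices beyond any [m] are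
    provided for the later diagonal extraction. *)
Lemma locally_uniform_limit : exists z : R -> C,
  forall (b e : R) (m : nat), 0 <= b -> 0 < e ->
    exists2 n, (m < n)%N & forall x : R, 0 <= x <= b -> nsq (y n x - z x) <= e.
Proof.
have [U [UU Un]] := free_ultrafilter.
have PU := @ultra_proper _ U UU.
have lim (x : R) : exists zx : C, 0 <= x -> forall e : R, 0 < e -> U [set n | nsq (y n x - zx) < e].
  have [x0|x0] := leP 0 x; last by exists 0.
  have bnd n := abs_le_of_nsq (energy_pointwise n x0).
  have [l1 H1] := @ultra_lim R U (fun n => re (y n x)) (2 * E + 1) UU (fun n => (bnd n).1).
  have [l2 H2] := @ultra_lim R U (fun n => im (y n x)) (2 * E + 1) UU (fun n => (bnd n).2).
  exists (Complex l1 l2) => _ e e0.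
  pose d := Num.min 1 (e / 2).
  have d0 : 0 < d by rewrite lt_min ltr01 divr_gt0.
  have d2 : d ^+ 2 <= e / 2.
    have a1 : d <= 1 by rewrite ge_min lexx.
    have a2 : d <= e / 2 by rewrite ge_min lexx orbT.
    by have := ler_wpM2r (ltW d0) a1; rewrite expr2 mul1r; lra.
  apply: (@filterS nat U _ ([set n | `|re (y n x) - l1| < d] `&` [set n | `|im (y n x) - l2| < d])); last first.
    by apply: filterI; [exact: H1|exact: H2].
  move=> n [/= h1 h2]; rewrite /nsq reB imB/=.
  have s1 : (re (y n x) - l1) ^+ 2 < d ^+ 2.
    by rewrite -real_normK ?num_real// ltrXn2r ?nnegrE ?(ltW d0).
  have s2 : (im (y n x) - l2) ^+ 2 < d ^+ 2.
    by rewrite -real_normK ?num_real// ltrXn2r ?nnegrE ?(ltW d0).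
  lra.
have [z Hz] := choice lim; exists z => b e m b0 e0.
have zc (s t : R) : 0 <= s -> s <= t -> nsq (z t - z s) <= 4 * ((t - s) * E).
  move=> s0 st; apply/ler_addgt0Pr => d d0; have d8 : 0 < d / 8 by rewrite divr_gt0.
  have H : U ([set n | nsq (y n s - z s) < d / 8] `&` [set n | nsq (y n t - z t) < d / 8]).
    by apply: filterI; apply: Hz => //; exact: le_trans st.
  have [n [/= h1 h2]] := @filter_ex _ U PU _ H.
  have := energy_equicontinuous n s0 st.
  have := nsqB_le ((y n t - y n s) + (y n s - z s)) (y n t - z t).
  have := nsqD_le (y n t - y n s) (y n s - z s).
  rewrite (_ : y n t - y n s + (y n s - z s) - (y n t - z t) = z t - z s); last by ring.
  lra.
have E1 : 0 < 20 * (E + 1) by have := E0; lra.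
(* Within a cell the squared increments of [y n] and [z] are at most [d * E] and [4 * d * E], with
   [d * E <= e / 20]; adding the squared error [e / 20] at the grid point, two uses of
   [2 |u|^2 + 2 |v|^2] give at most [16 * e / 20]. *)
pose d := e / (20 * (E + 1)).
have d0 : 0 < d by rewrite divr_gt0.
have dE : d * E <= e / 20.
  have : d * (20 * (E + 1)) = e by rewrite divfK// gt_eqF.
  by have := d0; lra.
have grid k : U [set n | forall i : nat, (i < k)%N -> nsq (y n (i%:R * d) - z (i%:R * d)) < e / 20].
  elim: k => [|k IH]; first by apply: (@filterS _ U _ setT) => //; exact: filterT.
  have kd0 : 0 <= k%:R * d by rewrite mulr_ge0// ltW.
  have e20 : 0 < e / 20 by rewrite divr_gt0.
  apply: filterS (filterI IH (Hz _ kd0 _ e20)) => n [/= h1 h2] i.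
  by rewrite ltnS leq_eqVlt => /orP[/eqP ->|]; [exact: h2|exact: h1].
have [n [/= mn Hn]] := @filter_ex _ U PU _ (filterI (Un m.+1) (grid (Num.bound (b / d)).+1)).
exists n => // x /andP[x0 xb].
have xd0 : 0 <= x / d by rewrite divr_ge0// ltW.
pose i := Num.truncn (x / d).
have /andP[i1 i2] : i%:R <= x / d < i.+1%:R by exact: Num.Theory.truncn_itv.
have id0 : 0 <= i%:R * d by rewrite mulr_ge0// ltW.
have ix : i%:R * d <= x by rewrite -ler_pdivlMr.
have xi : x - i%:R * d <= d.
  by move: i2; rewrite ltr_pdivrMr// -natr1 mulrDl mul1r; lra.
have ib : (i < (Num.bound (b / d)).+1)%N.
  have bd0 : 0 <= b / d by rewrite divr_ge0// ltW.
  rewrite ltnS -(ler_nat R); apply: le_trans i1 _; apply: ltW.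
  by apply: le_lt_trans (archi_boundP bd0); rewrite ler_pM2r// invr_gt0.
have := Hn i ib; have := zc _ _ id0 ix; have := energy_equicontinuous n id0 ix.
have H1 : (x - i%:R * d) * E <= d * E by apply: ler_wpM2r.
have := nsqB_le ((y n x - y n (i%:R * d)) + (y n (i%:R * d) - z (i%:R * d))) (z x - z (i%:R * d)).
have := nsqD_le (y n x - y n (i%:R * d)) (y n (i%:R * d) - z (i%:R * d)).
rewrite (_ : y n x - y n (i%:R * d) + (y n (i%:R * d) - z (i%:R * d)) - (z x - z (i%:R * d)) = y n x - z x); last by ring.
lra.
Qed.

Hypothesis tail : forall e : R, 0 < e -> exists2 b : R, 0 <= b &
  forall n (c : R), b <= c -> I (fun x => nsq (y n x)) b c <= e.

(** The diagonal subsequence is within [1 / (k + 1)], in squared distance, on [[0, k]]. This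
    controls every fixed [[0, b]]; beyond [b], the uniform tails of the sequence pass to the
    limit. *)
Lemma L2_convergent_subsequence : exists (phi : nat -> nat) (z : R -> C),
  (forall n, (phi n < phi n.+1)%N) /\ L2 z /\
  (fun n => L2norm (fun x => y (phi n) x - z x)) @ \oo --> (0 : R).
Proof.
have [z Hz] := locally_uniform_limit.
have [phi [phi_inc Hphi]] : exists phi : nat -> nat, (forall k, (phi k < phi k.+1)%N) /\
    forall k, forall x : R, 0 <= x <= k%:R -> nsq (y (phi k) x - z x) <= k.+1%:R^-1.
  apply: (@increasing_choice (fun k n => forall x : R, 0 <= x <= k%:R -> nsq (y n x - z x) <= k.+1%:R^-1)).
  by move=> k m; apply: Hz => //; rewrite invr_gt0.
have cvg_part (g : C -> R) : (forall u v, g (u - v) = g u - g v) -> (forall u, g u ^+ 2 <= nsq u) ->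
    forall x : R, 0 <= x -> (fun k => g (y (phi k) x)) @ \oo --> g (z x).
  move=> gB gn x x0; apply/cvgrPdist_le => e e0; near=> k.
  rewrite -(@ler_pXn2r _ 2)// ?nnegrE ?(ltW e0)// real_normK ?num_real//.
  rewrite -sqrrN opprB -gB.
  apply: le_trans (gn _) _; apply: le_trans (Hphi k x _) _.
    by rewrite x0; near: k; exact: nbhs_infty_ger.
  rewrite invf_ple ?posrE ?exprn_gt0//.
  apply: (@le_trans _ _ k%:R); last by rewrite ler_nat.
  by near: k; exact: nbhs_infty_ger.
(* [z] comes from a pointwise choice of ultrafilter limits, so its measurability is recovered from
   the convergent subsequence; [g] stands for [re] or [im]. *)
have mz (g : C -> R) : (forall u v, g (u - v) = g u - g v) -> (forall u, g u ^+ 2 <= nsq u) ->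
    (forall n, measurable_fun (@Rp R) (fun x => g (y n x))) -> measurable_fun (@Rp R) (fun x => g (z x)).
  move=> gB gn mg; apply: (@measurable_fun_cvg _ _ _ _ (fun k x => g (y (phi k) x))) => //.
  by move=> x; rewrite /Rp/= in_itv/= andbT; exact: cvg_part.
have mz1 : measurable_fun (@Rp R) (fun x => re (z x)).
  apply: mz => [u v|u|n]; [exact: reB|by rewrite /nsq lerDl sqr_ge0|exact: prim_meas (py n).1].
have mz2 : measurable_fun (@Rp R) (fun x => im (z x)).
  apply: mz => [u v|u|n]; [exact: imB|by rewrite /nsq lerDr sqr_ge0|exact: prim_meas (py n).2].
have zb (x : R) : 0 <= x -> nsq (z x) <= 4 * E + 2.
  move=> x0; have xk : 0 <= x <= (Num.bound x)%:R by rewrite x0 ltW// archi_boundP.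
  have H := Hphi _ x xk.
  have : (Num.bound x).+1%:R^-1 <= 1 :> R by rewrite invf_le1// ler1n.
  have := energy_pointwise (phi (Num.bound x)) x0.
  move: (_^-1) H => w H; have := nsq_le_diff (y (phi (Num.bound x)) x) (z x); lra.
have lz : lint (fun x => nsq (z x)).
  apply: (lint_le _ (lint_cst (4 * E + 2))).
    by apply: measurable_funD; exact: measurable_funX.
  by move=> x x0; rewrite !ger0_norm ?nsq_ge0 ?zb//; have := E0; lra.
have ly n := lint_nsq_prim (py n).
have cz : clint z.
  split; apply: (lint_le _ (lint_cst (4 * E + 3))) => // x x0.
    have [h _] := abs_le_of_nsq (zb x x0).
    by rewrite [leRHS]ger0_norm; have := E0; lra.
  have [_ h] := abs_le_of_nsq (zb x x0).
  by rewrite [leRHS]ger0_norm; have := E0; lra.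
have cy n : clint (y n) := cprim_clint (py n).
have cNz : clint (fun x => - z x).
  by have [h1 h2] := cz; split; [apply: lint_eq (lintN h1)|apply: lint_eq (lintN h2)] => x _; rewrite ?reN ?imN.
have lNz : lint (fun x => nsq (- z x)) by apply: lint_eq lz => x _; rewrite /nsq reN imN !sqrrN.
have ld n : lint (fun x => nsq (y n x - z x)) := lint_nsqD (cy n) cNz (ly n) lNz.
(* For [k] with [c <= k] and [2 * c <= e * (k + 1)], comparison with [y (phi k)] costs [2 * e] for
   its tail and [e] for the distance. *)
have ztail (e b c : R) : 0 <= b -> b <= c -> 0 < e ->
    (forall n (c : R), b <= c -> I (fun x => nsq (y n x)) b c <= e) -> I (fun x => nsq (z x)) b c <= 3 * e.
  move=> b0 bc e0 He.
  pose k := maxn (Num.bound c) (Num.bound (2 * c / e)).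
  have c0 : 0 <= c by exact: le_trans bc.
  have ck : c <= k%:R.
    by apply: le_trans (ltW (archi_boundP c0)) _; rewrite ler_nat leq_maxl.
  have ek : 2 * c / e <= k.+1%:R.
    have h : 0 <= 2 * c / e by rewrite divr_ge0 ?mulr_ge0 ?(ltW e0).
    by apply: le_trans (ltW (archi_boundP h)) _; rewrite ler_nat ltnW// ltnS leq_maxr.
  have l1 := lintZ 2 (ly (phi k)).
  apply: (@le_trans _ _ (I (fun x => 2 * nsq (y (phi k) x) + 2 * k.+1%:R^-1) b c)).
    apply: Ile => //; first exact: lintD l1 (lint_cst _).
    move=> x /andP[bx xc].
    have xk : 0 <= x <= k%:R by rewrite (le_trans b0 bx) (le_trans xc ck).
    have := Hphi k x xk.
    by move: (_^-1) => w; have := nsq_le_diff (y (phi k) x) (z x); lra.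
  rewrite ID//; last exact: lint_cst.
  rewrite IZ// Icst//; have H1 := He (phi k) c bc.
  suff H2 : 2 * k.+1%:R^-1 * (c - b) <= e.
    by rewrite (_ : 3 * e = 2 * e + e); [apply: lerD => //; apply: ler_wpM2l|ring].
  apply: (@le_trans _ _ (2 * k.+1%:R^-1 * c)).
    by apply: ler_wpM2l; [rewrite mulr_ge0// invr_ge0|lra].
  by rewrite mulrAC ler_pdivrMr// [e * _]mulrC -ler_pdivrMr.
(* The budget is [e / 10] on [[0, b]], and beyond [b] twice the tail [e / 10] of the sequence plus
   twice the tail [3 * e / 10] of the limit. *)
have key (e : R) : 0 < e -> \forall k \near \oo, forall c : R, 0 <= c -> I (fun x => nsq (y (phi k) x - z x)) 0 c <= e.
  move=> e0; have e10 : 0 < e / 10 by rewrite divr_gt0.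
  have [b b0 Hb] := tail e10.
  near=> k => c c0.
  have bk : b <= k%:R by near: k; exact: nbhs_infty_ger.
  have ek : 10 * b / e <= k%:R by near: k; exact: nbhs_infty_ger.
  have near0 : I (fun x => nsq (y (phi k) x - z x)) 0 b <= e / 10.
    apply: (@le_trans _ _ (I (fun=> k.+1%:R^-1) 0 b)).
      apply: Ile => //; first exact: lint_cst.
      by move=> x /andP[x0 xb]; apply: Hphi; rewrite x0 (le_trans xb bk).
    rewrite Icst// subr0 mulrC ler_pdivrMr//.
    have : k%:R <= k.+1%:R :> R by rewrite ler_nat.
    by move: ek; rewrite ler_pdivrMr// => ek kk; have := ler_wpM2r (ltW e0) kk; lra.
  have mono (u v : R) : 0 <= u -> u <= v -> I (fun x => nsq (y (phi k) x - z x)) 0 u <= I (fun x => nsq (y (phi k) x - z x)) 0 v.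
    move=> u0 uv; rewrite (Ichasles (ld (phi k)) (lexx 0) u0 uv) lerDl.
    by apply: Ige0 => *; exact: nsq_ge0.
  have [cb|bc] := leP c b; first by have := mono c b c0 cb; lra.
  rewrite (Ichasles (ld (phi k)) (lexx 0) b0 (ltW bc)).
  have l1 := lintZ 2 (ly (phi k)); have l2 := lintZ 2 lz.
  have H3 : I (fun x => nsq (y (phi k) x - z x)) b c <= 2 * (e / 10) + 2 * (3 * (e / 10)).
    apply: (@le_trans _ _ (I (fun x => 2 * nsq (y (phi k) x) + 2 * nsq (z x)) b c)).
      by apply: Ile => //; [exact: lintD|move=> x _; exact: nsqB_le].
    rewrite ID// !IZ//; apply: lerD; apply: ler_wpM2l => //; first exact: Hb (ltW bc).
    exact: ztail b0 (ltW bc) e10 Hb.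
  by apply: le_trans (lerD near0 H3) _; lra.
have L2y n : L2 (y n).
  have [] // := @L2_of_bound _ (y n) E.
  - exact: prim_meas (py n).1.
  - exact: prim_meas (py n).2.
  - by move=> b b0; have := HE n b0; have := I1_0 n 0 b; lra.
have L2z : L2 z.
  have [N _ HN] := key 1 ltr01; have {}HN := HN N (leqnn N).
  have [] // := @L2_of_bound _ z (2 * E + 2).
  move=> b b0; have l1 := lintZ 2 (ly (phi N)); have l2 := lintZ 2 (ld (phi N)).
  apply: (@le_trans _ _ (I (fun x => 2 * nsq (y (phi N) x) + 2 * nsq (y (phi N) x - z x)) 0 b)).
    apply: Ile => //; first exact: lintD.
    by move=> x _; exact: nsq_le_diff.
  rewrite ID// !IZ//; apply: (@le_trans _ _ (2 * E + 2 * 1)); last by rewrite mulr1.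
  apply: lerD; apply: ler_wpM2l => //; last exact: HN.
  by have := HE (phi N) b0; have := I1_0 (phi N) 0 b; lra.
exists phi, z; split => //; split => //.
apply/cvgrPdist_le => e e0; have e2 : 0 < e ^+ 2 by rewrite exprn_gt0.
near=> k.
rewrite sub0r normrN ger0_norm ?L2norm_ge0//.
rewrite -(@ler_pXn2r _ 2)// ?nnegrE ?L2norm_ge0 ?(ltW e0)//.
have Hk : forall c : R, 0 <= c -> I (fun x => nsq (y (phi k) x - z x)) 0 c <= e ^+ 2.
  by near: k; exact: key.
have Ld := L2B (L2y (phi k)) L2z.
by have [] := @L2_of_bound _ (fun x => y (phi k) x - z x) (e ^+ 2) Ld.1 Ld.2.1 (ld _) Hk.
Unshelve. all: by end_near. Qed.

End Sequence.

Lemma compact_resolvent_of_coercive q (A B lam : C) (K : R) :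
  L1loc q -> molchanov q -> 0 <= K ->
  (forall f y y1 (M : R), csol (fun x => q x - lam) f y y1 -> L2 f -> L2 y ->
     A * y 0 + B * y1 0 = 0 -> 0 <= M ->
     I (fun x => nsq (y1 x)) 0 M + I (fun x => cabs (q x) * nsq (y x)) 0 M
       + I (fun x => nsq (y x)) 0 M <= K * L2norm f ^+ 2) ->
  compact_resolvent_at q A B lam.
Proof.
move=> lq mq K0 HE f y M Lf fM yG.
have cq : clint q by split => b b0; have [] := lq b b0.
have M0 : 0 <= M by apply: le_trans (fM 0%N); exact: L2norm_ge0.
pose E := K * M ^+ 2.
have E0 : 0 <= E by rewrite mulr_ge0 ?sqr_ge0.
have /choice[y1 Hy1] : forall n, exists y1 : R -> C, [/\ cprim (y n) y1, lint (fun x => nsq (y1 x)) &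
    forall c : R, 0 <= c -> I (fun x => nsq (y1 x)) 0 c + I (fun x => cabs (q x) * nsq (y n x)) 0 c
       + I (fun x => nsq (y n x)) 0 c <= E].
  move=> n; have [g [G ge]] := yG n; have [y1 [s bc Ly Lg]] := graph_csol lam lq G.
  exists y1; split; [exact: s.1|exact: lint_nsq_prim s.2|].
  move=> c c0; have Lf' := L2B Lg (L2Z lam Ly).
  apply: le_trans (HE _ _ _ c s Lf' Ly bc c0) _; apply: ler_wpM2l => //.
  by rewrite lerXn2r ?nnegrE ?L2norm_ge0//; exact: ae_eq_L2norm_le (Lf n) ge M0 (fM n).
have py n : cprim (y n) (y1 n) by have [] := Hy1 n.
have ln n : lint (fun x => nsq (y1 n x)) by have [] := Hy1 n.
have HEn n (c : R) : 0 <= c -> I (fun x => nsq (y1 n x)) 0 c + I (fun x => cabs (q x) * nsq (y n x)) 0 c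
       + I (fun x => nsq (y n x)) 0 c <= E by have [_ _] := Hy1 n; apply.
have n1 n (c : R) : 0 <= I (fun x => nsq (y n x)) 0 c by apply: Ige0 => *; exact: nsq_ge0.
have n2 n (c : R) : 0 <= I (fun x => cabs (q x) * nsq (y n x)) 0 c.
  by apply: Ige0 => *; rewrite mulr_ge0 ?cabs_ge0 ?nsq_ge0.
apply: (@L2_convergent_subsequence y y1 E py ln).
  by move=> n c c0; have := HEn n c c0; have := n2 n c; lra.
move=> e e0; have [b b0 Hb] := molchanov_tail cq mq E0 e0.
exists b => // n c; apply: Hb (py n) (ln n) _ => c' c0.
by have := HEn n c' c0; have := n1 n c'; lra.
Qed.

End Subsequence.

(** * Necessity of the Molchanov condition *)

Section Bump.
Variable R : realType.
Local Notation mu := (@lebesgue_measure R).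
Local Notation I h a b := (\int[mu]_(x in `[a, b]) h x).
Local Notation C := R[i].
Implicit Types (p f q g : R -> C).

Lemma Ieq_oo (f g : R -> R) (a b : R) : lint f -> lint g -> 0 <= a ->
  (forall x : R, a < x < b -> f x = g x) -> I f a b = I g a b.
Proof.
move=> lf lg a0 fg; rewrite /Rintegral.
have mo (h : R -> R) : lint h -> measurable_fun (`]a, b[%classic : set R) h.
  move=> lh; apply: (measurable_funS _ _ (lint_meas lh)); first exact: measurable_itv.
  by move=> x /=; rewrite /Rp/= !in_itv/= andbT => /andP[ax _]; rewrite (le_trans a0)// ltW.
rewrite (@integral_itv_bndoo R a b (EFin \o f) true false); last by apply/measurable_EFinP; exact: mo.
rewrite (@integral_itv_bndoo R a b (EFin \o g) true false); last by apply/measurable_EFinP; exact: mo.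
by congr fine; apply: eq_integral => x; rewrite inE/= in_itv/= => /fg ->.
Qed.

Lemma Izero (f : R -> R) (a b : R) : a <= b -> (forall x : R, a <= x <= b -> f x = 0) -> I f a b = 0.
Proof. by move=> ab f0; rewrite (@Ieq _ f (fun=> 0))// Icst// mul0r. Qed.

Definition cutoff (a b : R) (F : R -> R) (x : R) : R := if a < x < b then F x else 0.

Lemma lint_cutoff (a b : R) (F : R -> R) : lint F -> lint (cutoff a b F).
Proof.
move=> lF; apply: (lint_le _ lF); last first.
  by move=> x _; rewrite /cutoff; case: ifP; rewrite ?normr0.
rewrite (_ : cutoff a b F = (fun x => F x * \1_(`]a, b[%classic) x)).
  by apply: measurable_funM; [exact: lint_meas|exact: measurable_indic].
apply/funext => x; rewrite /cutoff indicE mem_setE in_itv/=.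
by case: ifP => _; rewrite ?mulr1 ?mulr0.
Qed.

(** The zeros of [F] at both ends prevent jumps, so the extension by 0 has the density [H] cut off
    in the same way; the values at the ends do not affect the integral. *)
Lemma prim_cutoff (a b : R) (F H : R -> R) : prim F H -> 0 <= a -> a <= b -> F a = 0 -> F b = 0 ->
  prim (cutoff a b F) (cutoff a b H).
Proof.
move=> pF a0 ab Fa Fb; have lH := prim_lint pF; have lc := lint_cutoff a b lH.
have l0 := @lint_cst R 0.
split => // x x0.
have -> : cutoff a b F 0 = 0 by rewrite /cutoff ltNge a0.
rewrite add0r.
have below (t : R) : 0 <= t -> t <= a -> I (cutoff a b H) 0 t = 0.
  move=> t0 ta; apply: Izero => // s /andP[_ st].
  by rewrite /cutoff ltNge (le_trans st ta).
have mid (t : R) : a <= t -> t <= b -> I (cutoff a b H) a t = F t.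
  move=> at_ tb; rewrite -[RHS]subr0 -Fa (primB_itv pF a0 at_).
  apply: Ieq_oo => // s /andP[as_ st]; by rewrite /cutoff as_ (lt_le_trans st tb).
have [xa|ax] := leP x a; first by rewrite below// /cutoff ltNge xa.
rewrite (Ichasles lc (lexx 0) a0 (ltW ax)) below// add0r.
have [xb|bx] := ltP x b; first by rewrite /cutoff ax xb mid// ltW.
rewrite /cutoff ax ltNge bx/= (Ichasles lc a0 ab bx) mid// Fb add0r.
rewrite (@Ieq_oo _ (fun=> 0)) ?(le_trans a0)// ?Icst ?mul0r// => s /andP[bs _].
by rewrite /cutoff [s < b]ltNge (ltW bs) andbF.
Qed.

Definition ccutoff (a b : R) (F : R -> C) (x : R) : C := if a < x < b then F x else 0.

Lemma cprim_cutoff (a b : R) (F H : R -> C) : cprim F H -> 0 <= a -> a <= b -> F a = 0 -> F b = 0 ->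
  cprim (ccutoff a b F) (ccutoff a b H).
Proof.
move=> [p1 p2] a0 ab Fa Fb; split.
  apply: prim_eq (prim_cutoff p1 a0 ab _ _); rewrite ?Fa ?Fb// => x _;
    by rewrite /cutoff /ccutoff; case: ifP.
apply: prim_eq (prim_cutoff p2 a0 ab _ _); rewrite ?Fa ?Fb// => x _;
  by rewrite /cutoff /ccutoff; case: ifP.
Qed.

(* The Wronskian of the two solutions with unit data at [0] is constant, so it equals [1] at [a]. *)
Lemma csol_initial p (a : R) : clint p -> 0 <= a ->
  exists u u1 : R -> C, [/\ csol p (fun=> 0) u u1, u a = 1 & u1 a = 0].
Proof.
move=> cp a0.
have [v [v1 [v0 v10 sv]]] := csol_exists 1 0 cp (clint_cst 0).
have [w [w1 [w0 w10 sw]]] := csol_exists 0 1 cp (clint_cst 0).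
exists (fun x => w1 a * v x - v1 a * w x), (fun x => w1 a * v1 x - v1 a * w1 x).
have sol := csolB (csolZ (w1 a) sv) (csolZ (v1 a) sw).
split; first by apply: csol_eq sol => x _; rewrite !mulr0 subr0.
  have [W1 W2] : cprim (fun x => v x * w1 x - v1 x * w x) (fun=> 0).
    have A := cprimM sv.1 sw.2; have B := cprimM sv.2 sw.1.
    by apply: cprim_eq (cprimD A (cprimZ (-1) B)) => x _; ring.
  have -> : w1 a * v a - v1 a * w a = v a * w1 a - v1 a * w a by ring.
  have e (g h : R -> R) : prim g h -> (forall x, h x = 0) -> g a = g 0.
    by move=> [_ ->] // h0; rewrite (Izero a0) ?addr0.
  have {W1}W1 := e _ _ W1 (fun _ => erefl); have {W2}W2 := e _ _ W2 (fun _ => erefl).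
  by apply: complex_ext; rewrite ?W1 ?W2 v0 v10 w0 w10 !(mul0r, mul1r, subr0).
by rewrite mulrC subrr.
Qed.

(** Let [S] be the supremum of [|u|] on the interval. Then [|u1| <= 2 * P * S], hence
    [|u - 1| <= 4 * d * P * S <= S / 4], so [S <= 1 + S / 4] and [S <= 4 / 3]. The factors 2 come
    from treating real and imaginary parts separately; the smallness of [d] is what yields
    [S / 4]. *)
Lemma csol_local_bounds p u u1 (a d P : R) : clint p -> 0 <= a -> 0 < d -> 0 <= P ->
  I (fun x => cabs (p x)) a (a + d) <= P -> 16 * (d * (P + 1)) <= 1 ->
  csol p (fun=> 0) u u1 -> u a = 1 -> u1 a = 0 ->
  forall x : R, a <= x <= a + d -> [/\ cabs (u x) <= 2, 1 / 2 <= cabs (u x) & cabs (u1 x) <= 4 * P].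
Proof.
move=> cp a0 d0 P0 IP dP [pu pu1] ua u1a.
have lp := lint_cabs cp; have cu := cprim_clint pu; have cu1 := cprim_clint pu1.
have lu1 := lint_cabs cu1; have ad : a <= a + d by lra.
have cpu := clintM cp pu.
have lpu1 : clint (fun x => p x * u x - 0) by have [h1 h2] := pu1; split; [exact: prim_lint h1|exact: prim_lint h2].
have incr (g h : R -> C) (x B : R) : cprim g h -> a <= x -> x <= a + d ->
    I (fun x => cabs (h x)) a x <= B -> cabs (g x - g a) <= 2 * B.
  move=> [g1 g2] ax xd HB.
  have ch : clint h by split; [exact: prim_lint g1|exact: prim_lint g2].
  have lh := lint_cabs ch.
  rewrite (_ : 2 * B = B + B); last by ring.
  apply: cabs_le_sum.
    rewrite reB (primB_itv g1 a0 ax); apply: le_trans (Iabs _ ch.1 a0) _; apply: le_trans HB.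
    by apply: Ile => //; [exact: lint_abs ch.1|move=> t _; exact: re_le_cabs].
  rewrite imB (primB_itv g2 a0 ax); apply: le_trans (Iabs _ ch.2 a0) _; apply: le_trans HB.
  by apply: Ile => //; [exact: lint_abs ch.2|move=> t _; exact: im_le_cabs].
have Isub (g : R -> R) x : lint g -> (forall x, 0 <= g x) -> a <= x -> x <= a + d -> I g a x <= I g a (a + d).
  move=> lg g0 ax xd; rewrite (Ichasles lg a0 ax xd) lerDl.
  by apply: Ige0 => *; exact: g0.
have u1b S : 0 <= S -> (forall x : R, a <= x <= a + d -> cabs (u x) <= S) ->
    forall x : R, a <= x <= a + d -> cabs (u1 x) <= 2 * (P * S).
  move=> S0 uS x /andP[ax xd]; rewrite -[u1 x]subr0 -u1a; apply: (incr _ _ x _ pu1) => //.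
  have lS := lintZ S lp.
  apply: (@le_trans _ _ (I (fun x => S * cabs (p x)) a x)).
    apply: Ile => //; first exact: lint_cabs lpu1.
    move=> t /andP[at_ tx]; rewrite subr0 cabsM mulrC; apply: ler_wpM2r; first exact: cabs_ge0.
    by apply: uS; rewrite at_ (le_trans tx).
  rewrite IZ// mulrC; apply: ler_wpM2r => //.
  by apply: le_trans IP; apply: Isub => // t; exact: cabs_ge0.
have ub S : 0 <= S -> (forall x : R, a <= x <= a + d -> cabs (u x) <= S) ->
    forall x : R, a <= x <= a + d -> cabs (u x - 1) <= S / 4.
  move=> S0 uS x /andP[ax xd]; rewrite -ua.
  apply: (@le_trans _ _ (2 * (2 * (P * S) * d))).
    apply: (incr _ _ x _ pu) => //.
    apply: (@le_trans _ _ (I (fun=> 2 * (P * S)) a (a + d))).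
      apply: le_trans (Isub _ x lu1 (fun x => cabs_ge0 _) ax xd) _.
      by apply: Ile => //; [exact: lint_cst|exact: u1b].
    by rewrite Icst// (_ : a + d - a = d)//; ring.
  have h := ler_wpM2r S0 dP; have := mulr_ge0 (ltW d0) S0; lra.
pose X := [set z : R | exists2 x : R, a <= x <= a + d & z = cabs (u x)].
have aD : a <= a <= a + d by rewrite lexx.
have [M [M0 HM]] : exists M : R, 0 <= M /\ forall x : R, a <= x <= a + d -> cabs (u x) <= M.
  have [M1 [M10 HM1]] := prim_bounded (a + d) pu.1.
  have [M2 [M20 HM2]] := prim_bounded (a + d) pu.2.
  exists (M1 + M2); split; first exact: addr_ge0.
  move=> x /andP[ax xd]; have xx : 0 <= x <= a + d by rewrite (le_trans a0 ax).
  by apply: cabs_le_sum; [exact: HM1|exact: HM2].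
have supX : has_sup X.
  by split; [exists (cabs (u a)), a|exists M => _ [x xD ->]; exact: HM].
have S_ub : forall x : R, a <= x <= a + d -> cabs (u x) <= sup X.
  by move=> x xD; apply: ub_le_sup; [case: supX|exists x].
have S0 : 0 <= sup X by apply: le_trans (S_ub a aD); exact: cabs_ge0.
have c1 : cabs (1 : C) = 1 by rewrite /cabs/= expr0n addr0 expr1n sqrtr1.
have S1 : sup X <= 1 + sup X / 4.
  apply: ge_sup; first by case: supX.
  move=> _ [x xD ->]; have := ub _ S0 S_ub x xD.
  by have := cabsD (u x - 1) 1; rewrite subrK c1; lra.
have S2 : sup X <= 4 / 3 by lra.
move=> x xD; have h1 := S_ub x xD; have h2 := ub _ S0 S_ub x xD; have h3 := u1b _ S0 S_ub x xD.
split; first by lra.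
  have := cabsB (u x) (u x - 1); rewrite (_ : u x - (u x - 1) = 1); last by ring.
  by rewrite c1; lra.
by apply: le_trans h3 _; have := ler_wpM2l P0 S2; lra.
Qed.

(** For [y = X0 * u], with [X1] and [X2] the derivatives of [X0],
    [- y'' + p y = - X2 * u - 2 * X1 * u']: the potential drops out and [f] is bounded. The square
    in [X0] makes both [y] and [y'] vanish at the ends, so the extension by 0 still solves the
    equation. *)
Lemma bump_solution p (a d P : R) : clint p -> 0 <= a -> 0 < d -> d <= 1 -> 0 <= P ->
  I (fun x => cabs (p x)) a (a + d) <= P -> 16 * (d * (P + 1)) <= 1 ->
  exists f y y1 : R -> C, [/\ csol p f y y1,
    forall x : R, ~~ (a < x < a + d) -> y x = 0 /\ y1 x = 0 /\ f x = 0,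
    forall x : R, nsq (y x) <= 4,
    forall x : R, nsq (f x) <= (12 + 16 * P) ^+ 2 &
    d / 2 * (1 / 4 * (d / 4) ^+ 8) <= I (fun x => nsq (y x)) a (a + d)].
Proof.
move=> cp a0 d0 d1 P0 IP dP.
have [u [u1 [sol ua u1a]]] := csol_initial cp a0.
have bnd := csol_local_bounds cp a0 d0 P0 IP dP sol ua u1a.
pose b := a + d; pose s (x : R) := (x - a) * (b - x).
pose X0 (x : R) : R := s x ^+ 2.
pose X1 (x : R) : R := 2 * s x * (a + b - 2 * x).
pose X2 (x : R) : R := 2 * (a + b - 2 * x) ^+ 2 - 4 * s x.
have pid := @prim_id R.
have pl1 : prim (fun x : R => x - a) (fun=> 1).
  by apply: prim_eq (primD pid (prim_cst (- a))) => x _ //; rewrite addr0.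
have pl2 : prim (fun x : R => b - x) (fun=> -1).
  by apply: prim_eq (primD (prim_cst b) (primZ (-1) pid)) => x _; ring.
have pl3 : prim (fun x : R => a + b - 2 * x) (fun=> -2).
  by apply: prim_eq (primD (prim_cst (a + b)) (primZ (-2) pid)) => x _; ring.
have ps : prim s (fun x => a + b - 2 * x).
  by apply: prim_eq (primM pl1 pl2) => x _; rewrite /s//; ring.
have pX0 : prim X0 X1.
  by apply: prim_eq (primM ps ps) => x _; rewrite /X0 /X1 ?expr2//; ring.
have pX1 : prim X1 X2.
  by apply: prim_eq (primZ 2 (primM ps pl3)) => x _; rewrite /X1 /X2 ?expr2//; ring.
have cr (g h : R -> R) : prim g h -> cprim (fun x => (g x)%:C%C) (fun x => (h x)%:C%C).
  by move=> pg; split => //; exact: prim_cst.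
have [pu pu1] := sol.
pose Y x : C := (X0 x)%:C%C * u x.
pose Y1 x : C := (X1 x)%:C%C * u x + (X0 x)%:C%C * u1 x.
pose Y2 x : C := (X2 x)%:C%C * u x + 2 * (X1 x)%:C%C * u1 x + (X0 x)%:C%C * (p x * u x).
have pY : cprim Y Y1 by apply: cprim_eq (cprimM (cr _ _ pX0) pu) => x _; rewrite /Y /Y1//; ring.
have pY1 : cprim Y1 Y2.
  apply: cprim_eq (cprimD (cprimM (cr _ _ pX1) pu) (cprimM (cr _ _ pX0) pu1)) => x _; rewrite /Y1 /Y2//; ring.
have sa : s a = 0 by rewrite /s subrr mul0r.
have sb : s b = 0 by rewrite /s subrr mulr0.
have ab : a <= b by rewrite /b; lra.
have Z0 (x : R) : s x = 0 -> Y x = 0 /\ Y1 x = 0.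
  by move=> sx; rewrite /Y /Y1 /X1 /X0 sx expr0n !(mulr0, mul0r) addr0.
have [Ya Y1a] := Z0 a sa; have [Yb Y1b] := Z0 b sb.
pose F x : C := - ((X2 x)%:C%C * u x + 2 * (X1 x)%:C%C * u1 x).
have sbnd (x : R) : a < x < b -> [/\ 0 <= s x, s x <= 1, (a + b - 2 * x) ^+ 2 <= 1 & `|a + b - 2 * x| <= 1].
  move=> /andP[ax xb]; rewrite /b in xb *.
  have n1 : `|a + (a + d) - 2 * x| <= 1 by rewrite ler_norml; apply/andP; split; lra.
  split => //; rewrite /s /b.
  - by apply: mulr_ge0; lra.
  - have h1 : x - a <= 1 by lra.
    have h2 : a + d - x <= 1 by lra.
    have h3 : 0 <= x - a by lra.
    have h4 : 0 <= a + d - x by lra.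
    by have := ler_pM h3 h4 h1 h2; rewrite mulr1.
  - by rewrite -real_normK ?num_real// expr_le1.
have cR (t : R) : cabs (t%:C%C : C) = `|t| by rewrite /cabs/= expr0n addr0 sqrtr_sqr.
exists (ccutoff a b F), (ccutoff a b Y), (ccutoff a b Y1); split.
- split; first exact: cprim_cutoff.
  apply: cprim_eq (cprim_cutoff pY1 a0 ab Y1a Y1b) => x _ //.
  by rewrite /ccutoff; case: ifP => _; [rewrite /Y2 /Y /F; ring|rewrite mulr0 subr0].
- by move=> x /negPf nx; rewrite /ccutoff -/b in nx *; rewrite nx.
- move=> x; rewrite /ccutoff; case: ifP => [xab|_]; last by rewrite /nsq/= expr0n addr0.
  have [s0 s1 _ _] := sbnd x xab.
  have [|u2 _ _] := bnd x; first by case/andP: xab => ax xb; rewrite !ltW.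
  rewrite -cabs_sqr /Y cabsM cR.
  have X0b : `|X0 x| <= 1 by rewrite ger0_norm ?sqr_ge0// expr_le1.
  have h := ler_pM (normr_ge0 _) (cabs_ge0 _) X0b u2.
  rewrite (_ : 4 = (1 * 2) ^+ 2); last by ring.
  by rewrite lerXn2r ?nnegrE ?mulr_ge0 ?cabs_ge0.
- move=> x; rewrite /ccutoff; case: ifP => [xab|_]; last by rewrite /nsq/= expr0n addr0 sqr_ge0.
  have [s0 s1 l2 l1] := sbnd x xab.
  have [|u2 _ u1b] := bnd x; first by case/andP: xab => ax xb; rewrite !ltW.
  have P16 : 0 <= 12 + 16 * P by lra.
  rewrite -cabs_sqr lerXn2r ?nnegrE ?cabs_ge0//.
  rewrite /F cabsN; apply: le_trans (cabsD _ _) _; rewrite !cabsM !cR.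
  have c2 : cabs (2 : C) = 2.
    rewrite (_ : (2 : C) = (2%:R)%:C%C); last by rewrite rmorph_nat.
    by rewrite cR ger0_norm.
  rewrite c2.
  (* With [|u| <= 2] and [|u1| <= 4 * P], the bounds 6 and 2 on [X2] and [X1] give
     [6 * 2 + 2 * 2 * 4 * P = 12 + 16 * P]. *)
  have X2b : `|X2 x| <= 6.
    by rewrite /X2 ler_norml; have := sqr_ge0 (a + b - 2 * x); lra.
  have X1b : `|X1 x| <= 2.
    rewrite /X1 normrM (_ : `|2 * s x| = 2 * s x); last by rewrite ger0_norm// mulr_ge0.
    by have := ler_pM s0 (normr_ge0 _) s1 l1; lra.
  have h1 := ler_pM (normr_ge0 _) (cabs_ge0 _) X2b u2.
  have h2 := ler_pM (normr_ge0 _) (cabs_ge0 _) X1b u1b.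
  lra.
(* On the middle half, of length [d / 2], both factors of [s] are at least [d / 4], so
   [X0 ^+ 2 >= (d / 4) ^+ 8], while [|u|^2 >= 1 / 4]. *)
- pose l := a + d / 4; pose r := a + 3 * d / 4.
  have al : a <= l by rewrite /l; lra.
  have l0 : 0 <= l by rewrite (le_trans a0).
  have lr : l <= r by rewrite /l /r; lra.
  have rb : r <= b by rewrite /r /b; lra.
  have pc := cprim_cutoff pY a0 ab Ya Yb; have lc := lint_nsq_prim pc.
  apply: (@le_trans _ _ (I (fun x => nsq (ccutoff a b Y x)) l r)); last first.
    rewrite -/b (Ichasles lc a0 (le_trans al lr) rb) (Ichasles lc a0 al lr).
    have n0 v w : 0 <= I (fun x => nsq (ccutoff a b Y x)) v w by apply: Ige0 => *; exact: nsq_ge0.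
    by rewrite -addrA addrCA lerDl addr_ge0.
  rewrite (_ : d / 2 * _ = (1 / 4 * (d / 4) ^+ 8) * (r - l)); last by rewrite /r /l; field.
  rewrite -Icst//; apply: Ile => //; first exact: lint_cst.
  move=> x /andP[lx xr]; have xab : a < x < b by rewrite /l /r /b in lx xr *; apply/andP; split; lra.
  rewrite /ccutoff xab /Y nsqM.
  have [|_ u2 _] := bnd x; first by case/andP: xab => ax xb; rewrite !ltW.
  have d4 : 0 <= d / 4 by lra.
  have hs : (d / 4) ^+ 2 <= s x.
    rewrite expr2 /s; apply: ler_pM => //; rewrite /l /r /b in lx xr *; lra.
  have h8 : (d / 4) ^+ 8 <= nsq (X0 x)%:C%C.
    rewrite /nsq/= expr0n addr0 /X0 -exprM (_ : 8%N = (2 * 4)%N)// exprM.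
    by rewrite lerXn2r ?nnegrE ?exprn_ge0// (le_trans _ hs) ?exprn_ge0.
  have h4 : 1 / 4 <= nsq (u x).
    rewrite -cabs_sqr (_ : 1 / 4 = (1 / 2) ^+ 2); last by field.
    by rewrite lerXn2r ?nnegrE ?cabs_ge0//; lra.
  by rewrite mulrC; apply: ler_pM => //; exact: exprn_ge0.
Qed.

End Bump.

(** * Disjoint bumps against compactness *)

Section Necessity.
Variable R : realType.
Local Notation mu := (@lebesgue_measure R).
Local Notation I h a b := (\int[mu]_(x in `[a, b]) h x).
Local Notation C := R[i].
Implicit Types (p f q g : R -> C).

Lemma L2_of_support f (a d M : R) : clint f -> lint (fun x => nsq (f x)) -> 0 <= a -> 0 < d ->
  (forall x : R, ~~ (a < x < a + d) -> f x = 0) -> (forall x, nsq (f x) <= M) ->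
  L2 f /\ L2norm f ^+ 2 <= M * d.
Proof.
move=> [f1 f2] lf a0 d0 fs fM; have M0 : 0 <= M by apply: le_trans (fM 0); exact: nsq_ge0.
have ad : a <= a + d by lra.
have Iz (u v : R) : u <= v -> v <= a \/ a + d <= u -> I (fun x => nsq (f x)) u v = 0.
  move=> uv H; apply: Izero => // x /andP[ux xv]; rewrite fs ?/nsq/= ?expr0n ?addr0//.
  by apply/negP => /andP[ax xd]; case: H; lra.
apply: L2_of_bound => //; [exact: lint_meas|exact: lint_meas|].
move=> c c0; pose m := Num.max c (a + d).
have cm : c <= m by rewrite le_max lexx.
have dm : a + d <= m by rewrite le_max lexx orbT.
have mono : I (fun x => nsq (f x)) 0 c <= I (fun x => nsq (f x)) 0 m.
  by rewrite (Ichasles lf (lexx 0) c0 cm) lerDl; apply: Ige0 => *; exact: nsq_ge0.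
apply: le_trans mono _.
rewrite (Ichasles lf (lexx 0) a0 (le_trans ad dm)) (Ichasles lf a0 ad dm).
rewrite (Iz 0 a a0 (or_introl (lexx _))) (Iz _ m dm (or_intror (lexx _))) add0r addr0.
apply: (@le_trans _ _ (I (fun=> M) a (a + d))); first by apply: Ile => //; exact: lint_cst.
by rewrite Icst// (_ : a + d - a = d)//; ring.
Qed.

(** Two late members of the convergent subsequence would be close to the same [z], hence to each
    other on the support of one of them, where the other vanishes; this contradicts the lower bound
    [c0] on the mass. *)
Lemma molchanov_of_compact q (A B lam : C) : L1loc q -> compact_resolvent_at q A B lam -> molchanov q.
Proof.
move=> lq cmp h a h0 a0 dis; apply: contrapT => ncv.
have cq : clint q by split => b b0; have [] := lq b b0.
have lcq := lint_cabs cq.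
(* Failure of divergence to infinity gives a level [Q] that is not exceeded for arbitrarily large
   indices. *)
have [Q HQ] : exists Q : R, forall m : nat, exists2 n, (m < n)%N & I (fun x => cabs (q x)) (a n) (a n + h) <= Q.
  apply: contrapT => H; apply: ncv; apply/cvgeyPge => Q; apply: contrapT => HnQ; apply: H; exists Q => m.
  apply: contrapT => Hm; apply: HnQ; exists m.+1 => // n /= mn.
  rewrite integral_itvco// lee_fin leNgt; apply/negP => lt; apply: Hm; exists n => //; exact: ltW.
have [sg [sg_inc Hsg]] := increasing_choice (fun _ : nat => HQ).
have sg_lt n m : (n < m)%N -> (sg n < sg m)%N.
  elim: m => // m IH; rewrite ltnS leq_eqVlt => /orP[/eqP ->|/IH nm]; first exact: sg_inc.
  exact: ltn_trans nm (sg_inc m).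
have Q0 : 0 <= Q by apply: le_trans (Hsg 0%N); apply: Ige0 => *; exact: cabs_ge0.
pose P := Q + cabs lam.
have P0 : 0 <= P by rewrite addr_ge0// cabs_ge0.
(* [d < h] keeps each bump inside its own interval, [d <= 1] makes [Q + |lam|] a bound for the
   integral of [|q - lam|], and the last entry is the smallness condition of [csol_local_bounds]. *)
pose d := Num.min (h / 2) (Num.min 1 (16 * (P + 1))^-1).
have P1 : 0 < 16 * (P + 1) by lra.
have d0 : 0 < d by rewrite !lt_min ltr01 invr_gt0 P1 divr_gt0.
have dh : d < h by rewrite gt_min; apply/orP; left; lra.
have d1 : d <= 1 by rewrite !ge_min lexx orbT.
have dP : 16 * (d * (P + 1)) <= 1.
  have : d <= (16 * (P + 1))^-1 by rewrite !ge_min lexx !orbT.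
  by move=> hd; have := ler_wpM2r (ltW P1) hd; rewrite (mulVf (lt0r_neq0 P1)); lra.
pose p x := q x - lam.
have cp : clint p := clintB cq (clint_cst lam).
have Ip n : I (fun x => cabs (p x)) (a (sg n)) (a (sg n) + d) <= P.
  have an := a0 (sg n).
  have e1 : a (sg n) <= a (sg n) + d by lra.
  have e2 : a (sg n) + d <= a (sg n) + h by lra.
  apply: (@le_trans _ _ (I (fun x => cabs (q x) + cabs lam) (a (sg n)) (a (sg n) + d))).
    apply: Ile => //; [exact: lint_cabs cp|exact: lintD lcq (lint_cst _)|].
    by move=> x _; exact: cabsB.
  rewrite ID//; last exact: lint_cst.
  rewrite Icst//; apply: lerD.
    apply: le_trans (Hsg n); rewrite (Ichasles lcq an e1 e2) lerDl.
    by apply: Ige0 => *; exact: cabs_ge0.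
  by rewrite (_ : _ - _ = d); [rewrite ler_piMr ?cabs_ge0|ring].
have /choice[F HF] : forall n, exists F : (R -> C) * (R -> C) * (R -> C),
   [/\ csol p F.1.1 F.1.2 F.2,
    forall x : R, ~~ (a (sg n) < x < a (sg n) + d) -> F.1.2 x = 0 /\ F.2 x = 0 /\ F.1.1 x = 0,
    forall x : R, nsq (F.1.2 x) <= 4,
    forall x : R, nsq (F.1.1 x) <= (12 + 16 * P) ^+ 2 &
    d / 2 * (1 / 4 * (d / 4) ^+ 8) <= I (fun x => nsq (F.1.2 x)) (a (sg n)) (a (sg n) + d)].
  move=> n; have [f [y [y1 H]]] := bump_solution cp (a0 (sg n)) d0 d1 P0 (Ip n) dP.
  by exists (f, y, y1).
pose f n := (F n).1.1; pose y n := (F n).1.2; pose y1 n := (F n).2.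
have sol n : csol p (f n) (y n) (y1 n) by have [] := HF n.
have supp n : forall x : R, ~~ (a (sg n) < x < a (sg n) + d) -> y n x = 0 /\ y1 n x = 0 /\ f n x = 0.
  by have [] := HF n.
have fb n x : nsq (f n x) <= (12 + 16 * P) ^+ 2 by have [_ _ _ H _] := HF n; exact: H.
have yb n x : nsq (y n x) <= 4 by have [_ _ H _ _] := HF n; exact: H.
pose c0 := d / 2 * (1 / 4 * (d / 4) ^+ 8).
have c00 : 0 < c0 by rewrite !mulr_gt0 ?exprn_gt0 ?divr_gt0 ?invr_gt0.
have low n : c0 <= I (fun x => nsq (y n x)) (a (sg n)) (a (sg n) + d) by have [] := HF n.
have cy n : clint (y n) := cprim_clint (sol n).1.
have ly n := lint_nsq_prim (sol n).1.
have cf n : clint (f n).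
  have := clintB (clintM cp (sol n).1) (conj (prim_lint (sol n).2.1) (prim_lint (sol n).2.2)).
  case=> h1 h2; split; [apply: lint_eq h1|apply: lint_eq h2] => x _; congr (_ _); ring.
have lf n : lint (fun x => nsq (f n x)).
  apply: (lint_le _ (lint_cst ((12 + 16 * P) ^+ 2))).
    by have [h1 h2] := cf n; apply: measurable_funD; apply: measurable_funX; exact: lint_meas.
  by move=> x _; rewrite !ger0_norm ?nsq_ge0 ?sqr_ge0.
have Ly n : L2 (y n).
  by have [] := L2_of_support (cy n) (ly n) (a0 (sg n)) d0 (fun x hx => (supp n x hx).1) (yb n).
have Lf n : L2 (f n) /\ L2norm (f n) ^+ 2 <= (12 + 16 * P) ^+ 2 * d.
  exact: L2_of_support (cf n) (lf n) (a0 (sg n)) d0 (fun x hx => (supp n x hx).2.2) (fb n).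
have [||n|phi [z [phi_inc [Lz cvz]]]] := cmp f y (12 + 16 * P).
- by move=> n; have [] := Lf n.
- move=> n; have [_ H] := Lf n.
  have P16 : 0 <= 12 + 16 * P by lra.
  rewrite -(@ler_pXn2r _ 2)// ?nnegrE ?L2norm_ge0//.
  by apply: le_trans H _; rewrite ler_piMr ?sqr_ge0.
- exists (fun x => f n x + lam * y n x); split.
    apply: csol_graph; [exact: sol|exact: Ly|exact: (Lf n).1|].
    (* As [a (sg n) >= 0], the point 0 lies outside the open support; [y] and [y1] vanish there and
       the boundary condition holds for all [A] and [B]. *)
    have [|-> [-> _]] := supp n 0; first by rewrite ltNge a0.
    by rewrite !mulr0 addr0.
  by apply: aeW => x _; rewrite addrK.
(* The tolerance [c0 / 8] on squared distances leads to [c0 <= 2 * (c0 / 8) + 2 * (c0 / 8)],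
   impossible for [c0 > 0]. *)
have ed : 0 < Num.sqrt (c0 / 8) by rewrite sqrtr_gt0 divr_gt0.
have /cvgrPdist_lt/(_ _ ed)[N _ HN] := cvz.
have close n : (N <= n)%N -> L2norm (fun x => y (phi n) x - z x) ^+ 2 <= c0 / 8.
  move=> Nn; have := HN n Nn; rewrite /= sub0r normrN ger0_norm ?L2norm_ge0// => H.
  rewrite -[leRHS]sqr_sqrtr; last by rewrite divr_ge0// ltW.
  by rewrite lerXn2r ?nnegrE ?L2norm_ge0 ?sqrtr_ge0// ltW.
pose n := phi N; pose m := phi N.+1.
have nm : sg n != sg m by have := ltn_eqF (sg_lt _ _ (phi_inc N)); rewrite /n /m => ->.
have an := a0 (sg n); have ad : a (sg n) <= a (sg n) + d by lra.
have ym0 x : a (sg n) <= x <= a (sg n) + d -> y m x = 0.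
  move=> /andP[nx xn]; have [|//] := supp m x.
  apply/negP => /andP[mx xm].
  have : ([set` `[a (sg n), a (sg n) + h[] `&` [set` `[a (sg m), a (sg m) + h[]) x.
    split; rewrite /= in_itv/=; apply/andP; split => //; [|exact: ltW|].
      by apply: le_lt_trans xn _; rewrite ltrD2l.
    by apply: lt_trans xm _; rewrite ltrD2l.
  by rewrite dis.
have ldz k : lint (fun x => nsq (y k x - z x)) by apply: L2_nsq; exact: L2B.
have Iz k : (N <= k)%N -> I (fun x => nsq (y (phi k) x - z x)) (a (sg n)) (a (sg n) + d) <= c0 / 8.
  move=> Nk; apply: le_trans (close k Nk).
  apply: le_trans (L2_int_le (a (sg n) + d) (L2B (Ly (phi k)) Lz)).
  by rewrite (Ichasles (ldz _) (lexx 0) an ad) lerDr; apply: Ige0 => *; exact: nsq_ge0.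
have l1 := lintZ 2 (ldz n); have l2 := lintZ 2 (ldz m).
have : c0 <= I (fun x => 2 * nsq (y n x - z x) + 2 * nsq (y m x - z x)) (a (sg n)) (a (sg n) + d).
  apply: le_trans (low n) _; apply: Ile => //; first exact: lintD.
  move=> x xD; have := nsqB_le (y n x - z x) (y m x - z x).
  by rewrite (ym0 x xD) sub0r opprK subrK.
rewrite ID// !IZ// => H.
have := Iz N (leqnn N); have := Iz N.+1 (leqnSn N); rewrite -/n -/m => h1 h2.
have H' := lerD (ler_wpM2l (ler0n R 2) h2) (ler_wpM2l (ler0n R 2) h1).
by have := le_trans H H'; lra.
Qed.

End Necessity.

Theorem theorem2 (R : realType) (q : R -> R[i]) (A B : R[i]) :
  L1loc q -> sectorial q -> A != 0 \/ B != 0 ->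
  has_compact_resolvent q A B <-> molchanov q.
Proof.
move=> lq sq AB; have cq : clint q by split => b b0; have [] := lq b b0.
split=> [[lam [_ cmp]]|mq]; first exact: molchanov_of_compact lq cmp.
have [lam [K [K0 [HD HE]]]] := sectorial_coercive cq sq AB.
exists lam; split; last exact: compact_resolvent_of_coercive lq mq K0 HE.
apply: resolvent_point_of_coercive lq K0 AB HD _ => f y y1 M sol Lf Ly bc M0.
apply: le_trans (HE f y y1 M sol Lf Ly bc M0).
rewrite lerDr addr_ge0//; first by apply: Rintegral_ge0 => x _; exact: nsq_ge0.
by apply: Rintegral_ge0 => x _; rewrite mulr_ge0 ?cabs_ge0 ?nsq_ge0.
Qed.
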